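(* Let $T>0$, $\ell>0$. Let $a,f\in C([0,T]\times[-\ell,\ell]\times\mathbb{R}\times\mathbb{R})$ and $b(\cdot,\pm\ell,\cdot,\cdot),\,g(\cdot,\pm\ell,\cdot,\cdot)\in C([0,T]\times\mathbb{R}\times\mathbb{R})$ be real-valued with $a>0$ and $b(\cdot,\pm\ell,\cdot,\cdot)>0$. Let $u^0\in C^{1+\alpha}([-\ell,\ell])$ for some $\alpha\in(0,1)$, with $|u^0(x)-u^0(y)|\le K|x-y|$ for $x,y\in[-\ell,\ell]$. Let $M>0$ and suppose that there are $q_0\ge K$ and $\psi\in C^1([0,\infty),[1,\infty))$ with $$\int_{q_0}^\infty\frac{\rho\,d\rho}{\psi(\rho)}>2M$$ such that $$|f(t,x,z,p)|\le a(t,x,z,p)\,\psi(|p|),\qquad (t,x,z,p)\in\overline{\Omega}_T\times[-M,M]\times\mathbb{R},$$ and such that for all $(t,z)\in(0,T]\times[-M,M]$ and all $p\ge q_0$ $$g(t,\ell,z,p)\le b(t,\ell,z,p)p,\qquad -g(t,\ell,z,-p)\le b(t,\ell,z,-p)p,$$ $$-g(t,-\ell,z,p)\le b(t,-\ell,z,p)p,\qquad g(t,-\ell,z,-p)\le b(t,-\ell,z,-p)p.$$ Then there are numbers $\delta=\delta(M,\alpha)\in(0,\alpha]$ and $C_*=C_*(M,\psi,\langle u^0_x\rangle^{\alpha}_{\Omega})$ such that the following holds: if $u\in C^{1,2}(\overline{\Omega}_\tau)$ is any classical solution on $\Omega_\tau$, with $\tau\le T$, to $$u_t-a(t,x,u,u_x)u_{xx}=f(t,x,u,u_x),\qquad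 (t,x)\in(0,\tau)\times(-\ell,\ell),$$ $$u_t\pm b(t,x,u,u_x)u_x=g(t,x,u,u_x),\qquad t\in(0,\tau),\ x=\pm\ell,$$ subject to $u(0,\cdot)=u^0$ on $[-\ell,\ell]$ and satisfying $|u|_{\Omega_\tau}\le M$, then $$\langle u_x\rangle^{(\frac{\delta}{2},\delta)}_{\Omega_\tau}\le C_*.$$
   Context: $\Omega=(-\ell,\ell)$, $\Omega_\tau=(0,\tau)\times(-\ell,\ell)$ for $\tau>0$; $|v|_{\Omega_\tau}=\sup_{\Omega_\tau}|v|$. The boundary condition with $\pm$ means two conditions, with $+$ at $x=\ell$ and $-$ at $x=-\ell$. $C^{1,2}(\overline{\Omega}_\tau)$ is the space of continuous functions on $\overline{\Omega}_\tau$ with continuous derivatives $u_t,u_{xx}$ on $\overline{\Omega}_\tau$ (similarly $C^{1,2}(\Omega_\tau)$). A classical solution on $\Omega_\tau$ is a function in $C^{1,2}(\Omega_\tau)\cap C(\overline{\Omega}_\tau)$ whose derivatives $u_t(\cdot,\pm\ell)$ and $u_x(\cdot,\pm\ell)$ are defined on $(0,\tau)$ and which satisfies the equation and the boundary conditions pointwise. For an interval $I$ and $\beta\in(0,1)$, $[v]^{(\beta)}_I=\sup_{x\ne y\in I}|v(x)-v(y)|/|x-y|^\beta$; $C^{1+\alpha}([-\ell,\ell])$ is the space of continuously differentiable functions with $\alpha$-Hölder continuous derivative, and $\langle u^0_x\rangle^{\alpha}_{\Omega}$ denotes the Hölder seminorm $[u^0_x]^{(\alpha)}_{\Omega}$.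 For $w:\Omega_\tau\to\mathbb{R}$ and $\delta\in(0,1)$, $$\langle w\rangle^{(\frac{\delta}{2},\delta)}_{\Omega_\tau}=\sup_{x\in\Omega}[w(\cdot,x)]^{(\delta/2)}_{(0,\tau)}+\sup_{t\in(0,\tau)}[w(t,\cdot)]^{(\delta)}_{\Omega}.$$ *)

(* Defs.v *)
From HB Require Import structures.
From mathcomp Require Import all_boot all_order all_algebra.
From mathcomp Require Import all_classical all_reals all_analysis.

Set Implicit Arguments.
Unset Strict Implicit.
Unset Printing Implicit Defensive.

Import Order.TTheory GRing.Theory Num.Theory.
Import numFieldNormedType.Exports.
Local Open Scope classical_set_scope.
Local Open Scope ring_scope.

Section Defs.
Context {R : realType}.
Implicit Types (A I : set R) (D : set (R * R)) (v : R -> R) (u w : R -> R -> R).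

(* Derivative of v at x relative to A: the difference quotient is only taken
   at points of A.  It is the usual derivative when x is interior to A and the
   one-sided derivative when x is an endpoint of an interval A. *)
Definition derivable_within A v (x : R) : Prop :=
  cvg ((v y - v x) / (y - x) @[y --> within A x^']).

Definition derive_within A v (x : R) : R :=
  lim ((v y - v x) / (y - x) @[y --> within A x^']).

Definition C1_on A v : Prop :=
  (forall x, A x -> derivable_within A v x) /\
  {within A, continuous (derive_within A v)}.

(* The supremum is taken in \bar R, so that it is +oo when unbounded. *)
Definition sup_norm D u : \bar R :=
  ereal_sup [set `|u q.1 q.2|%:E | q in D].

Definition holder_seminorm (beta : R) I v : \bar R :=
  ereal_sup [set (`|v q.1 - v q.2| / `|q.1 - q.2| `^ beta)%:E |
              q in [set q : R * R | [/\ I q.1, I q.2 & q.1 != q.2]]].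

Definition C1_holder (alpha l : R) v : Prop :=
  C1_on `[- l, l] v /\
  holder_seminorm alpha `[- l, l] (derive_within `[- l, l] v) \is a fin_num.

Definition open_cyl (tau l : R) : set (R * R) := `]0, tau[ `*` `]- l, l[.
Definition closed_cyl (tau l : R) : set (R * R) := `[0, tau] `*` `[- l, l].

Definition parabolic_seminorm (delta tau l : R) w : \bar R :=
  let time_part := ereal_sup
    [set holder_seminorm (delta / 2) `]0, tau[ (w ^~ x) | x in `]- l, l[] in
  let space_part := ereal_sup
    [set holder_seminorm delta `]- l, l[ (w t) | t in `]0, tau[] in
  (time_part + space_part)%E.

(* Partial derivatives of u on the closed cylinder; one-sided on its sides. *)
Definition dt (tau : R) u (t x : R) : R := derive_within `[0, tau] (u ^~ x) t.
Definition dx (l : R) u (t x : R) : R := derive_within `[- l, l] (u t) x.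
Definition dxx (l : R) u : R -> R -> R := dx l (dx l u).

Definition derivable_t (tau : R) u (t x : R) : Prop :=
  derivable_within `[0, tau] (u ^~ x) t.
Definition derivable_x (l : R) u (t x : R) : Prop :=
  derivable_within `[- l, l] (u t) x.

Definition continuous_on D u : Prop :=
  {within D, continuous (fun q : R * R => u q.1 q.2)}.

(* The space C^{1,2}(D), used for D the open and the closed cylinder. *)
Definition C12_on (tau l : R) D u : Prop :=
  [/\ continuous_on D u,
      forall t x, D (t, x) ->
        [/\ derivable_t tau u t x, derivable_x l u t x
          & derivable_x l (dx l u) t x],
      continuous_on D (dt tau u)
    & continuous_on D (dxx l u)].

Definition continuous_interior (T l : R) (c : R -> R -> R -> R -> R) : Prop :=
  {within [set q : R * R * R * R | closed_cyl T l q.1.1],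
    continuous (fun q : R * R * R * R => c q.1.1.1 q.1.1.2 q.1.2 q.2)}.

Definition continuous_boundary (T x : R) (c : R -> R -> R -> R -> R) : Prop :=
  {within [set q : R * R * R | 0 <= q.1.1 <= T],
    continuous (fun q : R * R * R => c q.1.1 x q.1.2 q.2)}.

Definition classical_solution (tau l : R) (a f b g : R -> R -> R -> R -> R) u
    : Prop :=
  [/\ C12_on tau l (open_cyl tau l) u,
      continuous_on (closed_cyl tau l) u,
      forall t, 0 < t < tau ->
        [/\ derivable_t tau u t l, derivable_t tau u t (- l),
            derivable_x l u t l & derivable_x l u t (- l)],
      forall t x, 0 < t < tau -> - l < x < l ->
        dt tau u t x - a t x (u t x) (dx l u t x) * dxx l u t x
        = f t x (u t x) (dx l u t x)
    & forall t, 0 < t < tau ->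
        dt tau u t l + b t l (u t l) (dx l u t l) * dx l u t l
        = g t l (u t l) (dx l u t l) /\
        dt tau u t (- l)
          - b t (- l) (u t (- l)) (dx l u t (- l)) * dx l u t (- l)
        = g t (- l) (u t (- l)) (dx l u t (- l))].

End Defs.

(* Main.v *)
Require Import Defs.
From HB Require Import structures.
From mathcomp Require Import all_boot all_order all_algebra.
From mathcomp Require Import all_classical all_reals all_analysis.
From mathcomp Require Import ring lra.

Set Implicit Arguments.
Unset Strict Implicit.
Unset Printing Implicit Defensive.

Import Order.TTheory GRing.Theory Num.Theory.
Import numFieldNormedType.Exports.
Local Open Scope classical_set_scope.
Local Open Scope ring_scope.

(* Both bounds on [p = u_x] come from the maximum principle applied to
   [u t x - u t y] as a function of [(t, x, y)] (Kruzhkov's doubling of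
   variables).

   Gradient bound: if [h'' = - psi (h')] with [h'] decreasing from [P] to [q0]
   and [h] reaching [2 M], then [u t x - u t y <= h (x - y)]: at a first
   contact point the equation gives [u_t <= 0] at [x] and [u_t >= 0] at [y], and
   at the end points the conditions on [g] do the same, since the slope there is
   at least [q0].

   Hoelder bound: [u_t] is bounded at the end points, so after odd reflection
   [u] solves [u_t = a u_xx + f] with bounded [f] across them.  If all slopes of
   [u] on a parabolic cylinder lie in [[m, m + om]], then the slope between one
   pair of points is in the upper or in the lower half.  This positivity of
   [u t x - u t y - m (x - y)] (or of its counterpart) is propagated by an
   explicit barrier up to the diagonal [x = y] in a smaller cylinder, so the
   oscillation of [u_x] decays geometrically; near [t = 0] the Hoelder
   continuity of the initial slope plays the role of the pair of points.  The
   rate depends on the ellipticity ratio only.  A first pass yields a modulus of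
   continuity of [u_x]; by uniform continuity of [a] the ratio is then at most 2
   on small cylinders, and a second pass yields an exponent that does not depend
   on [P]. *)

(** * One-sided derivatives and symmetric second derivatives *)

(** The coefficients are merely continuous, so the equation cannot be differentiated to produce one
    for [u_x]. Doubling the variables avoids this: at a contact point the equation is used at [x]
    and at [y] separately, and only the pure second differences in [x] and in [y] occur. The barrier
    argument needs bounds on the coefficients but no regularity. The class of functions it is
    applied to is therefore described pointwise: at each point there are some coefficient within the
    ellipticity bounds and some bounded right-hand side. This class is stable under parabolic
    rescaling, under the flip [x - U] and under odd reflection, whose second derivative in general
    jumps at the end points. Differentiability is weakened accordingly: a left derivative in time
    suffices, since a contact point is compared with earlier times only, and a symmetric second
    derivative in space is what the reflection still has at [l] and [- l]. The exponent has to be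
    fixed before [psi] and [q0], hence before the ellipticity ratio of [a] over the slopes in
    [[- P, P]] is known. *)

Definition lderiv (R : realType) (w : R -> R) (t D : R) : Prop :=
  forall e : R, 0 < e -> exists2 d : R, 0 < d &
    forall s : R, 0 < s < d -> `|w t - w (t - s) - D * s| <= e * s.

(** At a centre of odd symmetry the second difference vanishes identically, so the value 0 is
    assigned even where no second derivative exists; at a minimum it is still nonnegative. *)
Definition sderiv2 (R : realType) (w : R -> R) (x L : R) : Prop :=
  forall e : R, 0 < e -> exists2 d : R, 0 < d &
    forall s : R, 0 < s < d ->
      `|w (x + s) + w (x - s) - 2 * w x - L * s ^+ 2| <= e * s ^+ 2.

Section Calculus.
Context {R : realType}.
Implicit Types (w z : R -> R) (t x D L c : R).

Lemma lderiv_lin w z t D E c :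
  lderiv w t D -> lderiv z t E -> lderiv (fun s => w s + c * z s) t (D + c * E).
Proof.
move=> wD zE e e0.
have c0 : 0 < 2 * (`|c| + 1) by rewrite mulr_gt0// ltr_wpDl.
have [d1 d10 h1] := wD (e / 2) ltac:(lra).
have [d2 d20 h2] := zE (e / (2 * (`|c| + 1))) ltac:(exact: divr_gt0).
exists (Num.min d1 d2) => [|s /andP[s0]]; first by rewrite lt_min d10.
rewrite lt_min => /andP[s1 s2].
have {}h1 := h1 s ltac:(by rewrite s0).
have {}h2 := h2 s ltac:(by rewrite s0).
rewrite (_ : _ - _ = (w t - w (t - s) - D * s) + c * (z t - z (t - s) - E * s));
  last by ring.
apply: (le_trans (ler_normD _ _)); rewrite normrM.
have : `|c| * `|z t - z (t - s) - E * s| <= e / 2 * s.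
  apply: (le_trans (ler_wpM2l _ h2)) => //.
  rewrite mulrA ler_wpM2r ?(ltW s0)// mulrA ler_pdivrMr//; lra.
lra.
Qed.

Lemma sderiv2_lin w z x L E c :
  sderiv2 w x L -> sderiv2 z x E ->
  sderiv2 (fun s => w s + c * z s) x (L + c * E).
Proof.
move=> wD zE e e0.
have c0 : 0 < 2 * (`|c| + 1) by rewrite mulr_gt0// ltr_wpDl.
have [d1 d10 h1] := wD (e / 2) ltac:(lra).
have [d2 d20 h2] := zE (e / (2 * (`|c| + 1))) ltac:(exact: divr_gt0).
exists (Num.min d1 d2) => [|s /andP[s0]]; first by rewrite lt_min d10.
rewrite lt_min => /andP[s1 s2].
have {}h1 := h1 s ltac:(by rewrite s0).
have {}h2 := h2 s ltac:(by rewrite s0).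
rewrite (_ : _ - _ = (w (x + s) + w (x - s) - 2 * w x - L * s ^+ 2) +
  c * (z (x + s) + z (x - s) - 2 * z x - E * s ^+ 2)); last by ring.
apply: (le_trans (ler_normD _ _)); rewrite normrM.
have : `|c| * `|z (x + s) + z (x - s) - 2 * z x - E * s ^+ 2|
    <= e / 2 * s ^+ 2.
  apply: (le_trans (ler_wpM2l _ h2)) => //.
  rewrite mulrA ler_wpM2r ?sqr_ge0// mulrA ler_pdivrMr//; lra.
lra.
Qed.

Lemma lderiv_ge0 w t D (d : R) : 0 < d -> lderiv w t D ->
  (forall s : R, 0 < s < d -> w (t - s) <= w t) -> 0 <= D.
Proof.
move=> d0 wD h; rewrite leNgt; apply/negP => D0.
have [d1 d10 h1] := wD (- D / 2) ltac:(lra).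
pose s := Num.min d d1 / 2.
have m0 : 0 < Num.min d d1 by rewrite lt_min d0.
have s0 : 0 < s by rewrite /s; lra.
have [sd sd1] : s < d /\ s < d1.
  have : s < Num.min d d1 by rewrite /s; lra.
  by rewrite lt_min => /andP[].
have := h s ltac:(by rewrite s0); have := h1 s ltac:(by rewrite s0).
rewrite ler_norml => /andP[_]; have : D * s < 0 by rewrite nmulr_rlt0.
lra.
Qed.

Lemma sderiv2_ge0 w x L (d : R) : 0 < d -> sderiv2 w x L ->
  (forall s : R, 0 < s < d -> w x <= w (x + s) /\ w x <= w (x - s)) -> 0 <= L.
Proof.
move=> d0 wD h; rewrite leNgt; apply/negP => D0.
have [d1 d10 h1] := wD (- L / 2) ltac:(lra).
pose s := Num.min d d1 / 2.
have m0 : 0 < Num.min d d1 by rewrite lt_min d0.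
have s0 : 0 < s by rewrite /s; lra.
have [sd sd1] : s < d /\ s < d1.
  have : s < Num.min d d1 by rewrite /s; lra.
  by rewrite lt_min => /andP[].
have [] := h s ltac:(by rewrite s0); have := h1 s ltac:(by rewrite s0).
rewrite ler_norml => /andP[_].
have : L * s ^+ 2 < 0 by rewrite nmulr_rlt0// exprn_gt0.
lra.
Qed.

(** The barrier is a polynomial of degree five in each space variable, so its symmetric second
    difference is a quadratic term plus a quartic one, and the latter is o(s^2). *)
Lemma sderiv2_poly w x L Q :
  (forall s, w (x + s) + w (x - s) - 2 * w x = L * s ^+ 2 + Q * s ^+ 4) ->
  sderiv2 w x L.
Proof.
move=> h e e0.
have Q0 : 0 < `|Q| + 1 by rewrite ltr_wpDl.
exists (Num.min 1 (e / (`|Q| + 1))) => [|s /andP[s0]].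
  by rewrite lt_min ltr01 divr_gt0.
rewrite lt_min => /andP[s1 se]; rewrite h.
rewrite (_ : _ - _ = Q * s ^+ 2 * s ^+ 2); last by ring.
rewrite normrM (ger0_norm (sqr_ge0 s)) normrM (ger0_norm (sqr_ge0 s)).
rewrite ler_wpM2r ?sqr_ge0//.
apply: (@le_trans _ _ (`|Q| * s)).
  by rewrite ler_wpM2l// expr2 ger_pMl// ltW.
apply: (@le_trans _ _ ((`|Q| + 1) * (e / (`|Q| + 1)))).
  by apply: ler_pM => //; [exact: ltW|lra|exact: ltW].
by rewrite mulrC divfK// gt_eqF.
Qed.

Lemma is_derive_lderiv w t D : is_derive t 1 w D -> lderiv w t D.
Proof.
case=> dw wD e e0.
have /cvgrPdist_le /(_ e e0) : h^-1 *: (w (h *: 1 + t) - w t) @[h --> 0^']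
  --> D.
  by rewrite -wD; exact: dw.
move=> /nbhs_ballP[d /= d0 h]; exists d => // s /andP[s0 sd].
have bs : ball (0 : R) d (- s).
  by rewrite /ball/= sub0r opprK gtr0_norm.
have := h (- s) bs ltac:(by rewrite oppr_eq0 gt_eqF).
rewrite /GRing.scale/= mulr1 [- s + t]addrC => k.
rewrite (_ : _ - _ = (D - (- s)^-1 * (w (t - s) - w t)) * (- s)).
  by rewrite normrM normrN (gtr0_norm s0) ler_wpM2r// ltW.
by field; rewrite gt_eqF.
Qed.

(* The first derivative [p] need only be controlled near [x] through its own
   derivative at [x]: the mean value theorem is applied to
   [s |-> w (x + s) + w (x - s) - L s ^ 2], whose derivative is o(s). *)
Lemma is_derive_sderiv2 w (p : R -> R) x L (r : R) : 0 < r ->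
  (forall y : R, `|y - x| < r -> is_derive y 1 w (p y)) ->
  (forall e : R, 0 < e -> exists2 d : R, 0 < d & forall y : R, `|y - x| < d ->
     `|p y - p x - L * (y - x)| <= e * `|y - x|) ->
  sderiv2 w x L.
Proof.
move=> r0 wp pL e e0.
have [d d0 h] := pL (e / 2) ltac:(lra).
exists (Num.min r d) => [|s /andP[s0]]; first by rewrite lt_min r0.
rewrite lt_min => /andP[sr sd].
pose G := fun y => w (x + y) + w (x - y) - L * y ^+ 2.
pose dG := fun y => p (x + y) - p (x - y) - 2 * L * y.
have GdG (y : R) : `|y| < r -> is_derive y 1 G (dG y).
  move=> yr.
  have D1 : is_derive (x + y) 1 w (p (x + y)) by apply: wp; rewrite addrC addKr.
  have D2 : is_derive (x - y) 1 w (p (x - y)).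
    by apply: wp; rewrite addrAC subrr sub0r normrN.
  have E1 : is_derive y (1 : R) (cst x + @id R) (1 : R).
    by apply: is_derive_eq; rewrite add0r.
  have E2 : is_derive y (1 : R) (cst x - @id R) (-1 : R).
    by apply: is_derive_eq; rewrite add0r.
  have C1 : is_derive (y : R) (1 : R) (w \o (cst x + @id R)) (p (x + y) * 1).
    exact: (@is_derive1_comp _ w).
  have C2 : is_derive (y : R) (1 : R) (w \o (cst x - @id R)) (p (x - y) * -1).
    exact: (@is_derive1_comp _ w).
  have -> : G = (w \o (cst x + @id R)) + (w \o (cst x - @id R))
    - L \*: (fun y => y ^+ 2).
    by [].
  apply: is_derive_eq; rewrite /dG /GRing.scale/=; ring.
have [||c cs GE] := @MVT R G dG 0 s s0.
- move=> y; rewrite in_itv/= => /andP[y0 ys]; apply: GdG.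
  by rewrite gtr0_norm//; exact: lt_trans sr.
- apply: derivable_within_continuous => y; rewrite in_itv/= => /andP[y0 ys].
  have /GdG[] // : `|y| < r by rewrite ger0_norm//; exact: le_lt_trans sr.
move: cs; rewrite in_itv/= => /andP[c0 cs].
have k1 := h (x + c); have k2 := h (x - c).
rewrite addrAC subrr add0r gtr0_norm// in k1.
rewrite addrAC subrr add0r normrN gtr0_norm// in k2.
have {}k1 := k1 (lt_trans cs sd); have {}k2 := k2 (lt_trans cs sd).
have -> : w (x + s) + w (x - s) - 2 * w x - L * s ^+ 2 = G s - G 0.
  by rewrite /G addr0 subr0; ring.
rewrite GE subr0 normrM (gtr0_norm s0) expr2 mulrA ler_wpM2r ?(ltW s0)//.
have -> : dG c = (p (x + c) - p x - L * c) - (p (x - c) - p x - L * - c).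
  by rewrite /dG; ring.
apply: (le_trans (ler_normB _ _)).
have : e * c <= e * s by rewrite ler_pM2l// ltW.
lra.
Qed.

Lemma sderiv2_min w z x L E (d : R) : 0 < d -> sderiv2 w x L -> sderiv2 z x E ->
  (forall s, `|s| < d -> w x - z x <= w (x + s) - z (x + s)) -> E <= L.
Proof.
move=> d0 wL zE h; rewrite -subr_ge0 -mulN1r.
apply: (sderiv2_ge0 d0 (sderiv2_lin (-1) wL zE)) => s /andP[s0 sd].
have h1 := h s; have h2 := h (- s); rewrite normrN in h2.
rewrite gtr0_norm// in h1 h2; move: (h1 sd) (h2 sd); split; lra.
Qed.

Lemma lderiv_min w z t D E (d : R) : 0 < d -> lderiv w t D -> lderiv z t E ->
  (forall s : R, 0 < s < d -> w t - z t <= w (t - s) - z (t - s)) -> D <= E.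
Proof.
move=> d0 wD zE h; rewrite -subr_ge0 -mulN1r.
apply: (lderiv_ge0 d0 (lderiv_lin (-1) zE wD)) => s sd.
move: (h s sd); lra.
Qed.

(** Compactness of a box cut by two closed conditions. With [G] and [H] arbitrary, one statement
    serves the region [y <= x] under the barrier, the strip [0 <= x - y <= kap] of the gradient
    bound and, with constant constraints, the time modulus. *)
Lemma constrained_min (F G H : R * R * R -> R) (a b c d e f : R) :
  continuous F -> continuous G -> continuous H ->
  let K := [set q : R * R * R | [/\ a <= q.1.1 <= b, c <= q.1.2 <= d,
              e <= q.2 <= f, 0 <= G q & 0 <= H q]] in
  K !=set0 -> exists2 q, K q & forall q', K q' -> F q <= F q'.
Proof.
move=> cF cG cH K K0.
have cK : compact K.
  pose B := (`[a, b] `*` `[c, d]) `*` `[e, f] : set (R * R * R).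
  have cB : compact B by do !apply: compact_setX => //; exact: segment_compact.
  have -> : K = B `&` (G @^-1` [set x | 0 <= x] `&` H @^-1` [set x | 0 <= x]).
    apply/seteqP; split=> q; rewrite /K /B/= !in_itv/=.
      by move=> [-> -> -> -> ->].
    by move=> [[[-> ->] ->] [-> ->]].
  apply: compact_closedI => //; apply: closedI;
    by apply: preimage_closed => //; exact: closed_ge.
have [q /set_mem Kq h] := compact_EVT_min K0 cK (continuous_subspaceT cF).
by exists q => // q' Kq'; apply: h; exact: mem_set.
Qed.

End Calculus.

(** * The barrier *)

(** [a] and [f] are quantified at each point: the dependence of the coefficients on [u] and [u_x] is
    forgotten and only their bounds survive. *)
Definition parabolic_at (R : realType) (U : R -> R -> R) (lam Lam F t x : R)
    : Prop :=
  exists D L a f : R, [/\ lderiv (U ^~ x) t D, sderiv2 (U t) x L,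
    lam <= a <= Lam, `|f| <= F & D = a * L + f].

(** Bounds on [u_x] in integrated form: they involve no derivative, pass to rescaled and reflected
    functions by adding increments, and are what doubling of variables produces. *)
Definition slopes (R : realType) (U : R -> R -> R) (s t lo hi m M : R) : Prop :=
  forall th y x : R, s <= th <= t -> lo <= y -> y <= x -> x <= hi ->
    m * (x - y) <= U th x - U th y <= M * (x - y).

Section Barrier.
Context {R : realType}.

Lemma normr_le_sqr (x c : R) : 0 <= c -> x ^+ 2 <= c ^+ 2 -> `|x| <= c.
Proof.
by move=> c0; rewrite -(real_normK (num_real x)) ler_pXn2r ?nnegrE.
Qed.

(* The barrier is [d (E S ^ 2 - eps (2 - d))] with [d = x - y],
  [E = exp (- mu t)]
   and [S = g - X ^ 2 - Y ^ 2], where [X = x - 1/4] and [Y = y + 1/4].  Near the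
   diagonal [X < 0 < Y], so the first order terms created by the factor [d] have
   the right sign; away from it the rate [mu] absorbs them.  The term in [eps]
   absorbs the right-hand side. *)
Lemma barrier_ineq (kap g0 g1 g mu E S X Y d a1 a2 eps : R) :
  1 <= kap -> 0 < g0 -> 0 <= g1 <= 1 -> g0 <= g <= 9 / 64 ->
  (49 * kap ^+ 2) ^+ 2 <= mu * g0 ->
  S = g - X ^+ 2 - Y ^+ 2 -> d = X - Y + 1 / 2 -> 0 < S -> 0 < d -> 0 < E ->
  1 <= a1 <= kap -> 1 <= a2 <= kap -> 0 < eps ->
  E * (d * (- mu * S ^+ 2 + 2 * S * g1)) <
    a1 * (E * (- 8 * S * X + d * (8 * X ^+ 2 - 4 * S)) + 2 * eps) +
    a2 * (E * (8 * S * Y + d * (8 * Y ^+ 2 - 4 * S)) + 2 * eps) - 2 * eps.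
Proof.
move=> kap1 g00 /andP[g10 g11] /andP[gg0 g9] hmu SE dE S0 d0 E0 /andP[a11 a1k]
  /andP[a21 a2k] eps0.
have X20 : 0 <= X ^+ 2 by exact: sqr_ge0.
have Y20 : 0 <= Y ^+ 2 by exact: sqr_ge0.
(* The terms in [eps] add up to [2 * eps * (a1 + a2 - 1) > 0], the source of strictness; everything
   else carries the common factor [E]. *)
suff core : d * (- mu * S ^+ 2 + 2 * S * g1) <=
    8 * S * (a2 * Y - a1 * X) + 8 * d * (a1 * X ^+ 2 + a2 * Y ^+ 2)
    - 4 * d * S * (a1 + a2).
  have {}core : E * (d * (- mu * S ^+ 2 + 2 * S * g1)) <=
    E * (8 * S * (a2 * Y - a1 * X) + 8 * d * (a1 * X ^+ 2 + a2 * Y ^+ 2)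
    - 4 * d * S * (a1 + a2)) by rewrite ler_pM2l.
  apply: (le_lt_trans core).
  rewrite -subr_gt0 (_ : _ - _ = 2 * eps * (a1 + a2 - 1)); last by ring.
  by rewrite !mulr_gt0//; lra.
have dS0 : 0 < d * S by rewrite mulr_gt0.
have daX : d * X ^+ 2 <= d * (a1 * X ^+ 2).
  by rewrite ler_pM2l// ler_peMl.
have daY : d * Y ^+ 2 <= d * (a2 * Y ^+ 2).
  by rewrite ler_pM2l// ler_peMl.
have dX20 : 0 <= d * X ^+ 2 by rewrite mulr_ge0// ltW.
have dY20 : 0 <= d * Y ^+ 2 by rewrite mulr_ge0// ltW.
have t1 : d * S * g1 <= d * S by rewrite ger_pMr.
have t2 : d * S * a1 <= d * S * kap by rewrite ler_pM2l.
have t3 : d * S * a2 <= d * S * kap by rewrite ler_pM2l.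
have t4 : d * S <= d * S * kap by rewrite ler_peMr// ltW.
have mu0 : 0 < mu.
  have : 0 < mu * g0.
    by apply: lt_le_trans hmu; rewrite exprn_gt0// mulr_gt0// exprn_gt0//; lra.
  by rewrite pmulr_lgt0.
have [dk|dk] := leP (32 * kap * d) 1.
  have d32 : 32 * d <= 1.
    by apply: le_trans dk; rewrite ler_wpM2r ?(ltW d0)//; lra.
  (* [S > 0] forces [X ^ 2 + Y ^ 2 < (3 / 8) ^ 2]. With [d <= 1 / 32], an [X] above [- 1 / 16] would
     push [Y] beyond [13 / 32 > 3 / 8]. *)
  have Xle : X <= - 1 / 16.
    rewrite leNgt; apply/negP => hX.
    have : 13 / 32 < Y by lra.
    move=> hY; have : (13 / 32) ^+ 2 <= Y ^+ 2 :> R.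
      by rewrite lerXn2r ?nnegrE//; lra.
    lra.
  have Yge : 1 / 16 <= Y.
    rewrite leNgt; apply/negP => hY.
    have : 13 / 32 < - X by lra.
    move=> hX; have : (13 / 32) ^+ 2 <= (- X) ^+ 2 :> R.
      by rewrite lerXn2r ?nnegrE//; lra.
    rewrite sqrrN; lra.
  have u1 : 1 / 16 <= a2 * Y by apply: (le_trans Yge); rewrite ler_peMl//; lra.
  have u2 : 1 / 16 <= a1 * - X.
    by apply: (@le_trans _ _ (- X)); [lra|rewrite ler_peMl//; lra].
  have u3 : S * (1 / 8) <= S * (a2 * Y - a1 * X) by rewrite ler_pM2l//; lra.
  have u4 : d * S * kap <= S * (1 / 32).
    by rewrite [d * S]mulrC -mulrA ler_pM2l//; lra.
  have : 0 <= d * (mu * S ^+ 2).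
    by rewrite !mulr_ge0// ?sqr_ge0// ltW.
  lra.
(* Away from the diagonal [a2 * Y - a1 * X] may be negative, but it is at least [- kap], and
   [1 < 32 * kap * d] turns this loss into a multiple of [d * S]. *)
have Xle : `|X| <= 3 / 8.
  by apply: normr_le_sqr; lra.
have Yle : `|Y| <= 3 / 8.
  by apply: normr_le_sqr; lra.
have u1 : - kap <= a2 * Y - a1 * X.
  have : `|a2 * Y| <= kap * (3 / 8).
    by rewrite normrM; apply: ler_pM => //; rewrite ger0_norm//; lra.
  have : `|a1 * X| <= kap * (3 / 8).
    by rewrite normrM; apply: ler_pM => //; rewrite ger0_norm//; lra.
  by rewrite !ler_norml => /andP[_ ?] /andP[? _]; lra.
have u2 : - (32 * kap ^+ 2 * (d * S)) <= S * (a2 * Y - a1 * X).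
  apply: (@le_trans _ _ (S * - kap)); last by rewrite ler_pM2l.
  rewrite (_ : _ * (d * S) = S * (kap * (32 * kap * d))); last by ring.
  rewrite mulrN lerN2 ler_pM2l// ler_pMr; first exact: ltW.
  lra.
have k2 : kap <= kap ^+ 2 by rewrite expr2 ler_pMr//; lra.
have k12 : 1 <= kap ^+ 2 by lra.
have t5 : d * S * kap <= d * S * kap ^+ 2 by rewrite ler_pM2l.
(* 274 = 256 + 8 + 8 + 2 collects the first order terms, those in [a1 + a2], the replacement of
   [X ^ 2 + Y ^ 2] by [g - S], and the growth of [g]. Completing the square needs
   [137 ^ 2 <= 8 * 49 ^ 2], which explains the 49 in the condition on [mu]. *)
have q0 : 0 <= mu * S ^+ 2 - 274 * kap ^+ 2 * S + 8 * g0.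
  rewrite -(pmulr_lge0 _ mu0) (_ : _ * mu =
    (mu * S - 137 * kap ^+ 2) ^+ 2 + (8 * (mu * g0) - (137 * kap ^+ 2) ^+ 2));
    last by ring.
  rewrite addr_ge0 ?sqr_ge0//.
  have : 0 <= kap ^+ 4 by rewrite exprn_ge0//; lra.
  lra.
have {}q0 : 0 <= d * (mu * S ^+ 2 - 274 * kap ^+ 2 * S + 8 * g0).
  by rewrite mulr_ge0// ltW.
have u5 : d * g0 <= d * S + d * X ^+ 2 + d * Y ^+ 2.
  by rewrite -!mulrDr ler_pM2l//; lra.
lra.
Qed.

End Barrier.

(** * Comparison of the doubled solution with the barrier *)

Section Comparison.
Context {R : realType}.

Lemma contB (T : topologicalType) (f g : T -> R) :
  continuous f -> continuous g -> continuous (fun x => f x - g x).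
Proof. by move=> cf cg x; apply: continuousB; [exact: cf|exact: cg]. Qed.

Lemma contD (T : topologicalType) (f g : T -> R) :
  continuous f -> continuous g -> continuous (fun x => f x + g x).
Proof. by move=> cf cg x; apply: continuousD; [exact: cf|exact: cg]. Qed.

Lemma contM (T : topologicalType) (f g : T -> R) :
  continuous f -> continuous g -> continuous (fun x => f x * g x).
Proof. by move=> cf cg x; apply: continuousM; [exact: cf|exact: cg]. Qed.

Lemma cont_comp (T U V : topologicalType) (g : U -> V) (f : T -> U) :
  continuous g -> continuous f -> continuous (fun x => g (f x)).
Proof. by move=> cg cf x; apply: (@continuous_comp _ _ _ f g);
  [exact: cf|exact: cg]. Qed.

Lemma cont_uncurry (T : topologicalType) (U : R -> R -> R) (f g : T -> R) :
  continuous (fun q : R * R => U q.1 q.2) -> continuous f -> continuous g ->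
  continuous (fun x => U (f x) (g x)).
Proof.
move=> cU cf cg; apply: (@cont_comp _ _ _ (fun q : R * R => U q.1 q.2)
  (fun x => (f x, g x))) => // x; exact: (cvg_pair (cf x) (cg x)).
Qed.

Lemma is_derive_barrier (mu g0 g1 Q d e t : R) :
  is_derive t 1
    (fun s => d * (expR (- mu * s) * (g0 + g1 * s - Q) ^+ 2 - e * (2 - d)))
    (expR (- mu * t) * (d * (- mu * (g0 + g1 * t - Q) ^+ 2 +
       2 * (g0 + g1 * t - Q) * g1))).
Proof.
pose E := (fun s : R => expR (- mu * s)).
have dE : is_derive t 1 E (expR (- mu * t) * - mu).
  have -> : E = expR \o (- mu \*: @id R) by [].
  apply: (@is_derive1_comp _ expR); apply: is_derive_eq.
  by rewrite /GRing.scale/= mulr1.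
pose G := fun s : R => g0 + g1 * s - Q.
have dG : is_derive t 1 G g1.
  have -> : G = cst (g0 - Q) + (g1 \*: @id R).
    by apply/funext => s; rewrite /G fctE/= /GRing.scale/=; ring.
  by apply: is_derive_eq; rewrite add0r /GRing.scale/= mulr1.
have -> : (fun s => d * (expR (- mu * s) * (g0 + g1 * s - Q)
  ^+ 2 - e * (2 - d)))
    = (d \*: (E * (G * G) - cst (e * (2 - d)))) by [].
apply: is_derive_eq.
rewrite subr0 /GRing.scale/= /G /E mulrfctE; ring.
Qed.

(** Minimum of [U t x - U t y - phi] over [x >= y], [S >= 0]: where [x = y] or [S = 0] the barrier
    is at most 0, below the nonnegative increment of [U]; at time 0 the initial condition applies. A
    negative minimum is thus attained inside and contradicts the strict inequality [barrier_ineq].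
    The disc [S >= 0] keeps [x] and [y] away from 1 and -1, so no lateral condition is required. *)
Lemma barrier_comparison (U : R -> R -> R) (kap T1 g0 g1 mu eps : R) :
  1 <= kap -> 0 < g0 -> 0 <= g1 <= 1 -> g0 + g1 * T1 <= 9 / 64 ->
  (49 * kap ^+ 2) ^+ 2 <= mu * g0 -> 0 < eps ->
  continuous (fun q : R * R => U q.1 q.2) ->
  (forall t y x, 0 <= t <= T1 -> - 1 <= y -> y <= x -> x <= 1 ->
     U t y <= U t x) ->
  (forall t x, 0 < t <= T1 -> - 1 < x < 1 -> parabolic_at U 1 kap eps t x) ->
  (forall y x, - 1 <= y -> y <= x -> x <= 1 ->
     let S := g0 - (x - 1 / 4) ^+ 2 - (y + 1 / 4) ^+ 2 in
     0 <= S -> (x - y) * S ^+ 2 <= U 0 x - U 0 y) ->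
  forall t y x, 0 <= t <= T1 -> - 1 <= y -> y <= x -> x <= 1 ->
    let S := g0 + g1 * t - (x - 1 / 4) ^+ 2 - (y + 1 / 4) ^+ 2 in
    0 <= S ->
    (x - y) * (expR (- mu * t) * S ^+ 2 - eps * (2 - (x - y))) <=
      U t x - U t y.
Proof.
move=> kap1 g00 g1b gT hmu eps0 cU mono eqU init t' y' x' t'b y'1 yx' x'1 S0
  S0p.
pose S (q : R * R * R) :=
  g0 + g1 * q.1.1 - (q.1.2 - 1 / 4) ^+ 2 - (q.2 + 1 / 4) ^+ 2.
pose phi (q : R * R * R) := (q.1.2 - q.2) *
  (expR (- mu * q.1.1) * S q ^+ 2 - eps * (2 - (q.1.2 - q.2))).
pose F (q : R * R * R) := U q.1.1 q.1.2 - U q.1.1 q.2 - phi q.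
have c11 : continuous (fun q : R * R * R => q.1.1).
  by move=> q; apply: continuous_comp; exact: cvg_fst.
have c12 : continuous (fun q : R * R * R => q.1.2).
  by move=> q; apply: continuous_comp; [exact: cvg_fst|exact: cvg_snd].
have c2 : continuous (fun q : R * R * R => q.2).
  by move=> q; exact: cvg_snd.
have csq : continuous (fun x : R => x ^+ 2) by exact: exprn_continuous.
have cS : continuous S.
  rewrite /S; apply: contB; first apply: contB.
  - apply: contD; first exact: cst_continuous.
    by apply: contM => //; exact: cst_continuous.
  - apply: (cont_comp csq (f := fun q : R * R * R => q.1.2 - 1 / 4)).
    by apply: contB => //; exact: cst_continuous.
  - apply: (cont_comp csq (f := fun q : R * R * R => q.2 + 1 / 4)).
    by apply: contD => //; exact: cst_continuous.
have cd : continuous (fun q : R * R * R => q.1.2 - q.2) by exact: contB.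
have cF : continuous F.
  rewrite /F /phi; apply: contB; first by apply: contB; exact: cont_uncurry.
  apply: contM => //; apply: contB.
    apply: contM; last exact: (cont_comp csq).
    apply: (cont_comp (@continuous_expR R) (f := fun q : R * R * R =>
      - mu * q.1.1)).
    apply: contM => //.
    exact: cst_continuous.
  by apply: contM; [|apply: contB => //]; exact: cst_continuous.
rewrite leNgt; apply/negP => neg.
have [] := @constrained_min R F (fun q =>
  q.1.2 - q.2) S 0 T1 (-1) 1 (-1) 1 cF cd cS.
  exists (t', x', y'); split => //=; rewrite ?y'1 ?x'1 ?subr_ge0 ?andbT//.
  - exact: le_trans yx'.
  - exact: le_trans x'1.
move=> [[t x] y] /= [t01 xb yb]; rewrite subr_ge0 => yx SK minq.
have {neg} : F (t, x, y) < 0.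
  apply: (@le_lt_trans _ _ (F (t', x', y'))).
    apply: minq; split => //=; rewrite ?y'1 ?x'1 ?subr_ge0 ?andbT//.
    - exact: le_trans yx'.
    - exact: le_trans x'1.
  by rewrite /F /phi/= subr_lt0.
rewrite /F/= subr_lt0 => neg.
have /andP[x1 x2] := xb; have /andP[y1 y2] := yb; have /andP[t0 tT] := t01.
have Sle : S (t, x, y) <= 9 / 64 - (x - 1 / 4) ^+ 2 - (y + 1 / 4) ^+ 2.
  rewrite /S/= !lerD2r; apply: le_trans gT; rewrite lerD2l ler_wpM2l//.
  by case/andP: g1b.
have Z0 : U t y <= U t x by apply: mono.
have d0 : 0 < x - y.
  rewrite subr_gt0 lt_neqAle yx andbT; apply/eqP => xyE.
  by move: neg; rewrite /phi/= xyE !subrr mul0r ltxx.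
have e2 : 0 <= (x - y) * (eps * (2 - (x - y))).
  by rewrite !mulr_ge0 ?(ltW d0) ?(ltW eps0)//; clear -x2 y1; lra.
have Sp : 0 < S (t, x, y).
  rewrite lt_neqAle SK andbT; apply/eqP => SE.
  move: neg; rewrite /phi/= -SE expr0n/= mulr0 sub0r => neg.
  have := e2; clear -neg Z0; lra.
have tp : 0 < t.
  rewrite lt_neqAle t0 andbT; apply/eqP => tE.
  have S0E : S (t, x, y) = g0 - (x - 1 / 4) ^+ 2 - (y + 1 / 4) ^+ 2.
    by rewrite /S/= -tE mulr0 addr0.
  have := init y x y1 yx x2; rewrite /= -S0E => /(_ SK).
  move: neg; rewrite /phi/= -tE mulr0 expR0 mul1r tE.
  have := e2; clear; lra.
have sx : 0 <= (x - 1 / 4) ^+ 2 by exact: sqr_ge0.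
have sy : 0 <= (y + 1 / 4) ^+ 2 by exact: sqr_ge0.
have : `|x - 1 / 4| <= 3 / 8 by apply: normr_le_sqr; clear -Sle SK sx sy; lra.
rewrite ler_norml => /andP[X1 X2].
have : `|y + 1 / 4| <= 3 / 8 by apply: normr_le_sqr; clear -Sle SK sx sy; lra.
rewrite ler_norml => /andP[Y1 Y2].
have [Dx [Lx [a1 [f1 [hDx hLx a1b f1b eqx]]]]] :
  parabolic_at U 1 kap eps t x by apply: eqU; [rewrite tp|clear -X1 X2; lra].
have [Dy [Ly [a2 [f2 [hDy hLy a2b f2b eqy]]]]] :
  parabolic_at U 1 kap eps t y by apply: eqU; [rewrite tp|clear -Y1 Y2; lra].
pose X := x - 1 / 4; pose Y := y + 1 / 4; pose d := x - y.
pose E := expR (- mu * t); pose s := S (t, x, y).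
(* [1 / 4] keeps the varied point in []-1, 1[] and gives [|2 * X + h| <= 1], so [S] changes by at
   most [|h|]; [s / 2] then keeps [S] nonnegative, and [d] keeps the two points in order. *)
pose r := Num.min (1 / 4) (Num.min (s / 2) d).
have r0 : 0 < r by rewrite !lt_min; apply/andP; split; [clear;
  lra|rewrite d0 andbT divr_gt0].
have rP : forall z : R, `|z| < r -> [/\ `|z| < 1 / 4, `|z| < s / 2 & `|z| < d].
  by move=> z; rewrite /r !lt_min => /andP[? /andP[? ?]]; split.
pose Q := (x - 1 / 4) ^+ 2 + (y + 1 / 4) ^+ 2.
have QE (A : R) : A - (x - 1 / 4) ^+ 2 - (y + 1 / 4) ^+ 2 = A - Q.
  by rewrite /Q opprD addrA.
have hT : lderiv (fun th => phi (th, x, y)) t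
    (E * (d * (- mu * s ^+ 2 + 2 * s * g1))).
  have -> : (fun th => phi (th, x, y)) = (fun th => d *
      (expR (- mu * th) * (g0 + g1 * th - Q) ^+ 2 - eps * (2 - d))).
    by apply/funext => th; rewrite /phi /S/= QE.
  have -> : s = g0 + g1 * t - Q by rewrite /s /S/= QE.
  exact: is_derive_lderiv (is_derive_barrier _ _ _ _ _ _ _).
have hX : sderiv2 (fun z => phi (t, z, y)) x
    (E * (- 8 * s * X + d * (8 * X ^+ 2 - 4 * s)) + 2 * eps).
  apply: (@sderiv2_poly _ _ _ _ (E * (8 * X + 2 * d))) => z.
  by rewrite /phi /S/= -/E /s /S/= /X /d; ring.
have hY : sderiv2 (fun z => phi (t, x, z)) y
    (E * (8 * s * Y + d * (8 * Y ^+ 2 - 4 * s)) + 2 * eps).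
  apply: (@sderiv2_poly _ _ _ _ (E * (- 8 * Y + 2 * d))) => z.
  by rewrite /phi /S/= -/E /s /S/= /Y /d; ring.
have tst : Dx - Dy <= E * (d * (- mu * s ^+ 2 + 2 * s * g1)).
  have hD := lderiv_lin (-1) hDx hDy; rewrite mulN1r in hD.
  (* Going back in time by [h] lowers [S] by [g1 * h <= h], so [h < s] stays in the region. *)
  have m0 : 0 < Num.min t s by rewrite lt_min tp.
  apply: (lderiv_min m0 hD hT) => h /andP[h0]; rewrite lt_min => /andP[ht hs].
  have /= := minq (t - h, x, y); rewrite /F/=.
  have sE : S (t - h, x, y) = s - g1 * h by rewrite /s /S/=; ring.
  have gh : g1 * h <= h by case/andP: g1b => ? ?; rewrite ger_pMl.
  have k : [/\ 0 <= t - h <= T1, -1 <= x <= 1, -1 <= y <= 1, 0 <= x - y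
      & 0 <= S (t - h, x, y)].
    rewrite sE; split => //; last 2 first.
    - exact: ltW.
    - by clear -gh hs; lra.
    by clear -h0 ht tT; lra.
  by move/(_ k); clear; lra.
have tsx : E * (- 8 * s * X + d * (8 * X ^+ 2 - 4 * s)) + 2 * eps <= Lx.
  apply: (sderiv2_min r0 hLx hX) => h /rP[h1 h2 h3].
  have /= := minq (t, x + h, y); rewrite /F/=.
  move: h1 h2 h3; rewrite !ltr_norml =>
    /andP[h1 h1'] /andP[h2 h2'] /andP[h3 h3'].
  have sE : S (t, x + h, y) = s - h * (2 * X + h).
    by rewrite /s /S /X/=; ring.
  have hh : `|h * (2 * X + h)| <= `|h| * 1.
    by rewrite normrM ler_wpM2l// ler_norml /X; clear -h1 h1' X1 X2; lra.
  have {}hh : h * (2 * X + h) <= s.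
    apply: (le_trans (ler_norm _)); apply: (le_trans hh); rewrite mulr1.
    by rewrite ler_norml; clear -h2 h2'; lra.
  rewrite /d in h3.
  have k : [/\ 0 <= t <= T1, -1 <= x + h <= 1, -1 <= y <= 1, 0 <= x + h - y
      & 0 <= S (t, x + h, y)].
    rewrite sE; split => //; last by clear -hh; lra.
    - by clear -h1 h1' X1 X2; lra.
    - by clear -h3; lra.
  by move/(_ k); clear; lra.
have tsy : E * (8 * s * Y + d * (8 * Y ^+ 2 - 4 * s)) + 2 * eps <= - Ly.
  have hLy' := sderiv2_lin (-1) (sderiv2_poly (w := cst 0) (x := y) (L := 0)
    (Q := 0)
    ltac:(move=> ?; rewrite /cst; ring)) hLy.
  rewrite add0r mulN1r in hLy'.
  apply: (sderiv2_min r0 hLy' hY) => h /rP[h1 h2 h3].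
  have /= := minq (t, x, y + h); rewrite /F/=.
  move: h1 h2 h3; rewrite !ltr_norml =>
    /andP[h1 h1'] /andP[h2 h2'] /andP[h3 h3'].
  have sE : S (t, x, y + h) = s - h * (2 * Y + h).
    by rewrite /s /S /Y/=; ring.
  have hh : `|h * (2 * Y + h)| <= `|h| * 1.
    by rewrite normrM ler_wpM2l// ler_norml /Y; clear -h1 h1' Y1 Y2; lra.
  have {}hh : h * (2 * Y + h) <= s.
    apply: (le_trans (ler_norm _)); apply: (le_trans hh); rewrite mulr1.
    by rewrite ler_norml; clear -h2 h2'; lra.
  rewrite /d in h3'.
  have k : [/\ 0 <= t <= T1, -1 <= x <= 1, -1 <= y + h <= 1, 0 <= x - (y + h)
      & 0 <= S (t, x, y + h)].
    rewrite sE; split => //; last by clear -hh; lra.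
    - by clear -h1 h1' Y1 Y2; lra.
    - by clear -h3'; lra.
  by move/(_ k); rewrite /cst; clear; lra.
have g9 : g0 <= g0 + g1 * t <= 9 / 64.
  have /andP[g10 g11] := g1b.
  rewrite lerDl mulr_ge0//=; apply: le_trans gT; rewrite lerD2l.
  by rewrite ler_wpM2l.
have sE : s = g0 + g1 * t - X ^+ 2 - Y ^+ 2 by [].
have dE : d = X - Y + 1 / 2 by rewrite /X /Y /d; clear; lra.
have E0 : 0 < E by exact: expR_gt0.
have := barrier_ineq kap1 g00 g1b g9 hmu sE dE Sp d0 E0 a1b a2b eps0.
apply/negP; rewrite -leNgt.
have a1p : 0 <= a1 by case/andP: a1b => /(le_trans ler01).
have a2p : 0 <= a2 by case/andP: a2b => /(le_trans ler01).
move: (ler_wpM2l a1p tsx) (ler_wpM2l a2p tsy).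
move: f1b f2b; rewrite !ler_norml => /andP[f11 f12] /andP[f21 f22].
rewrite mulrN.
have DE : Dx - Dy = a1 * Lx + f1 - (a2 * Ly + f2) by rewrite eqx eqy.
move=> k1 k2.
apply: le_trans tst; rewrite DE.
apply: le_trans (_ : a1 * Lx - a2 * Ly - 2 * eps <= _).
  by rewrite -subr_ge0; clear -k1 k2; lra.
by clear -f11 f12 f21 f22; lra.
Qed.

End Comparison.

(** * Decay of the oscillation of the slopes *)

Section UnitStep.
Context {R : realType}.

(* [1 / 128] bounds [S] from below near the origin. *)
Definition gain (kap : R) : R :=
  expR (- ((16 * (49 * kap ^+ 2)) ^+ 2)) * (1 / 128) ^+ 2 / 2.

Lemma gain_bounds (kap : R) : 0 < gain kap <= 1 / 2.
Proof.
have e0 := expR_gt0 (- ((16 * (49 * kap ^+ 2)) ^+ 2)).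
have e1 : expR (- ((16 * (49 * kap ^+ 2)) ^+ 2)) <= 1.
  by rewrite -expR0 ler_expR oppr_le0 sqr_ge0.
rewrite /gain; apply/andP; split; first by rewrite divr_gt0// mulr_gt0.
move: e0 e1; set e := expR _; clear; lra.
Qed.

(** Positivity of the increment over one pair, or of all initial slopes, is carried by the barrier
    to the diagonal near the origin. There the factor [x - y] of the barrier turns it into a lower
    bound on every slope. *)
Lemma slopes_gain (U : R -> R -> R) (kap T1 : R) :
  1 <= kap -> 0 <= T1 <= 1 ->
  continuous (fun q : R * R => U q.1 q.2) ->
  slopes U 0 T1 (-1) 1 0 1 ->
  (forall t x, 0 < t <= T1 -> - 1 < x < 1 ->
     parabolic_at U 1 kap (gain kap / 2) t x) ->
  (T1 = 1 /\ 1 / 4 <= U 0 (1 / 4) - U 0 (- (1 / 4))) \/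
  (forall y x, - 1 <= y -> y <= x -> x <= 1 ->
     (x - y) / 4 <= U 0 x - U 0 y) ->
  forall t y x, 0 <= t <= T1 -> T1 - (1 / 32) ^+ 2 <= t ->
    - (1 / 32) <= y -> y <= x -> x <= 1 / 32 ->
    gain kap * (x - y) <= U t x - U t y.
Proof.
move=> kap1 /andP[T0 T1le] cU sl eqU hyp t y x t01 tge y1 yx x1.
have [gp gle] := andP (gain_bounds kap).
have /andP[t0 tT] := t01.
(* The factor 16 compensates the smallest radius used below: with [g0 = 1 / 256] one has
   [mu * g0 = (49 * kap ^ 2) ^ 2]. *)
pose mu := (16 * (49 * kap ^+ 2)) ^+ 2.
have mono th y' x' : 0 <= th <= T1 -> - 1 <= y' -> y' <= x' -> x' <= 1 ->
    U th y' <= U th x'.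
  move=> thb y'1 y'x' x'1; have := sl th y' x' thb y'1 y'x' x'1.
  by rewrite mul0r subr_ge0 => /andP[].
have lip th y' x' : 0 <= th <= T1 -> - 1 <= y' -> y' <= x' -> x' <= 1 ->
    U th x' - U th y' <= x' - y'.
  move=> thb y'1 y'x' x'1; have := sl th y' x' thb y'1 y'x' x'1.
  by rewrite mul1r => /andP[].
have e0 : 0 < gain kap / 2 by rewrite divr_gt0.
have x2 : x ^+ 2 <= (1 / 32) ^+ 2.
  rewrite -(real_normK (num_real x)) lerXn2r ?nnegrE//.
  by rewrite ler_norml; clear -y1 yx x1; lra.
have y2 : y ^+ 2 <= (1 / 32) ^+ 2.
  rewrite -(real_normK (num_real y)) lerXn2r ?nnegrE//.
  by rewrite ler_norml; clear -y1 yx x1; lra.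
(* The barrier is applied with a radius that either grows (interior case) or is
   constant (initial layer); in both cases [S >= 1/128] near the origin. *)
have concl g0 g1 : let S := g0 + g1 * t - (x - 1 / 4) ^+ 2 - (y + 1 / 4) ^+ 2 in
    (x - y) * (expR (- mu * t) * S ^+ 2 - gain kap / 2 * (2 - (x - y))) <=
      U t x - U t y -> 9 / 64 - 35 / 256 * (1 / 32) ^+ 2 <= g0 + g1 * t ->
    gain kap * (x - y) <= U t x - U t y.
  move=> S le gge; apply: le_trans le; rewrite mulrC ler_wpM2l ?subr_ge0//.
  have Sge : 1 / 128 <= S.
    by rewrite /S; clear -gge x2 y2 yx; lra.
  have S2 : (1 / 128) ^+ 2 <= S ^+ 2.
    by rewrite lerXn2r ?nnegrE//; apply: le_trans Sge.
  have ex : expR (- mu) <= expR (- mu * t).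
    have mu0 : 0 <= mu by exact: sqr_ge0.
    by rewrite ler_expR mulNr lerN2 ler_piMr// (le_trans tT).
  have : expR (- mu) * (1 / 128) ^+ 2 <= expR (- mu * t) * S ^+ 2.
    by apply: ler_pM => //; exact: expR_ge0.
  (* The barrier has height at least [2 * gain kap] near the origin, and the term in [eps] removes
     at most [gain kap]. *)
  have -> : expR (- mu) * (1 / 128) ^+ 2 = 2 * gain kap.
    by rewrite /gain -/mu; field.
  have : gain kap / 2 * (2 - (x - y)) <= gain kap / 2 * 2.
    by rewrite ler_pM2l//; clear -yx; lra.
  clear; lra.
have S1 : 0 <= 1 / 4 - (x - 1 / 4) ^+ 2 - (y + 1 / 4) ^+ 2 by clear -x2 y2 yx;
  lra.
case: hyp => [[TE U0]|U0].
(* [S >= 0] is a disc about the pair [(1 / 4, - 1 / 4)]: of radius [1 / 16] at time 0 and, since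
   1/256 + 35/256 = 9/64, of radius [3 / 8] at time 1. The squared distance of the origin is
   [8 / 64], so the disc has then passed over it. *)
- apply: (concl (1 / 256) (35 / 256)); last first.
    by move: tge; rewrite TE; clear; lra.
  apply: (barrier_comparison kap1 _ _ _ _ e0 cU mono eqU _ t01 _ yx).
  + by clear; lra.
  + by clear; lra.
  + by rewrite TE; clear; lra.
  + by rewrite /mu; clear; lra.
  + move=> y' x' y'1 y'x' x'1 S S0.
    have sx : 0 <= (x' - 1 / 4) ^+ 2 by exact: sqr_ge0.
    have sy : 0 <= (y' + 1 / 4) ^+ 2 by exact: sqr_ge0.
    have : `|x' - 1 / 4| <= 1 / 16.
      by apply: normr_le_sqr; move: S0; rewrite /S; clear -sx sy; lra.
    rewrite ler_norml => /andP[X1 X2].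
    have : `|y' + 1 / 4| <= 1 / 16.
      by apply: normr_le_sqr; move: S0; rewrite /S; clear -sx sy; lra.
    rewrite ler_norml => /andP[Y1 Y2].
    have h0 : 0 <= (0 : R) <= T1 by rewrite lexx.
    (* Each end of the pair moves by at most [1 / 16]: outwards at no cost by monotonicity, inwards
       at the cost of the Lipschitz bound. An increment of [1 / 4 - 2 / 16 = 1 / 8] remains. *)
    have Ux : U 0 (1 / 4) - 1 / 16 <= U 0 x'.
      have [h|h] := leP (1 / 4) x'.
        have := mono 0 (1 / 4) x' h0 ltac:(clear; lra) h x'1; clear; lra.
      have := lip 0 x' (1 / 4) h0 ltac:(clear -X1; lra) (ltW h) ltac:(clear;
        lra).
      clear -X1; lra.
    have Uy : U 0 y' <= U 0 (- (1 / 4)) + 1 / 16.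
      have [h|h] := leP y' (- (1 / 4)).
        have := mono 0 y' (- (1 / 4)) h0 y'1 h ltac:(clear; lra); clear; lra.
      have := lip 0 (- (1 / 4)) y' h0 ltac:(clear; lra) (ltW h)
        ltac:(clear -Y2; lra).
      clear -Y2; lra.
    apply: (@le_trans _ _ (1 / 8)); last by clear -Ux Uy U0; lra.
    have : (x' - y') * S ^+ 2 <= 2 * (1 / 16) ^+ 2.
      apply: ler_pM; [by rewrite subr_ge0|exact: sqr_ge0|by clear -y'1 x'1;
        lra|].
      by rewrite lerXn2r ?nnegrE// /S; clear -sx sy; lra.
    clear; lra.
  + by clear -y1; lra.
  + by clear -x1; lra.
  + by move: tge; rewrite TE; clear -x2 y2 yx; lra.
(* Initial slopes of at least [1 / 4] dominate [S ^ 2] everywhere, so the disc starts at its full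
   radius and need not grow. *)
- apply: (concl (9 / 64) 0); last by clear; lra.
  apply: (barrier_comparison kap1 _ _ _ _ e0 cU mono eqU _ t01 _ yx).
  + by clear; lra.
  + by rewrite lexx ler01.
  + by rewrite mul0r addr0.
  + have : 0 <= (49 * kap ^+ 2) ^+ 2 by exact: sqr_ge0.
    by rewrite /mu; clear; lra.
  + move=> y' x' y'1 y'x' x'1 S S0.
    apply: le_trans (U0 y' x' y'1 y'x' x'1).
    rewrite ler_wpM2l ?subr_ge0//.
    have sx : 0 <= (x' - 1 / 4) ^+ 2 by exact: sqr_ge0.
    have sy : 0 <= (y' + 1 / 4) ^+ 2 by exact: sqr_ge0.
    have : S ^+ 2 <= (1 / 2) ^+ 2.
      by rewrite lerXn2r ?nnegrE// /S; clear -sx sy; lra.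
    clear; lra.
  + by clear -y1; lra.
  + by clear -x1; lra.
  + by clear -x2 y2 yx; lra.
Qed.

(** [x - U] exchanges the slopes [p] and [1 - p], hence the lower and the upper half of [[0, 1]]. *)
Lemma parabolic_at_flip (U : R -> R -> R) (lam Lam F t x : R) :
  parabolic_at U lam Lam F t x ->
  parabolic_at (fun t x => x - U t x) lam Lam F t x.
Proof.
move=> [D [L [a [f [hD hL ab fb e]]]]]; exists (- D), (- L), a, (- f);
  split => //.
- have c0 : lderiv (cst x) t (0 : R).
    by apply: is_derive_lderiv; exact: is_derive_cst.
  have := lderiv_lin (-1) c0 hD; rewrite add0r mulN1r.
  by under eq_fun do rewrite mulN1r.
- have i0 : sderiv2 (@id R) x 0.
    by apply: (@sderiv2_poly _ _ _ _ 0) => s /=; ring.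
  have := sderiv2_lin (-1) i0 hL; rewrite add0r mulN1r.
  by under eq_fun do rewrite mulN1r.
- by rewrite normrN.
- by rewrite e; ring.
Qed.

(** The increments of [U] and of [W = x - U] over [[- 1 / 4, 1 / 4]] add up to [1 / 2], so one of
    them is at least [1 / 4]. In a cylinder cut by the initial time, slopes within [1 / 4] of some
    [c] are all at least [1 / 4] or all at most [3 / 4], according to whether [c >= 1 / 2]. *)
Lemma unit_osc_step (U : R -> R -> R) (kap T1 : R) :
  1 <= kap -> 0 <= T1 <= 1 ->
  continuous (fun q : R * R => U q.1 q.2) ->
  slopes U 0 T1 (-1) 1 0 1 ->
  (forall t x, 0 < t <= T1 -> - 1 < x < 1 ->
     parabolic_at U 1 kap (gain kap / 2) t x) ->
  T1 = 1 \/ (exists c, slopes U 0 0 (-1) 1 (c - 1 / 4) (c + 1 / 4)) ->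
  exists m, forall t y x, 0 <= t <= T1 -> T1 - (1 / 32) ^+ 2 <= t ->
    - (1 / 32) <= y -> y <= x -> x <= 1 / 32 ->
    m * (x - y) <= U t x - U t y <= (m + (1 - gain kap)) * (x - y).
Proof.
move=> kap1 T1b cU sl eqU hyp.
have /andP[T0 T1le] := T1b.
pose W t x := x - U t x.
have cW : continuous (fun q : R * R => W q.1 q.2).
  by apply: contB => // q; exact: cvg_snd.
have slW : slopes W 0 T1 (-1) 1 0 1.
  move=> t y x tb y1 yx x1; have /andP[] := sl t y x tb y1 yx x1.
  by rewrite /W; clear; lra.
have eqW t x : 0 < t <= T1 -> - 1 < x < 1 ->
     parabolic_at W 1 kap (gain kap / 2) t x.
  by move=> tb xb; apply: parabolic_at_flip; exact: eqU.
suff : ((T1 = 1 /\ 1 / 4 <= U 0 (1 / 4) - U 0 (- (1 / 4))) \/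
  (forall y x, - 1 <= y -> y <= x -> x <= 1 ->
     (x - y) / 4 <= U 0 x - U 0 y)) \/
  ((T1 = 1 /\ 1 / 4 <= W 0 (1 / 4) - W 0 (- (1 / 4))) \/
  (forall y x, - 1 <= y -> y <= x -> x <= 1 ->
     (x - y) / 4 <= W 0 x - W 0 y)).
  case=> [hU|hW].
  - exists (gain kap) => t y x tb tge y1 yx x1.
    rewrite (slopes_gain kap1 T1b cU sl eqU hU tb tge y1 yx x1)/=.
    have := sl t y x tb ltac:(clear -y1; lra) yx ltac:(clear -x1; lra).
    by move=> /andP[_]; clear; lra.
  - exists 0 => t y x tb tge y1 yx x1.
    have := slopes_gain kap1 T1b cW slW eqW hW tb tge y1 yx x1.
    have := sl t y x tb ltac:(clear -y1; lra) yx ltac:(clear -x1; lra).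
    by rewrite /W => /andP[? _] ?; apply/andP; split; lra.
case: hyp => [T1E|[c hc]].
- have [h|h] := leP (1 / 4) (U 0 (1 / 4) - U 0 (- (1 / 4))).
    by left; left.
  by right; left; split => //; rewrite /W; move: h; clear; lra.
- have h0 : 0 <= (0 : R) <= 0 by rewrite lexx.
  have [h|h] := leP (1 / 2) c.
  + left; right => y x y1 yx x1; have := hc 0 y x h0 y1 yx x1.
    move=> /andP[+ _]; apply: le_trans; rewrite mulrC ler_wpM2r ?subr_ge0//.
    by clear -h; lra.
  + right; right => y x y1 yx x1; have := hc 0 y x h0 y1 yx x1.
    rewrite /W => /andP[_ k].
    have : (c + 1 / 4) * (x - y) <= 3 / 4 * (x - y).
      by rewrite ler_wpM2r ?subr_ge0//; clear -h; lra.
    by move: k; clear; lra.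
Qed.

End UnitStep.

(** * Parabolic rescaling and iteration of the decay step *)

Section Iteration.
Context {R : realType}.
Implicit Types (U : R -> R -> R).

Lemma lderiv_affine (w : R -> R) (s0 k s D : R) : 0 < k ->
  lderiv w (s0 + k * s) D -> lderiv (fun z => w (s0 + k * z)) s (k * D).
Proof.
move=> k0 wD e e0; have [d d0 h] := wD (e / k) ltac:(exact: divr_gt0).
exists (d / k) => [|z /andP[z0 zd]]; first exact: divr_gt0.
have := h (k * z) ltac:(by rewrite mulr_gt0//= mulrC -ltr_pdivlMr).
rewrite (_ : s0 + k * s - k * z = s0 + k * (s - z)); last by ring.
rewrite (_ : D * (k * z) = k * D * z); last by ring.
by rewrite (_ : e / k * (k * z) = e * z)//; field; rewrite gt_eqF.
Qed.

Lemma sderiv2_affine (w : R -> R) (x0 r x L : R) : 0 < r ->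
  sderiv2 w (x0 + r * x) L ->
  sderiv2 (fun z => w (x0 + r * z)) x (r ^+ 2 * L).
Proof.
move=> r0 wL e e0.
have [d d0 h] := wL (e / r ^+ 2) ltac:(by rewrite divr_gt0// exprn_gt0).
exists (d / r) => [|z /andP[z0 zd]]; first exact: divr_gt0.
have := h (r * z) ltac:(by rewrite mulr_gt0//= mulrC -ltr_pdivlMr).
rewrite (_ : x0 + r * x + r * z = x0 + r * (x + z)); last by ring.
rewrite (_ : x0 + r * x - r * z = x0 + r * (x - z)); last by ring.
rewrite (_ : L * (r * z) ^+ 2 = r ^+ 2 * L * z ^+ 2); last by ring.
rewrite (_ : e / r ^+ 2 * (r * z) ^+ 2 = e * z ^+ 2)//.
by field; rewrite gt_eqF.
Qed.

Lemma slopes_sub U s t lo hi m M s' t' lo' hi' m' M' :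
  s <= s' -> t' <= t -> lo <= lo' -> hi' <= hi -> m' <= m -> M <= M' ->
  slopes U s t lo hi m M -> slopes U s' t' lo' hi' m' M'.
Proof.
move=> ss tt ll hh mm MM h th y x /andP[sth tht] ly yx xh.
have := h th y x; rewrite (le_trans ss sth) (le_trans tht tt).
move=> /(_ isT (le_trans ll ly) yx (le_trans xh hh)) /andP[h1 h2].
rewrite (le_trans _ h1) ?(le_trans h2)//; apply: ler_wpM2r => //;
  by rewrite subr_ge0.
Qed.

Lemma parabolic_at_sub U lam Lam F Lam' F' t x : Lam <= Lam' -> F <= F' ->
  parabolic_at U lam Lam F t x -> parabolic_at U lam Lam' F' t x.
Proof.
move=> LL FF [D [L [a [f [hD hL /andP[a1 a2] fb e]]]]].
exists D, L, a, f; split => //; first by rewrite a1 (le_trans a2).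
exact: le_trans FF.
Qed.

(** Measuring time in units of [r ^ 2 / mu] makes the lower ellipticity bound 1; subtracting the
    slope [m] and dividing by [r * om] brings slopes from [[m, m + om]] to [[0, 1]]. The right-hand
    side is multiplied by [r / (mu * om)], so it becomes harmless when [r] is small against [om]. *)
Lemma parabolic_at_scale U mu kap F s0 x0 r om m s x :
  0 < mu -> 0 < r -> 0 < om ->
  parabolic_at U mu (kap * mu) F (s0 + r ^+ 2 / mu * s) (x0 + r * x) ->
  parabolic_at
    (fun s x => (U (s0 + r ^+ 2 / mu * s) (x0 + r * x) - m * (r * x))
      / (r * om))
    1 kap (F * r / (mu * om)) s x.
Proof.
move=> mu0 r0 om0 [D [L [a [f [hD hL /andP[a1 a2] fb e]]]]].
have k0 : 0 < r ^+ 2 / mu by rewrite divr_gt0// exprn_gt0.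
exists (r / (mu * om) * D), (r / om * L), (a / mu), (f * r / (mu * om)).
have rn0 := lt0r_neq0 r0; have on0 := lt0r_neq0 om0; have mn0 := lt0r_neq0 mu0.
split.
- have c0 : lderiv (cst (- (m * x / om))) s (0 : R).
    by apply: is_derive_lderiv; exact: is_derive_cst.
  have h := lderiv_lin (1 / (r * om)) c0 (lderiv_affine k0 hD).
  rewrite (_ : r / (mu * om) * D = 0 + 1 / (r * om) * (r ^+ 2 / mu * D));
    last by field; rewrite rn0 on0 mn0.
  suff <- : (fun z => cst (- (m * x / om)) z +
      1 / (r * om) * U (s0 + r ^+ 2 / mu * z) (x0 + r * x)) = (fun z =>
      (U (s0 + r ^+ 2 / mu * z) (x0 + r * x) - m * (r * x)) / (r * om)) by [].
  by apply/funext => z /=; field; rewrite rn0 on0.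
- have i0 : sderiv2 (fun z => - (m * z / om)) x 0.
    by apply: (@sderiv2_poly _ _ _ _ 0) => z /=; field; rewrite on0.
  have h := sderiv2_lin (1 / (r * om)) i0 (sderiv2_affine r0 hL).
  rewrite (_ : r / om * L = 0 + 1 / (r * om) * (r ^+ 2 * L));
    last by field; rewrite rn0 on0.
  suff <- : (fun z => - (m * z / om) +
      1 / (r * om) * U (s0 + r ^+ 2 / mu * s) (x0 + r * z)) = (fun z =>
      (U (s0 + r ^+ 2 / mu * s) (x0 + r * z) - m * (r * z)) / (r * om)) by [].
  by apply/funext => z /=; field; rewrite rn0 on0.
- by rewrite ler_pdivlMr// mul1r a1/= ler_pdivrMr.
- rewrite normrM (ger0_norm (x := _^-1)) ?invr_ge0 ?mulr_ge0 ?(ltW mu0)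
  ?(ltW om0)//.
  by rewrite normrM (gtr0_norm r0) ler_wpM2r ?invr_ge0 ?mulr_ge0 ?(ltW mu0)
    ?(ltW om0)// ler_wpM2r// ltW.
- by rewrite e; field; rewrite on0 mn0.
Qed.

(** Lower time of the backward parabolic cylinder of radius [r], cut off at the initial time 0. *)
Definition bottom (t0 r mu : R) : R := Num.max 0 (t0 - r ^+ 2 / mu).

(** The condition on [F * r] says that the rescaled right-hand side is at most [gain kap / 2]. The
    rescaled height [T1] equals 1 for a full cylinder; when the cylinder is cut at time 0, the
    control of the initial slopes enters. *)
Lemma osc_step U kap mu F t0 x0 r om m :
  1 <= kap -> 0 < mu -> 0 < r -> 0 < om -> 0 <= t0 ->
  continuous (fun q : R * R => U q.1 q.2) ->
  slopes U (bottom t0 r mu) t0 (x0 - r) (x0 + r) m (m + om) ->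
  (forall t x, bottom t0 r mu < t <= t0 -> x0 - r < x < x0 + r ->
     parabolic_at U mu (kap * mu) F t x) ->
  F * r <= gain kap / 2 * (mu * om) ->
  (exists c, slopes U 0 0 (x0 - r) (x0 + r) (c - om / 4) (c + om / 4)) ->
  exists m', slopes U (bottom t0 (1 / 32 * r) mu) t0
    (x0 - 1 / 32 * r) (x0 + 1 / 32 * r) m' (m' + (1 - gain kap) * om).
Proof.
move=> kap1 mu0 r0 om0 t00 cU sl eqU Fr [c hc].
set s0 := bottom t0 r mu in sl eqU *.
pose k := r ^+ 2 / mu.
have k0 : 0 < k by rewrite divr_gt0// exprn_gt0.
have s00 : 0 <= s0 by rewrite /s0 /bottom le_max lexx.
have s0k : t0 - k <= s0 by rewrite /s0 /bottom le_max lexx orbT.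
have s0t : s0 <= t0 by rewrite /s0 /bottom ge_max t00 lerBlDr lerDl ltW.
pose T1 := (t0 - s0) / k.
have T10 : 0 <= T1 by rewrite divr_ge0 ?subr_ge0// ltW.
have T11 : T1 <= 1 by rewrite ler_pdivrMr// mul1r; lra.
have T1b : 0 <= T1 <= 1 by rewrite T10.
have kT1 : s0 + k * T1 = t0.
  by rewrite /T1; field; rewrite gt_eqF.
pose W s x := (U (s0 + k * s) (x0 + r * x) - m * (r * x)) / (r * om).
have ro0 : 0 < r * om by rewrite mulr_gt0.
have WE s y x : W s x - W s y =
    (U (s0 + k * s) (x0 + r * x) - U (s0 + k * s) (x0 + r * y)
       - m * (r * (x - y))) / (r * om).
  by rewrite /W; field; rewrite !gt_eqF.
have cW : continuous (fun q : R * R => W q.1 q.2).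
  have cr : continuous (fun q : R * R => r * q.2).
    by apply: contM; [exact: cst_continuous|move=> q; exact: cvg_snd].
  rewrite /W; apply: contM; last exact: cst_continuous.
  apply: contB; last by apply: contM; [exact: cst_continuous|exact: cr].
  apply: (cont_uncurry cU (f := fun q : R * R => s0 + k * q.1)
    (g := fun q : R * R => x0 + r * q.2)).
    apply: contD; first exact: cst_continuous.
    by apply: contM; [exact: cst_continuous|move=> q; exact: cvg_fst].
  by apply: contD; [exact: cst_continuous|exact: cr].
have tb s : 0 <= s <= T1 -> s0 <= s0 + k * s <= t0.
  move=> /andP[s1 s2]; rewrite lerDl mulr_ge0 ?(ltW k0)//= -kT1 lerD2l.
  by rewrite ler_pM2l.
have xb y : -1 <= y -> x0 - r <= x0 + r * y.
  by move=> y1; rewrite lerD2l -mulrN1 ler_pM2l.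
have xb' x : x <= 1 -> x0 + r * x <= x0 + r.
  by move=> x1; rewrite lerD2l ger_pMr.
have yxb y x : y <= x -> x0 + r * y <= x0 + r * x.
  by move=> yx; rewrite lerD2l ler_pM2l.
have dE y x : x0 + r * x - (x0 + r * y) = r * (x - y) by ring.
have slW : slopes W 0 T1 (-1) 1 0 1.
  move=> s y x sb y1 yx x1.
  have /andP[] := sl _ _ _ (tb _ sb) (xb _ y1) (yxb _ _ yx) (xb' _ x1).
  rewrite dE => h1 h2; rewrite WE mul0r mul1r divr_ge0 ?subr_ge0//;
    last exact: ltW.
  by rewrite /= ler_pdivrMr//; move: h2; clear; lra.
have eqW s x : 0 < s <= T1 -> - 1 < x < 1 ->
    parabolic_at W 1 kap (gain kap / 2) s x.
  move=> /andP[s1 s2] /andP[x1 x2].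
  apply: (@parabolic_at_sub _ _ kap (F * r / (mu * om))) => //.
    by rewrite ler_pdivrMr// mulr_gt0.
  apply: parabolic_at_scale => //; apply: eqU.
    by rewrite ltrDl mulr_gt0//= -kT1 lerD2l ler_pM2l.
  by rewrite ltrD2l -mulrN1 ltr_pM2l// x1/= ltrD2l gtr_pMr.
have hyp : T1 = 1 \/ exists c, slopes W 0 0 (-1) 1 (c - 1 / 4) (c + 1 / 4).
  have [h|h] := leP 0 (t0 - k).
    left; have sE : s0 = t0 - k by rewrite /s0 /bottom -/k; apply/max_idPr.
    by rewrite /T1 sE; field; rewrite gt_eqF.
  right; have sE : s0 = 0 by rewrite /s0 /bottom -/k; apply/max_idPl;
    exact: ltW.
  exists ((c - m) / om) => s y x /andP[s1 s2] y1 yx x1.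
  have s_0 : s = 0 by apply/eqP; rewrite eq_le s1 s2.
  have h0 : 0 <= (0 : R) <= 0 by rewrite lexx.
  have := hc 0 _ _ h0 (xb _ y1) (yxb _ _ yx) (xb' _ x1).
  rewrite WE s_0 sE mulr0 addr0 dE => /andP[h1 h2].
  rewrite ler_pdivlMr// ler_pdivrMr//.
  have -> : ((c - m) / om - 1 / 4) * (x - y) * (r * om) =
    (c - m - om / 4) * (r * (x - y)) by field; rewrite gt_eqF.
  have -> : ((c - m) / om + 1 / 4) * (x - y) * (r * om) =
    (c - m + om / 4) * (r * (x - y)) by field; rewrite gt_eqF.
  by move: h1 h2; clear; lra.
have [m1 hm1] := unit_osc_step kap1 T1b cW slW eqW hyp.
exists (m + m1 * om) => th y x /andP[th1 th2] y1 yx x1.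
move: th1; rewrite /bottom ge_max => /andP[th0 th1].
pose s := (th - s0) / k.
have thE : s0 + k * s = th by rewrite /s; field; rewrite gt_eqF.
have s0th : s0 <= th.
  rewrite /s0 /bottom ge_max th0 (le_trans _ th1)// lerD2l lerN2.
  by rewrite ler_pM2r ?invr_gt0// exprMn ler_piMl ?sqr_ge0//; clear; lra.
pose y' := (y - x0) / r; pose x' := (x - x0) / r.
have yE : x0 + r * y' = y by rewrite /y'; field; rewrite gt_eqF.
have xE : x0 + r * x' = x by rewrite /x'; field; rewrite gt_eqF.
have yx' : y' <= x' by rewrite ler_pM2r ?invr_gt0// lerD2r.
have sb : 0 <= s <= T1.
  rewrite divr_ge0 ?subr_ge0 ?(ltW k0)//=.
  by rewrite ler_pM2r ?invr_gt0// lerD2r.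
have sT : T1 - (1 / 32) ^+ 2 <= s.
  rewrite /s ler_pdivlMr// mulrBl /T1 divfK ?gt_eqF//.
  move: th1; rewrite exprMn -mulrA -/k; clear; lra.
have y1' : - (1 / 32) <= y'.
  by rewrite /y' ler_pdivlMr//; move: y1; clear; lra.
have x1' : x' <= 1 / 32.
  by rewrite /x' ler_pdivrMr//; move: x1; clear; lra.
have := hm1 _ _ _ sb sT y1' yx' x1'.
rewrite WE thE yE xE ler_pdivlMr// ler_pdivrMr//.
have -> : r * (x' - y') = x - y by rewrite -xE -yE; ring.
have E1 a : a * (x' - y') * (r * om) = a * om * (x - y).
  by rewrite -xE -yE; ring.
by rewrite !E1; clear; lra.
Qed.

(** [1 / 32 <= th] makes the radius shrink at least as fast as the range of the slopes, so the
    smallness of the right-hand side is inherited by every scale. *)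
Lemma osc_decay U kap mu F t0 x0 r0 om0 th m0 :
  1 <= kap -> 0 < mu -> 0 < r0 -> 0 < om0 -> 0 <= t0 -> 0 <= F ->
  1 - gain kap <= th -> 1 / 32 <= th ->
  continuous (fun q : R * R => U q.1 q.2) ->
  slopes U (bottom t0 r0 mu) t0 (x0 - r0) (x0 + r0) m0 (m0 + om0) ->
  (forall t x, bottom t0 r0 mu < t <= t0 -> x0 - r0 < x < x0 + r0 ->
     parabolic_at U mu (kap * mu) F t x) ->
  F * r0 <= gain kap / 2 * (mu * om0) ->
  (forall k, exists c, let r := (1 / 32) ^+ k * r0 in
     slopes U 0 0 (x0 - r) (x0 + r) (c - th ^+ k * om0 / 4)
       (c + th ^+ k * om0 / 4)) ->
  forall k, exists m, let r := (1 / 32) ^+ k * r0 in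
    slopes U (bottom t0 r mu) t0 (x0 - r) (x0 + r) m (m + th ^+ k * om0).
Proof.
move=> kap1 mu0 r00 om00 t00 F0 th1 th2 cU sl0 eqU Fr init.
have th0 : 0 < th by apply: lt_le_trans th2; clear; lra.
elim=> [|k [m IH]]; first by exists m0; rewrite /= !expr0 !mul1r.
rewrite /= in IH.
set r := (1 / 32) ^+ k * r0 in IH.
have rr0 : r <= r0.
  by rewrite /r ler_piMl ?(ltW r00)// exprn_ile1//; clear; lra.
have rp : 0 < r by rewrite mulr_gt0// exprn_gt0//; clear; lra.
have omp : 0 < th ^+ k * om0 by rewrite mulr_gt0// exprn_gt0.
have [||m' hm'] := @osc_step U kap mu F t0 x0 r (th ^+ k * om0) m
    kap1 mu0 rp omp t00 cU IH _ _ (init k).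
- move=> t x /andP[tb tt] /andP[x1 x2]; apply: eqU.
    rewrite tt andbT; apply: le_lt_trans tb.
    rewrite /bottom ge_max !le_max lexx/=; apply/orP; right.
    rewrite lerD2l lerN2 ler_pM2r ?invr_gt0//.
    by rewrite lerXn2r ?nnegrE ?(ltW rp) ?(ltW r00).
  by apply/andP; split; move: rr0 x1 x2; clear; lra.
- have e : F * r <= th ^+ k * (F * r0).
    rewrite /r mulrCA ler_wpM2r ?mulr_ge0 ?(ltW r00)//.
    by rewrite lerXn2r ?nnegrE ?(ltW th0)//; clear; lra.
  apply: (le_trans e).
  rewrite (_ : gain kap / 2 * (mu * (th ^+ k * om0)) =
    th ^+ k * (gain kap / 2 * (mu * om0))); last by ring.
  by rewrite ler_pM2l// exprn_gt0.
exists m' => /=; rewrite exprS -mulrA -/r; apply: slopes_sub hm' => //.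
by rewrite lerD2l exprS -mulrA ler_pM2r.
Qed.

End Iteration.

(** * The gradient bound *)

(** Conjugating by the central symmetry [w |-> - w (- y)] keeps the derivative and exchanges left
    and right, so facts on left derivatives transfer without a second proof. *)
Definition rderiv (R : realType) (w : R -> R) (x p : R) : Prop :=
  lderiv (fun y => - w (- y)) (- x) p.

Section GradientBound.
Context {R : realType}.
Implicit Types (w : R -> R -> R) (h : R -> R).

Lemma lderivN (w : R -> R) x p : lderiv w x p -> lderiv (fun z =>
  - w z) x (- p).
Proof.
have c0 : lderiv (cst 0) x (0 : R) by apply: is_derive_lderiv;
  exact: is_derive_cst.
move=> h; have := lderiv_lin (-1) c0 h; rewrite add0r mulN1r.
suff -> : (fun s => cst 0 s + -1 * w s) = (fun z => - w z) by [].
by apply/funext => z /=; rewrite add0r mulN1r.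
Qed.

Lemma rderivN (w : R -> R) x p : rderiv w x p -> rderiv (fun z =>
  - w z) x (- p).
Proof. by move=> /lderivN. Qed.

Lemma sderiv2N (w : R -> R) x p :
  sderiv2 w x p -> sderiv2 (fun z => - w z) x (- p).
Proof.
have c0 : sderiv2 (cst 0) x (0 : R).
  by apply: (@sderiv2_poly _ _ _ _ 0) => s /=; ring.
move=> h; have := sderiv2_lin (-1) c0 h; rewrite add0r mulN1r.
suff -> : (fun s => cst 0 s + -1 * w s) = (fun z => - w z) by [].
by apply/funext => z /=; rewrite add0r mulN1r.
Qed.

Lemma lderiv_shift h y x q : lderiv h (x - y) q -> lderiv (fun z =>
  h (z - y)) x q.
Proof.
move=> hq e e0; have [d d0 hd] := hq e e0; exists d => // s sd.
by rewrite (_ : x - s - y = x - y - s); [exact: hd|ring].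
Qed.

Lemma lderiv_reflect h y x q :
  rderiv h (x - y) q -> lderiv (fun z => - h (x - z)) y q.
Proof.
move=> hq e e0; have [d d0 hd] := hq e e0; exists d => // s sd.
have := hd s sd; rewrite !opprK.
by rewrite (_ : x - (y - s) = - (- (x - y) - s)); last by ring.
Qed.

Lemma rderiv_shift h y x q : rderiv h (x - y) q -> rderiv (fun z =>
  h (z - y)) x q.
Proof.
move=> hq e e0; have [d d0 hd] := hq e e0; exists d => // s sd.
have := hd s sd; rewrite !opprK.
by rewrite (_ : - (- x - s) - y = - (- (x - y) - s)); last by ring.
Qed.

Lemma rderiv_reflect h y x q :
  lderiv h (x - y) q -> rderiv (fun z => - h (x - z)) y q.
Proof.
move=> hq e e0; have [d d0 hd] := hq e e0; exists d => // s sd.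
have := hd s sd; rewrite !opprK.
by rewrite (_ : x + (- y - s) = x - y - s); last by ring.
Qed.

Lemma sderiv2_shift h y x q : sderiv2 h (x - y) q -> sderiv2 (fun z =>
  h (z - y)) x q.
Proof.
move=> hq e e0; have [d d0 hd] := hq e e0; exists d => // s sd.
rewrite (_ : x - s - y = x - y - s); last by ring.
by rewrite (_ : x + s - y = x - y + s); [exact: hd|ring].
Qed.

Lemma sderiv2_reflect h y x q :
  sderiv2 h (x - y) q -> sderiv2 (fun z => - h (x - z)) y (- q).
Proof.
move=> hq; apply: sderiv2N => e e0; have [d d0 hd] := hq e e0.
exists d => // s sd; have := hd s sd.
rewrite [h (x - y + s) + _]addrC.
rewrite (_ : x - (y + s) = x - y - s); last by ring.
by rewrite (_ : x - (y - s) = x - y + s); last by ring.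
Qed.

(** [profile_lin] excludes contact at time 0 through [q0] and converts the comparison into a slope
    bound through [P]; [profile_ge] excludes contact at distance [kap], since increments of the
    solution never exceed [2 * M]. *)
Record comparison_profile (psi : R -> R) (q0 M P kap : R) h : Prop := {
  profile_cont : continuous h ;
  profile_gt0 : 0 < kap ;
  profile_ge : 2 * M <= h kap ;
  profile_lin : forall d : R, 0 <= d <= kap -> q0 * d <= h d <= P * d ;
  profile_ode : forall d : R, 0 < d < kap -> exists q : R, [/\ q0 <= q,
    lderiv h d q,
    rderiv h d q & sderiv2 h d (- psi q)] }.

Definition gradient_eq (psi : R -> R) w (t x : R) : Prop :=
  exists D L p a f : R, [/\ lderiv (w ^~ x) t D, sderiv2 (w t) x L,
    lderiv (w t) x p /\ rderiv (w t) x p, 0 < a /\ `|f| <= a * psi `|p|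
    & D = a * L + f].

(** The added [eps * t] makes the contact strict: minimality gives [Dx - Dy >= eps], while the
    equation or the boundary conditions give [Dx <= 0 <= Dy]. Distances above [kap] are settled by
    [2 * M <= h kap <= P * kap]. *)
Lemma gradient_bound w psi (l tau q0 M P kap : R) h :
  0 < l -> 0 <= q0 -> comparison_profile psi q0 M P kap h ->
  continuous (fun q : R * R => w q.1 q.2) ->
  (forall t x : R, 0 <= t <= tau -> - l <= x <= l -> `|w t x| <= M) ->
  (forall y x : R, - l <= y -> y <= x -> x <= l -> w 0 x - w 0 y <= q0 * (x -
    y)) ->
  (forall t x : R, 0 < t <= tau -> - l < x < l -> gradient_eq psi w t x) ->
  (forall t : R, 0 < t <= tau -> exists D p : R, [/\ lderiv (w ^~ l) t D,
     lderiv (w t) l p & q0 <= p -> D <= 0]) ->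
  (forall t : R, 0 < t <= tau -> exists D p : R, [/\ lderiv (w ^~ (- l)) t D,
     rderiv (w t) (- l) p & q0 <= p -> 0 <= D]) ->
  forall t y x : R, 0 <= t <= tau -> - l <= y -> y <= x -> x <= l ->
    w t x - w t y <= P * (x - y).
Proof.
move=> l0 q00 [ch k0 hk hlin hode]
  cw wM init eqw eqr eql t' y' x' t'b y'1 yx' x'1.
have P0 : 0 <= P.
  have /andP[] := hlin kap ltac:(by rewrite lexx ltW).
  move=> _; apply: contraTT; rewrite -!ltNge => P0.
  apply: lt_le_trans hk; rewrite (@lt_le_trans _ _ 0)//;
    first by rewrite nmulr_rlt0.
  by rewrite mulr_ge0// (le_trans (normr_ge0 (w t' x')))// wM// x'1 (le_trans
    y'1).
have [dk|dk] := leP (x' - y') kap; last first.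
  have := wM t' x' t'b ltac:(by rewrite x'1 (le_trans y'1)).
  have := wM t' y' t'b ltac:(by rewrite y'1 (le_trans yx')).
  have /andP[_ h2] := hlin kap ltac:(by rewrite lexx ltW).
  have : P * kap <= P * (x' - y') by rewrite ler_wpM2l// ltW.
  rewrite !ler_norml => h3 /andP[h4 _] /andP[_ h5].
  by move: hk h2 h3 h4 h5; clear; lra.
suff : w t' x' - w t' y' <= h (x' - y').
  have /andP[_] := hlin (x' - y') ltac:(by rewrite subr_ge0 yx').
  by move=> ? /le_trans; apply.
rewrite leNgt; apply/negP => neg.
have /andP[t'0 t'T] := t'b.
(* [eps * t] uses up at most half of the assumed defect; [tau + 1] keeps the denominator
   positive. *)
pose eps := (w t' x' - w t' y' - h (x' - y')) / (2 * (tau + 1)).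
have T1 : 0 < 2 * (tau + 1) by move: t'0 t'T; clear; lra.
have eps0 : 0 < eps by rewrite divr_gt0// subr_gt0.
pose F (q : R * R * R) := h (q.1.2 - q.2)
  + eps * q.1.1 - w q.1.1 q.1.2 + w q.1.1 q.2.
have c11 : continuous (fun q : R * R * R => q.1.1).
  by move=> q; apply: continuous_comp; exact: cvg_fst.
have c12 : continuous (fun q : R * R * R => q.1.2).
  by move=> q; apply: continuous_comp; [exact: cvg_fst|exact: cvg_snd].
have c2 : continuous (fun q : R * R * R => q.2).
  by move=> q; exact: cvg_snd.
have cd : continuous (fun q : R * R * R => q.1.2 - q.2) by exact: contB.
have cH : continuous (fun q : R * R * R => kap - (q.1.2 - q.2)).
  by apply: contB => //; exact: cst_continuous.
have cF : continuous F.
  rewrite /F; apply: contD; last exact: cont_uncurry.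
  apply: contB; last exact: cont_uncurry.
  apply: contD; first exact: (cont_comp ch cd).
  by apply: contM => //; exact: cst_continuous.
have K' : [/\ 0 <= t' <= tau, - l <= x' <= l, - l <= y' <= l,
    0 <= x' - y' & 0 <= kap - (x' - y')].
  by split; rewrite ?subr_ge0 ?y'1 ?x'1 ?(le_trans y'1)// (le_trans yx').
have [|[[t x] y] /= [/andP[t0 tT] /andP[x1 x2] /andP[y1 y2] yx dkap] minq] :=
  @constrained_min R F (fun q => q.1.2 - q.2) (fun q => kap - (q.1.2 - q.2))
    0 tau (- l) l (- l) l cF cd cH.
  by exists (t', x', y').
have {neg} : F (t, x, y) < 0.
  apply: (@le_lt_trans _ _ (F (t', x', y'))); first exact: minq.
  rewrite /F/=.
  have : eps * t' <= eps * (tau + 1).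
    by rewrite ler_pM2l//; move: t'T; clear; lra.
  have : eps * (tau + 1) = (w t' x' - w t' y' - h (x' - y')) / 2.
    by rewrite /eps; field; move: T1; clear; lra.
  by move: neg; clear; lra.
rewrite /F/= => neg.
have et : 0 <= eps * t by rewrite mulr_ge0// ltW.
have tb : 0 <= t <= tau by rewrite t0.
have d0 : 0 < x - y.
  rewrite lt_neqAle yx andbT; apply/eqP => xyE.
  have /andP[h0 _] := hlin 0 ltac:(by rewrite lexx ltW).
  have yE : y = x by move: xyE; clear; lra.
  by move: neg h0 et; rewrite yE subrr; clear; lra.
have dlt : x - y < kap.
  rewrite lt_neqAle; move: dkap; rewrite subr_ge0 => ->; rewrite andbT.
  apply/eqP => xyE.
  have := wM t x tb ltac:(by rewrite x1).
    have := wM t y tb ltac:(by rewrite y1).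
  rewrite !ler_norml => /andP[h1 _] /andP[_ h2].
  by move: neg hk et h1 h2; rewrite xyE; clear; lra.
have yxle : y <= x by rewrite -subr_ge0.
have tp : 0 < t.
  rewrite lt_neqAle t0 andbT; apply/eqP => tE.
  have := init y x y1 yxle x2.
  have /andP[h1 _] := hlin (x - y) ltac:(by rewrite yx ltW).
  by move: neg h1; rewrite -tE; clear; lra.
have tpb : 0 < t <= tau by rewrite tp.
have [q [qq0 hl hr hs]] := hode (x - y) ltac:(by rewrite d0).
have [r r0 rP] : exists2 r : R, 0 < r & forall s : R, `|s| < r ->
    [/\ - (x - y) < s, s < x - y, - (kap - (x - y)) < s & s < kap - (x - y)].
  exists (Num.min (x - y) (kap - (x - y))) => [|s].
    by rewrite lt_min d0 subr_gt0.
  by rewrite lt_min !ltr_norml => /andP[/andP[? ?] /andP[? ?]]; split.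
have minx (s : R) : `|s| < r -> - l <= x + s <= l ->
    h (x - y) - w t x <= h (x + s - y) - w t (x + s).
  move=> /rP[s1 s2 s3 s4] xs.
  have k : [/\ 0 <= t <= tau, - l <= x + s <= l, - l <= y <= l,
      0 <= x + s - y & 0 <= kap - (x + s - y)].
    split => //; first by rewrite y1.
      by move: s1; clear; lra.
    by move: s4; clear; lra.
  by have := minq (t, x + s, y) k; rewrite /F/=; clear; lra.
have miny (s : R) : `|s| < r -> - l <= y + s <= l ->
    w t y - - h (x - y) <= w t (y + s) - - h (x - (y + s)).
  move=> /rP[s1 s2 s3 s4] xs.
  have k : [/\ 0 <= t <= tau, - l <= x <= l, - l <= y + s <= l,
      0 <= x - (y + s) & 0 <= kap - (x - (y + s))].
    split => //; first by rewrite x1.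
      by move: s2; clear; lra.
    by move: s3; clear; lra.
  by have := minq (t, x, y + s) k; rewrite /F/=; clear; lra.
have nr (s z : R) : 0 < s < z -> `|s| < z by move=> /andP[s0 sr];
  rewrite gtr0_norm.
have xl : - l < x by move: y1 d0; clear; lra.
have yl : y < l by move: x2 d0; clear; lra.
have [Dx [hDx Dx0]] : exists Dx, lderiv (w ^~ x) t Dx /\ Dx <= 0.
  have r10 : 0 < Num.min r (x + l) by rewrite lt_min r0; move: xl; clear; lra.
  (* Moving [x] to the left is allowed even at [x = l]; this yields a slope of at least [q0] there,
     as the boundary condition requires. *)
  have left p : lderiv (w t) x p -> q <= p.
    move=> hp; apply: (lderiv_min r10 (lderiv_shift hl) hp) => s.
    rewrite lt_min => /andP[s0 /andP[s1 s2]]; apply: minx.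
      by rewrite normrN gtr0_norm.
    by move: s0 s1 s2 x2; clear; lra.
  move: x2; rewrite le_eqVlt => /orP[/eqP xE|x2].
    have [D [p [hD hp pD]]] := eqr t tpb.
    exists D; rewrite xE; split => //; apply: pD; apply: (le_trans qq0).
    by apply: left; rewrite xE.
  have r2p : 0 < Num.min r (Num.min (x + l) (l - x)).
    by rewrite !lt_min r0; move: xl x2; clear; lra.
  have [D [L [p [a [f [hD hL [hp1 hp2] [a0 fb] e]]]]]] :=
    eqw t x tpb ltac:(by rewrite xl).
  exists D; split => //.
  have qp := left p hp1.
  have pq : p <= q.
    apply: (lderiv_min r2p hp2 (rderiv_shift hr)) => s.
    rewrite !lt_min => /andP[s0 /andP[s1 /andP[s2 s3]]].
    have := minx s (nr s r ltac:(by rewrite s0)) ltac:(move: s0 s2 s3; clear;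
      lra).
    rewrite !opprK (_ : - (- x - s) = x + s); last by ring.
    by clear; lra.
  have Lq : L <= - psi q.
    apply: (sderiv2_min r2p (sderiv2_shift hs) hL) => s.
    rewrite !lt_min => /andP[s1 /andP[]];
      rewrite !ltr_norml => /andP[a1 a2] /andP[a3 a4].
    by apply: minx => //; clear -a1 a2 a3 a4; lra.
  (* At an interior contact the slopes agree, so the bound on [f] and the profile evaluate [psi] at
     the same argument and cancel. *)
  have pE : p = q by apply/eqP; rewrite eq_le pq.
  move: fb; rewrite pE (ger0_norm (le_trans q00 qq0)) ler_norml => /andP[_ fb].
  have : a * L <= a * - psi q by rewrite ler_pM2l.
  by rewrite e; move: fb; clear; lra.
have [Dy [hDy Dy0]] : exists Dy, lderiv (w ^~ y) t Dy /\ 0 <= Dy.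
  have r10 : 0 < Num.min r (l - y) by rewrite lt_min r0; move: yl; clear; lra.
  have right p : rderiv (w t) y p -> q <= p.
    move=> hp; apply: (lderiv_min r10 (rderiv_reflect hl) hp) => s.
    rewrite lt_min => /andP[s0 /andP[s1 s2]].
    have ys : - l <= y + s <= l by move: s0 s2 y1; clear; lra.
    have := miny s (nr s r ltac:(by rewrite s0)) ys.
    rewrite !opprK (_ : - (- y - s) = y + s); last by ring.
    rewrite (_ : x + (- y - s) = x - (y + s)); last by ring.
    by clear; lra.
  move: y1; rewrite le_eqVlt => /orP[/eqP yE|y1].
    have [D [p [hD hp pD]]] := eql t tpb.
    exists D; rewrite -yE; split => //; apply: pD; apply: (le_trans qq0).
    by apply: right; rewrite -yE.
  have r2p : 0 < Num.min r (Num.min (y + l) (l - y)).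
    by rewrite !lt_min r0; move: yl y1; clear; lra.
  have [D [L [p [a [f [hD hL [hp1 hp2] [a0 fb] e]]]]]] :=
    eqw t y tpb ltac:(by rewrite y1).
  exists D; split => //.
  have qp := right p hp2.
  have pq : p <= q.
    apply: (lderiv_min r2p hp1 (lderiv_reflect hr)) => s.
    rewrite !lt_min => /andP[s0 /andP[s1 /andP[s2 s3]]]; apply: miny.
      by rewrite normrN gtr0_norm.
    by move: s0 s2 s3; clear; lra.
  have Lq : psi q <= L.
    rewrite -[psi q]opprK.
    apply: (sderiv2_min r2p hL (sderiv2_reflect hs)) => s.
    rewrite !lt_min => /andP[s1 /andP[]];
      rewrite !ltr_norml => /andP[a1 a2] /andP[a3 a4].
    by apply: miny => //; clear -a1 a2 a3 a4; lra.
  have pE : p = q by apply/eqP; rewrite eq_le pq.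
  move: fb; rewrite pE (ger0_norm (le_trans q00 qq0)) ler_norml => /andP[fb _].
  have : a * psi q <= a * L by rewrite ler_pM2l.
  by rewrite e; move: fb; clear; lra.
have ht : lderiv (fun s => eps * s) t eps.
  by move=> e e0; exists 1 => // s /andP[s0 _];
    rewrite (_ : _ - _ = 0) ?normr0 ?mulr_ge0 ?(ltW e0) ?(ltW s0)//; ring.
have hZ := lderiv_lin (-1) hDx hDy.
have : eps <= Dx + -1 * Dy.
  apply: (lderiv_min tp ht hZ) => s /andP[s0 st].
  have k : [/\ 0 <= t - s <= tau, - l <= x <= l, - l <= y <= l,
      0 <= x - y & 0 <= kap - (x - y)].
    by split => //; rewrite ?x1 ?y1//; move: s0 st tT; clear; lra.
  by have := minq (t - s, x, y) k; rewrite /F/=; clear; lra.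
by move: eps0 Dx0 Dy0; clear; lra.
Qed.

End GradientBound.

(** * Time modulus and reflection *)

Section TimeModulus.
Context {R : realType}.
Implicit Types (w : R -> R -> R).

(** Comparison with a paraboloid rising at rate [C]. At time [s] it lies above [w] because Young's
    inequality bounds [P * |x - x0|] by [P * e + P / (4 * e) * (x - x0) ^ 2]. Later [C] exceeds the
    time derivative at any contact: [Lam * P / (2 * e) + F] inside, [N] at the end points. The
    opposite bound comes from [- w]. *)
Lemma time_modulus w (l tau lam Lam F N P e s t x0 : R) :
  0 < l -> 0 < lam -> 0 <= F -> 0 <= N -> 0 <= P -> 0 < e ->
  continuous (fun q : R * R => w q.1 q.2) ->
  slopes w 0 tau (- l) l (- P) P ->
  (forall t x : R, 0 < t <= tau -> - l < x < l -> parabolic_at w lam Lam F t x)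
    ->
  (forall t x : R, 0 < t <= tau -> x = l \/ x = - l ->
     exists2 D : R, lderiv (w ^~ x) t D & D <= N) ->
  0 <= s -> s <= t -> t <= tau -> - l <= x0 <= l ->
  w t x0 - w s x0 <= P * e + (Lam * P / (2 * e) + F + N + 1) * (t - s).
Proof.
move=> l0 lam0 F0 N0 P0 e0 cw sl eqw bd s0 st tT /andP[x01 x02].
set C := _ + 1.
pose phi (q : R * R * R) := w s x0 + P * e + P / (4 * e) * (q.1.2 - x0) ^+ 2
  + C * (q.1.1 - s).
pose G (q : R * R * R) := phi q - w q.1.1 q.1.2.
have c11 : continuous (fun q : R * R * R => q.1.1).
  by move=> q; apply: continuous_comp; exact: cvg_fst.
have c12 : continuous (fun q : R * R * R => q.1.2).
  by move=> q; apply: continuous_comp; [exact: cvg_fst|exact: cvg_snd].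
have csq : continuous (fun x : R => x ^+ 2) by exact: exprn_continuous.
have cG : continuous G.
  rewrite /G /phi; apply: contB; last exact: cont_uncurry.
  apply: contD; first apply: contD; first exact: cst_continuous.
    apply: contM; first exact: cst_continuous.
    apply: (cont_comp csq (f := fun q : R * R * R => q.1.2 - x0)).
    by apply: contB => //; exact: cst_continuous.
  apply: contM; first exact: cst_continuous.
  by apply: contB => //; exact: cst_continuous.
(* There is a single space variable here: the third coordinate is frozen at 0 and both constraints
   are constant. *)
have c1 : continuous (fun q : R * R * R => 1 : R) by exact: cst_continuous.
rewrite leNgt; apply/negP => neg.
have K' : [/\ s <= t <= t, - l <= x0 <= l, 0 <= (0 : R) <= 0,
  0 <= (1 : R) & 0 <= (1 : R)].
  by split; rewrite ?st ?x01 ?x02 ?lexx.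
have [|[[th x] z] /= [/andP[th0 tht] /andP[x1 x2] _ _ _] minq] :=
  @constrained_min R G (fun=> 1) (fun=> 1) s t (- l) l 0 0 cG c1 c1.
  by exists (t, x0, 0).
have {neg} : G (th, x, z) < 0.
  apply: le_lt_trans (minq (t, x0, 0) K') _; rewrite /G /phi/=.
  by move: neg; rewrite subrr expr0n/= mulr0 addr0; clear; lra.
have thtau : th <= tau by exact: le_trans tht tT.
have min' (th' x' : R) : s <= th' <= t -> - l <= x' <= l ->
    G (th, x, z) <= G (th', x', 0).
  by move=> h1 h2; apply: minq; split; rewrite //= lexx.
rewrite {1}/G /phi/= => neg.
have thp : s < th.
  rewrite lt_neqAle th0 andbT; apply/eqP => thE; move: neg.
  rewrite -thE subrr mulr0 addr0; apply/negP; rewrite -leNgt.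
  have sb : 0 <= s <= tau by rewrite s0 (le_trans st).
  have : w s x - w s x0 <= P * `|x - x0|.
    have [h|h] := leP x0 x.
      by have /andP[_] := sl s x0 x sb x01 h x2; rewrite ger0_norm ?subr_ge0.
    have /andP[+ _] := sl s x x0 sb x1 (ltW h) x02.
    by rewrite distrC gtr0_norm ?subr_gt0//; clear; lra.
  have : P * `|x - x0| <= P * e + P / (4 * e) * (x - x0) ^+ 2.
    rewrite -(real_normK (num_real (x - x0))).
    rewrite -subr_ge0 (_ : _ - _ = P / (4 * e) * (2 * e - `|x - x0|) ^+ 2).
      by rewrite mulr_ge0 ?sqr_ge0// divr_ge0// mulr_ge0// ltW.
    by field; rewrite gt_eqF.
  by clear; lra.
have [D [hD DC]] : exists D : R, lderiv (w ^~ x) th D /\ D < C.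
  have thb : 0 < th <= tau by rewrite (le_lt_trans s0).
  have Lam_int : 0 <= Lam -> 0 <= Lam * P / (2 * e).
    by move=> L0; rewrite divr_ge0 ?mulr_ge0// ltW.
  have bdC y : y = l \/ y = - l -> x = y -> exists D : R,
    lderiv (w ^~ x) th D /\ D < C.
    move=> yl xy; rewrite -xy in yl; have [D hD DN] := bd th x thb yl;
      exists D; split => //.
    (* The sign of [Lam] is read off the equation at the interior point 0. *)
    have [_ [_ [a [_ [_ _ /andP[a1 a2] _ _]]]]] : parabolic_at w lam Lam F th 0.
      by apply: eqw; rewrite ?oppr_lt0 ?l0.
    have := Lam_int (le_trans (ltW lam0) (le_trans a1 a2)).
    by rewrite /C; move: DN F0; clear; lra.
  move: x2; rewrite le_eqVlt => /orP[/eqP xE|x2]; first by apply: (bdC l);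
    [left|].
  move: x1; rewrite le_eqVlt => /orP[/eqP xE|x1]; first by apply: (bdC (- l));
    [right|].
  have [D [L [a [f [hD hL /andP[a1 a2] fb DE]]]]]
    := eqw th x thb ltac:(by rewrite x1).
  exists D; split => //.
  have hphi : sderiv2 (fun y => phi (th, y, z)) x (P / (2 * e)).
    apply: (@sderiv2_poly _ _ _ _ 0) => y; rewrite /phi/=; field.
    by rewrite gt_eqF.
  have m0 : 0 < Num.min (x + l) (l - x).
    by rewrite lt_min; move: x1 x2; clear; lra.
  have Lle : L <= P / (2 * e).
    apply: (sderiv2_min m0 hphi hL) => y.
    rewrite lt_min !ltr_norml => /andP[/andP[y1 y2] /andP[y3 y4]].
    apply: (min' th (x + y)); first by rewrite th0.
    by move: y1 y4; clear; lra.
  have a0 : 0 <= a by exact: le_trans (ltW lam0) a1.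
  have Pe0 : 0 <= P / (2 * e) by rewrite divr_ge0// mulr_ge0// ltW.
  have : a * L <= Lam * P / (2 * e).
    apply: (@le_trans _ _ (a * (P / (2 * e)))); first by rewrite ler_wpM2l.
    by rewrite -mulrA ler_wpM2r.
  move: fb; rewrite ler_norml => /andP[_ fb].
  by rewrite DE /C; move: fb N0; clear; lra.
have hphi : lderiv (fun y => phi (y, x, z)) th C.
  move=> e' e'0; exists 1 => // y /andP[y0 _]; rewrite /phi/=.
  by rewrite (_ : _ - _ = 0) ?normr0 ?mulr_ge0 ?(ltW e'0) ?(ltW y0)//; ring.
have : C <= D.
  apply: (@lderiv_min _ _ _ _ _ _ (th - s) _ hphi hD);
    first by rewrite subr_gt0.
  move=> y /andP[y0 y1]; apply: (min' (th - y) x); last by rewrite x1.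
  by move: y0 y1 tht; clear; lra.
by rewrite leNgt DC.
Qed.

End TimeModulus.

(** * Odd reflection about the end points *)

Section Reflection.
Context {R : realType}.
Implicit Types (w : R -> R -> R) (a b l x : R).

(** Projection onto [[a, b]], written with absolute values so that its continuity is that of the
    norm. *)
Definition clamp a b x : R := (a + b + `|x - a| - `|x - b|) / 2.

Lemma clamp_id a b x : a <= x <= b -> clamp a b x = x.
Proof.
move=> /andP[ax xb]; rewrite /clamp ger0_norm ?subr_ge0// ler0_norm ?subr_le0//.
by field.
Qed.

Lemma clamp_lo a b x : a <= b -> x <= a -> clamp a b x = a.
Proof.
move=> ab xa; rewrite /clamp !ler0_norm ?subr_le0//; first by field.
exact: le_trans ab.
Qed.

Lemma clamp_hi a b x : a <= b -> b <= x -> clamp a b x = b.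
Proof.
move=> ab bx; rewrite /clamp !ger0_norm ?subr_ge0//; first by field.
exact: le_trans bx.
Qed.

Lemma clamp_itv a b x : a <= b -> a <= clamp a b x <= b.
Proof.
move=> ab; have [xa|ax] := leP x a; first by rewrite clamp_lo// lexx.
have [bx|xb] := leP b x; first by rewrite clamp_hi// lexx ab.
by rewrite clamp_id !ltW.
Qed.

Lemma continuous_clamp a b : continuous (clamp a b).
Proof.
rewrite /clamp; apply: contM; last exact: cst_continuous.
have cn c : continuous (fun x : R => `|x - c|).
  apply: (cont_comp (@norm_continuous R R) (f := fun x : R => x - c)).
  by apply: contB; [move=> ?; exact: cvg_id|exact: cst_continuous].
by apply: contB => //; apply: contD => //; exact: cst_continuous.
Qed.

Lemma clamp_le a b x (y : R) : a <= b -> x <= y -> clamp a b x <= clamp a b y.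
Proof.
move=> ab xy; rewrite /clamp ler_pM2r ?invr_gt0//.
by case: (lerP a x) => ?; case: (lerP b x) => ?; case: (lerP a y) => ?;
  case: (lerP b y) => ?; lra.
Qed.

(* Odd reflection of [w t] about both end points: it turns the boundary
   conditions into interior equations, since the symmetric second difference
   vanishes at [x = l] and [x = - l]. *)
Definition odd_reflect w l t x : R :=
  w t (clamp (- l) l x) + (w t l - w t (clamp (- l) l (2 * l - x)))
  + (w t (- l) - w t (clamp (- l) l (- 2 * l - x))).

Lemma reflect_mid w l t x : - l <= x <= l -> odd_reflect w l t x = w t x.
Proof.
move=> xb; have /andP[x1 x2] := xb.
rewrite /odd_reflect clamp_id// (@clamp_hi _ _ (2 * l - x))
  ?(@clamp_lo _ _ (- 2 * l - x));
  by [ring|lra].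
Qed.

Lemma reflect_right w l t x : 0 < l -> l <= x <= 3 * l ->
  odd_reflect w l t x = 2 * w t l - w t (2 * l - x).
Proof.
move=> l0 /andP[x1 x2].
rewrite /odd_reflect clamp_hi// ?(@clamp_id _ _ (2 * l - x))
  ?(@clamp_lo _ _ (- 2 * l - x)); by [ring|lra].
Qed.

Lemma reflect_left w l t x : 0 < l -> - (3 * l) <= x <= - l ->
  odd_reflect w l t x = 2 * w t (- l) - w t (- 2 * l - x).
Proof.
move=> l0 /andP[x1 x2].
rewrite /odd_reflect clamp_lo// ?(@clamp_hi _ _ (2 * l - x))
  ?(@clamp_id _ _ (- 2 * l - x)); by [ring|lra].
Qed.

Lemma continuous_reflect w l : continuous (fun q : R * R => w q.1 q.2) ->
  continuous (fun q : R * R => odd_reflect w l q.1 q.2).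
Proof.
move=> cw; have c1 : continuous (fun q : R * R => q.1) by move=> q;
  exact: cvg_fst.
have c2 : continuous (fun q : R * R => q.2) by move=> q; exact: cvg_snd.
have cc c : continuous (fun q : R * R => clamp (- l) l (c - q.2)).
  apply: (cont_comp (@continuous_clamp _ _) (f := fun q : R * R => c - q.2)).
  by apply: contB => //; exact: cst_continuous.
have cwl (c : R) : continuous (fun q : R * R => w q.1 c).
  by apply: cont_uncurry => //; exact: cst_continuous.
rewrite /odd_reflect; apply: contD; first apply: contD.
- apply: cont_uncurry => //.
  exact: (cont_comp (@continuous_clamp _ _) c2).
- by apply: contB; [exact: cwl|exact: cont_uncurry].
- by apply: contB; [exact: cwl|exact: cont_uncurry].
Qed.

Lemma sderiv2_local (w z : R -> R) x L (d : R) : 0 < d ->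
  (forall y, `|y - x| < d -> w y = z y) -> sderiv2 z x L -> sderiv2 w x L.
Proof.
move=> d0 wz hz e e0; have [d' d'0 h] := hz e e0.
exists (Num.min d d') => [|s /andP[s0]]; first by rewrite lt_min d0.
rewrite lt_min => /andP[sd sd']; rewrite !wz ?h ?s0//.
- by rewrite subrr normr0.
- by rewrite addrAC subrr add0r normrN gtr0_norm.
- by rewrite addrAC subrr add0r gtr0_norm.
Qed.

Lemma lderiv_ext (w z : R -> R) x D : w =1 z -> lderiv z x D -> lderiv w x D.
Proof. by move=> /funext ->. Qed.

(** For [|x| < 3 * l], the point of [[- l, l]] at which the equation is read in order to obtain one
    for the reflection at [x]. *)
Definition fold_itv l x : R :=
  if l < x then 2 * l - x else if x < - l then - 2 * l - x else x.

(** Beyond an end point [c] the reflection is [2 * w t c] minus a mirrored value: [L] changes sign,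
    and the right-hand side becomes [2 * D - f] with [D] the time derivative at [c], whence
    [F + 2 * N]. At [c] itself [L = 0], any admissible coefficient serves, and [D] is the right-hand
    side. *)
Lemma reflect_parabolic w l lam Lam F N t x :
  0 < l -> lam <= Lam -> 0 <= F -> 0 <= N -> `|x| < 3 * l ->
  (- l < fold_itv l x < l -> parabolic_at w lam Lam F t (fold_itv l x)) ->
  (exists2 D, lderiv (w ^~ l) t D & `|D| <= N) ->
  (exists2 D, lderiv (w ^~ (- l)) t D & `|D| <= N) ->
  parabolic_at (odd_reflect w l) lam Lam (F + 2 * N) t x.
Proof.
move=> l0 ll F0 N0; rewrite ltr_norml =>
  /andP[xl1 xl2] eqw [Dr hDr DrN] [Dl hDl DlN].
have LF : F <= F + 2 * N by move: N0; clear; lra.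
have NF (D : R) : `|D| <= N -> `|D| <= F + 2 * N.
  by move=> /le_trans; apply; move: F0 N0; clear; lra.
(* by oddness the second difference vanishes at the end points *)
have corner (c D : R) : lderiv (w ^~ c) t D -> `|D| <= N -> - l <= c <= l ->
    (forall s, 0 < s < 2 * l ->
       odd_reflect w l t (c + s) + odd_reflect w l t (c - s) - 2 * w t c = 0) ->
    parabolic_at (odd_reflect w l) lam Lam (F + 2 * N) t c.
  move=> hD DN cl odd; exists D, 0, lam, D; split => //.
  - by apply: lderiv_ext hD => s; rewrite reflect_mid.
  - move=> e e0; exists (2 * l) => [|s /andP[s0 s1]]; first by rewrite mulr_gt0.
    rewrite (reflect_mid _ _ cl) odd ?s0// mul0r subrr normr0.
    by rewrite mulr_ge0 ?sqr_ge0// ltW.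
  - by rewrite lexx.
  - exact: NF.
  - by rewrite mulr0 add0r.
have outer (c c' D : R) : lderiv (w ^~ c) t D -> `|D| <= N ->
    parabolic_at w lam Lam F t (c' - x) ->
    (forall s, odd_reflect w l s x = 2 * w s c - w s (c' - x)) ->
    (exists2 d : R, 0 < d & forall y, `|y - x| < d ->
      odd_reflect w l t y = 2 * w t c - w t (c' - y)) ->
    parabolic_at (odd_reflect w l) lam Lam (F + 2 * N) t x.
  move=> hD DN [D1 [L [a [f [hD1 hL ab fb e]]]]] Et [d d0 Ex].
  exists (2 * D - D1), (- L), a, (2 * D - f); split => //.
  - have z0 : lderiv (cst 0) t (0 : R).
      by apply: is_derive_lderiv; exact: is_derive_cst.
    have := lderiv_lin (-1) (lderiv_lin 2 z0 hD) hD1.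
    rewrite add0r mulN1r; apply: lderiv_ext => s.
    by rewrite Et /=; ring.
  - apply: (sderiv2_local (d := d) d0 Ex).
    have := @sderiv2_reflect R (fun y => w t y) x c' L.
    move=> /(_ hL) h e0 e00; have [d' d'0 hd'] := h e0 e00.
    exists d' => // s sd; have := hd' s sd.
    by apply: le_trans; rewrite le_eqVlt; apply/orP; left; apply/eqP;
      congr `|_|; ring.
  - apply: (le_trans (ler_normB _ _)); rewrite normrM ger0_norm//.
    by rewrite addrC lerD// ler_pM2l.
  - by rewrite e; ring.
have [lx|xl|xE] := ltgtP l x.
- apply: (outer l (2 * l) Dr) => //.
  + have fE : fold_itv l x = 2 * l - x by rewrite /fold_itv lx.
    by rewrite -fE; apply: eqw; rewrite fE; move: lx xl2; clear; lra.
  + by move=> s; rewrite reflect_right// ltW//= ltW.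
  + exists (Num.min (x - l) (3 * l - x)) => [|y].
      by rewrite lt_min; move: lx xl2; clear; lra.
    rewrite lt_min !ltr_norml => /andP[/andP[y1 y2] /andP[y3 y4]].
    by rewrite reflect_right//; move: y1 y4; clear; lra.
- have [lx|xl'|xE] := ltgtP (- l) x.
  + have xb : - l < x < l by rewrite lx.
    have fE : fold_itv l x = x by rewrite /fold_itv ltNge (ltW xl)/= ltNge (ltW
      lx).
    have [D [L [a [f [hD hL ab fb e]]]]] : parabolic_at w lam Lam F t x.
      by rewrite -fE; apply: eqw; rewrite fE.
    exists D, L, a, f; split => //; last exact: le_trans fb _.
      by apply: lderiv_ext hD => s; rewrite reflect_mid// !ltW.
    apply: (sderiv2_local (d := Num.min (x + l) (l - x))) hL.
      by rewrite lt_min; move: lx xl; clear; lra.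
    move=> y; rewrite lt_min !ltr_norml => /andP[/andP[y1 y2] /andP[y3 y4]].
    by rewrite reflect_mid//; move: y1 y4; clear; lra.
  + apply: (outer (- l) (- 2 * l) Dl) => //.
    * have fE : fold_itv l x = - 2 * l - x
      by rewrite /fold_itv ltNge (ltW xl)/= xl'.
      by rewrite -fE; apply: eqw; rewrite fE; move: xl' xl1; clear; lra.
    * by move=> s; rewrite reflect_left// !ltW.
    * exists (Num.min (- l - x) (3 * l + x)) => [|y].
        by rewrite lt_min; move: xl' xl1; clear; lra.
      rewrite lt_min !ltr_norml => /andP[/andP[y1 y2] /andP[y3 y4]].
      by rewrite reflect_left//; move: y2 y3; clear; lra.
  + rewrite -xE; apply: (corner (- l) Dl) => //; first by move: l0; clear; lra.
    move=> s /andP[s0 s1].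
    rewrite reflect_mid; last by move: s0 s1; clear; lra.
    rewrite reflect_left//; last by move: s0 s1 l0; clear; lra.
    by rewrite (_ : - 2 * l - (- l - s) = - l + s); ring.
- rewrite -xE; apply: (corner l Dr) => //; first by move: l0; clear; lra.
  move=> s /andP[s0 s1].
  rewrite reflect_right//; last by move: s0 s1 l0; clear; lra.
  rewrite reflect_mid; last by move: s0 s1; clear; lra.
  by rewrite (_ : 2 * l - (l + s) = l - s); ring.
Qed.

(** An increment of the reflection is a sum of three increments of [w], over clamped intervals whose
    lengths add up to [x - y] as long as [|x|, |y| <= 3 * l]. Since [x0] lies in [[- l, l]],
    mirroring a point from outside does not take it further from [x0], so each piece stays in the
    window where the slopes are known. *)
Lemma slopes_reflect w l s t x0 r m M :
  0 < l -> - l <= x0 <= l -> 0 <= r <= 2 * l ->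
  (forall th y x, s <= th <= t -> - l <= y -> x0 - r <= y -> y <= x ->
     x <= l -> x <= x0 + r -> m * (x - y) <= w th x - w th y <= M * (x - y)) ->
  slopes (odd_reflect w l) s t (x0 - r) (x0 + r) m M.
Proof.
move=> l0 /andP[x01 x02] /andP[r0 r1] sl th y x thb y1 yx x1.
have ll : - l <= l by move: l0; clear; lra.
have y3 : - (3 * l) <= y by move: y1 x01 r1; clear; lra.
have x3 : x <= 3 * l by move: x1 x02 r1; clear; lra.
have inc z : - (3 * l) <= z -> z <= 3 * l ->
    clamp (- l) l z - clamp (- l) l (2 * l - z) - clamp (- l) l (- 2 * l - z)
      = z.
  move=> z1 z2; have [h|h] := leP l z.
    rewrite (clamp_hi ll h) (@clamp_id _ _ (2 * l - z))
      ?(@clamp_lo _ _ (- 2 * l - z));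
      by [ring|move: h z2 l0; clear; lra].
  have [h'|h'] := leP z (- l).
    rewrite (clamp_lo ll h') (@clamp_hi _ _ (2 * l - z))
      ?(@clamp_id _ _ (- 2 * l - z));
      by [ring|move: h' z1 l0; clear; lra].
  rewrite clamp_id ?(ltW h') ?(ltW h)// (@clamp_hi _ _ (2 * l - z))
    ?(@clamp_lo _ _ (- 2 * l - z)); by [ring|move: h h' l0; clear; lra].
have ix := inc x (le_trans y3 yx) x3.
have iy := inc y y3 (le_trans yx x3).
have cl z : - l <= clamp (- l) l z by case/andP: (clamp_itv z ll).
have cu z : clamp (- l) l z <= l by case/andP: (clamp_itv z ll).
have clo z : x0 - r <= z -> x0 - r <= clamp (- l) l z.
  move=> h; have [zl|lz] := leP z (- l).
    by rewrite clamp_lo//; exact: le_trans zl.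
  have [zl|zl] := leP l z; first by rewrite clamp_hi//; move: x02 r0; clear;
    lra.
  by rewrite clamp_id// !ltW.
have chi z : z <= x0 + r -> clamp (- l) l z <= x0 + r.
  move=> h; have [zl|lz] := leP z (- l).
    by rewrite clamp_lo//; move: x01 r0; clear; lra.
  have [zl|zl] := leP l z; first by rewrite clamp_hi// (le_trans zl).
  by rewrite clamp_id// !ltW.
have A := sl th (clamp (- l) l y) (clamp (- l) l x) thb (cl y) (clo y y1)
  (clamp_le ll yx) (cu x) (chi x x1).
have B : m * (clamp (- l) l (2 * l - y) - clamp (- l) l (2 * l - x)) <=
    w th (clamp (- l) l (2 * l - y)) - w th (clamp (- l) l (2 * l - x)) <=
    M * (clamp (- l) l (2 * l - y) - clamp (- l) l (2 * l - x)).
  have yx2 : 2 * l - x <= 2 * l - y by move: yx; clear; lra.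
  have [h|h] := leP x l.
    rewrite !clamp_hi//; first by rewrite !subrr !mulr0 lexx.
      by move: h; clear; lra.
    by move: h yx; clear; lra.
  apply: sl => //; first by apply: clo; move: x1 x02; clear; lra.
    exact: clamp_le.
  by apply: (le_trans (cu _)); move: h x1; clear; lra.
have C : m * (clamp (- l) l (- 2 * l - y) - clamp (- l) l (- 2 * l - x)) <=
    w th (clamp (- l) l (- 2 * l - y)) - w th (clamp (- l) l (- 2 * l - x)) <=
    M * (clamp (- l) l (- 2 * l - y) - clamp (- l) l (- 2 * l - x)).
  have yx2 : - 2 * l - x <= - 2 * l - y by move: yx; clear; lra.
  have [h|h] := leP (- l) y.
    rewrite !clamp_lo//; first by rewrite !subrr !mulr0 lexx.
      by move: h yx; clear; lra.
    by move: h; clear; lra.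
  apply: sl => //; first by apply: (le_trans _ (cl _)); move: h y1; clear; lra.
    exact: clamp_le.
  by apply: chi; move: y1 x01; clear; lra.
have -> : x - y = (clamp (- l) l x - clamp (- l) l y)
    + (clamp (- l) l (2 * l - y) - clamp (- l) l (2 * l - x))
    + (clamp (- l) l (- 2 * l - y) - clamp (- l) l (- 2 * l - x)).
  by rewrite -{1}ix -{1}iy; ring.
by move: A B C; rewrite /odd_reflect; clear; lra.
Qed.

End Reflection.

(** * The comparison profile *)

Section Profile.
Context {R : realType}.
Implicit Types (f F w : R -> R).

Lemma derive_within_eps (A : set R) (v : R -> R) (x : R) :
  derivable_within A v x -> forall e : R, 0 < e -> exists2 d : R, 0 < d &
    forall y, A y -> `|y - x| < d ->
      `|v y - v x - derive_within A v x * (y - x)| <= e * `|y - x|.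
Proof.
move=> dv e e0.
have /cvgrPdist_le /(_ e e0) :
  (v y - v x) / (y - x) @[y --> within A x^'] --> derive_within A v x
    by exact: dv.
move=> /nbhs_ballP[d /= d0 h]; exists d => // y Ay yd.
have [->|yx] := eqVneq y x; first by rewrite !subrr mulr0 subr0 normr0 mulr0.
have bx : ball x d y by rewrite /ball/= distrC.
have := h y bx yx Ay; set D := derive_within A v x => hD.
rewrite (_ : _ - _ = (D - (v y - v x) / (y - x)) * - (y - x)).
  by rewrite normrM normrN ler_wpM2r.
by field; rewrite subr_eq0.
Qed.

Lemma antiderivative f (a : R) : continuous f ->
  exists F : R -> R, forall x : R, a < x -> is_derive x 1 F (f x).
Proof.
move=> cf.
exists (fun x => (\int[lebesgue_measure]_(t in `[a, x]) f t)%R) => x ax.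
have xx1 : x < x + 1 by rewrite ltrDl.
have fi : lebesgue_measure.-integrable `[a, x + 1] (EFin \o f).
  apply: continuous_compact_integrable; first exact: segment_compact.
  exact: continuous_subspaceT.
have [dF FE] := continuous_FTC1_closed xx1 fi ax (cf x).
by apply: DeriveDef; [exact: dF|rewrite -derive1E; exact: FE].
Qed.

Lemma is_derive_mvt F f (a x y : R) :
  (forall x : R, a < x -> is_derive x 1 F (f x)) -> a < x -> x < y ->
  exists2 c : R, x < c < y & F y - F x = f c * (y - x).
Proof.
move=> dF ax xy; have [||c] := @MVT R F f x y xy.
- by move=> z; rewrite in_itv/= => /andP[xz _]; apply: dF; exact: lt_trans xz.
- apply: derivable_within_continuous => z; rewrite in_itv/= => /andP[xz _].
  by have [] := dF z (lt_le_trans ax xz).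
- by rewrite in_itv/= => cb h; exists c.
Qed.

(** If [F P - F q0 <= c] for all [P], then [F] is monotone and bounded beyond [q0], hence
    convergent, and the integral is its limit minus [F q0]. The contrapositive form also covers an
    infinite integral. *)
Lemma improper_integral_gt F f (a q0 c : R) : a < q0 ->
  continuous f -> (forall x : R, q0 <= x -> 0 <= f x) ->
  (forall x : R, a < x -> is_derive x 1 F (f x)) ->
  (c%:E < \int[lebesgue_measure]_(x in `[q0, +oo[) (f x)%:E)%E ->
  exists2 P : R, q0 < P & c < F P - F q0.
Proof.
move=> aq cf f0 dF; apply: contraPP => /forall2NP h.
have Fle P : F P - F q0 <= c \/ P <= q0.
  by have [/negP|/negP] := h P; rewrite -leNgt; [right|left].
have mono (x y : R) : q0 <= x -> x <= y -> F x <= F y.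
  move=> qx; rewrite le_eqVlt => /orP[/eqP->//|xy].
  have [z /andP[z1 z2] e] := is_derive_mvt dF (lt_le_trans aq qx) xy.
  rewrite -subr_ge0 e mulr_ge0 ?subr_ge0 ?(ltW xy)// f0//.
  by rewrite (le_trans qx)// ltW.
pose F1 x := F (Num.max q0 x).
have nd1 : nondecreasing_fun F1.
  move=> x y xy; apply: mono; first by rewrite le_max lexx.
  by rewrite ge_max !le_max lexx xy orbT.
have F1c x : F1 x <= c + F q0.
  rewrite -lerBlDr /F1; have [xq|qx] := leP x q0.
    rewrite subrr.
    have [|] := Fle (q0 + 1); last by rewrite gerDl leNgt ltr01.
    by apply: le_trans; rewrite subr_ge0; apply: mono; rewrite ?lerDl.
  by case: (Fle x) => //; rewrite leNgt qx.
have ub1 : has_ubound (range F1) by exists (c + F q0) => _ [x _ <-].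
have cv1 := nondecreasing_cvgr nd1 ub1.
set L := sup (range F1) in cv1.
have Lc : L <= c + F q0.
  by apply: ge_sup => [|_ [x _ <-]//]; exists (F1 0), 0.
have cvF : F x @[x --> +oo] --> L.
  apply: cvg_trans cv1; apply: near_eq_cvg; near=> x.
  have -> // : F1 x = F x; rewrite /F1; congr F; apply/max_idPr; near: x.
  exact: nbhs_pinfty_ge (num_real _).
rewrite (@ge0_continuous_FTC2y R f F q0 L) => //.
- by rewrite -EFinB lte_fin ltNge lerBlDr Lc.
- exact: continuous_subspaceT.
- by move=> x qx; have [] := dF x (lt_trans aq qx).
- apply: cvg_at_right_filter; apply: differentiable_continuous.
  by apply/derivable1_diffP; have [] := dF q0 aq.
- move=> x; rewrite in_itv/= andbT => qx; rewrite derive1E.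
  by have [_ ->] := dF x (lt_trans aq qx).
Unshelve. all: by end_near. Qed.

Lemma lderiv_local (w z : R -> R) (x D d : R) : 0 < d ->
  (forall y, `|y - x| < d -> w y = z y) -> lderiv z x D -> lderiv w x D.
Proof.
move=> d0 wz hz e e0; have [d' d'0 h] := hz e e0.
exists (Num.min d d') => [|s /andP[s0]]; first by rewrite lt_min d0.
rewrite lt_min => /andP[sd sd']; rewrite !wz ?h ?s0//.
- by rewrite addrAC subrr add0r normrN gtr0_norm.
- by rewrite subrr normr0.
Qed.

Lemma rderiv_local (w z : R -> R) (x D d : R) : 0 < d ->
  (forall y, `|y - x| < d -> w y = z y) -> rderiv z x D -> rderiv w x D.
Proof.
move=> d0 wz; apply: (lderiv_local d0) => y yd; rewrite wz//.
by rewrite -opprD normrN; move: yd; rewrite opprK.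
Qed.

Lemma is_derive_rderiv (w : R -> R) (x D : R)
  : is_derive x 1 w D -> rderiv w x D.
Proof.
move=> dw; apply: is_derive_lderiv.
have dw' : is_derive (- - x) 1 w D by rewrite opprK.
have -> : (fun y => - w (- y)) = - (w \o (-%R : R -> R)) by [].
have dN : is_derive (- x) 1 (-%R : R -> R) (- 1 : R).
  have -> : (-%R : R -> R) = - (@id R) by [].
  by apply: is_derive_eq.
have dc : is_derive (- x) 1 (w \o (-%R : R -> R)) (D * - 1).
  exact: (@is_derive1_comp _ w).
by apply: is_derive_eq; rewrite mulrN1 opprK.
Qed.

Lemma is_derive_eps (w : R -> R) (x D : R) : is_derive x 1 w D ->
  forall e : R, 0 < e -> exists2 d : R, 0 < d &
    forall y, `|y - x| < d -> `|w y - w x - D * (y - x)| <= e * `|y - x|.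
Proof.
move=> dw e e0.
have [d1 d10 h1] := is_derive_lderiv dw e0.
have [d2 d20 h2] := is_derive_rderiv dw e0.
exists (Num.min d1 d2) => [|y]; first by rewrite lt_min d10.
rewrite lt_min => /andP[y1 y2].
have [yx|xy|->] := ltgtP y x; last by rewrite !subrr mulr0 subr0 normr0 mulr0.
- have yxE : `|y - x| = x - y by rewrite distrC gtr0_norm ?subr_gt0.
  move: y1; rewrite yxE => y1.
  have := h1 (x - y); rewrite subr_gt0 yx => /(_ y1).
  rewrite (_ : x - (x - y) = y); last by ring.
  rewrite -[X in _ -> X <= _]normrN.
  by rewrite (_ : - (w y - w x - D * (y - x)) = w x - w y - D * (x - y));
    last by ring.
- have yxE : `|y - x| = y - x by rewrite gtr0_norm ?subr_gt0.
  move: y2; rewrite yxE => y2.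
  have := h2 (y - x); rewrite subr_gt0 xy => /(_ y2).
  rewrite opprK (_ : - (- x - (y - x)) = y); last by ring.
  by rewrite opprK [- w x + w y]addrC.
Qed.

(** The equation [h'' = - psi (h')] is separable for [p = h']. With [J] a primitive of [1 / psi], it
    reads [J (p d) = J P - d], so [p] falls from [P] to [q0] over the length [kap = J P - J q0].
    With [K] a primitive of [q / psi q], [h d = K P - K (p d)] has derivative [p], and
    [h kap = K P - K q0] exceeds [2 * M] for a suitable [P] by the integral condition. *)
Lemma profile_exists (psi : R -> R) (q0 M : R) : 0 <= q0 -> 0 < M ->
  C1_on `[0, +oo[ psi -> (forall q : R, 0 <= q -> 1 <= psi q) ->
  ((2 * M)%:E <
     \int[lebesgue_measure]_(rho in `[q0, +oo[) (rho / psi rho)%:E)%E ->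
  exists (P kap : R) (h : R -> R), comparison_profile psi q0 M P kap h.
Proof.
move=> q00 M0 [dpsi _] psi1 hint.
(* Constant extension of [psi] to negative arguments, so that primitives can start to the left of
   [q0]. *)
pose Psi (q : R) : R := psi (Num.max 0 q).
have PsiE (q : R) : 0 <= q -> Psi q = psi q by move=> q_0; rewrite /Psi max_r.
have Psi1 (q : R) : 1 <= Psi q by apply: psi1; rewrite le_max lexx.
have Psi0 (q : R) : 0 < Psi q by exact: lt_le_trans (Psi1 q).
have Psin0 (q : R) : Psi q != 0 by rewrite gt_eqF.
have cPsi : continuous Psi.
  move=> x; apply/cvgrPdist_le => e e0.
  set y := Num.max 0 x.
  have y0 : 0 <= y by rewrite le_max lexx.
  have Ay : `[0, +oo[%classic y by rewrite /= in_itv/= y0.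
  have [d d0 hd] := derive_within_eps (dpsi y Ay) e0.
  set D := derive_within _ _ _ in hd.
  have De0 : 0 < `|D| + e by rewrite ltr_wpDl.
  apply/nbhs_ballP; exists (Num.min d (e / (`|D| + e))) => /=.
    by rewrite lt_min d0 divr_gt0.
  move=> z; rewrite /ball/= lt_min distrC => /andP[zd ze].
  set y' := Num.max 0 z.
  have y'0 : 0 <= y' by rewrite le_max lexx.
  have yy : `|y' - y| <= `|z - x|.
    rewrite /y' /y; case: (lerP 0 z) => hz; case: (lerP 0 x) => hx //.
    - rewrite subr0 ger0_norm// (le_trans _ (ler_norm _))//.
      by move: hx; clear; lra.
    - rewrite sub0r normrN ger0_norm// distrC (le_trans _ (ler_norm _))//.
      by move: hz; clear; lra.
    - by rewrite subrr normr0.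
  have Ay' : `[0, +oo[%classic y' by rewrite /= in_itv/= y'0.
  have h1 := hd y' Ay' (le_lt_trans yy zd).
  rewrite distrC /Psi -/y -/y'.
  have : `|psi y' - psi y| <= (`|D| + e) * `|y' - y|.
    rewrite mulrDl -normrM -lerBlDl; apply: le_trans h1; exact: lerB_dist.
  move/le_trans; apply.
  apply: (@le_trans _ _ ((`|D| + e) * (e / (`|D| + e)))).
    by rewrite ler_pM2l// (le_trans yy)// ltW.
  by rewrite mulrC divfK// gt_eqF.
have cinv : continuous (fun q : R => (Psi q)^-1).
  by move=> x; apply: cvgV; [exact: Psin0|exact: cPsi].
have cid : continuous (fun q : R => q) by move=> ?; exact: cvg_id.
have crat : continuous (fun q : R => q / Psi q) by exact: contM.
(* Starting below [q0] makes the primitives differentiable in the two-sided sense at [q0]. *)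
pose a := q0 - 1.
have aq : a < q0 by rewrite /a ltrBlDr ltrDl.
have [J dJ] := antiderivative a cinv.
have [K dK] := antiderivative a crat.
have [P qP KP] : exists2 P : R, q0 < P & 2 * M < K P - K q0.
  apply: (@improper_integral_gt K (fun q => q / Psi q) a q0) => //.
    by move=> x qx; apply: divr_ge0; [exact: le_trans qx|exact: ltW].
  rewrite (_ : integral _ _ _ = \int[lebesgue_measure]_(rho in `[q0, +oo[)
    (rho / psi rho)%:E)%E//.
  apply: eq_integral => x; rewrite inE/= in_itv/= andbT => qx.
  by rewrite PsiE// (le_trans q00).
have Jlt (x y : R) : a < x -> x < y -> J x < J y.
  move=> ax xy; have [c _ e] := is_derive_mvt dJ ax xy.
  by rewrite -subr_gt0 e mulr_gt0 ?subr_gt0// invr_gt0.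
have Jinj (x y : R) : a < x -> a < y -> J x = J y -> x = y.
  move=> ax ay JE; have [xy|yx|//] := ltgtP x y.
    by have := Jlt _ _ ax xy; rewrite JE ltxx.
  by have := Jlt _ _ ay yx; rewrite JE ltxx.
(* Inverse of [J] by choice; the default [q0] is met only outside the range of [J] on []a, +oo[]. *)
pose g (s : R) : R := xget q0 [set q : R | a < q /\ J q = s].
have gJ (x : R) : a < x -> g (J x) = x.
  move=> ax; rewrite /g; case: xgetP => [y _ [ay Jy]|/(_ x)]; first exact: Jinj.
  by case.
have dg (x : R) : a < x -> is_derive (J x) 1 g (Psi x).
  move=> ax; rewrite -[Psi x]invrK.
  have nx : \forall y \near x, a < y by exact: lt_nbhsr.
  apply: (is_derive_inverse (f := J)).
  - by near=> y; apply: gJ; near: y.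
  - near=> y; have ay : a < y by near: y.
    apply: differentiable_continuous; apply/derivable1_diffP.
    by have [] := dJ y ay.
  - exact: dJ.
  - by rewrite invr_eq0.
pose kap := J P - J q0.
have k0 : 0 < kap by rewrite subr_gt0; exact: Jlt.
pose p (d : R) : R := g (J P - d).
have pP (d : R) : 0 <= d <= kap -> exists2 q : R, q0 <= q <= P & J q = J P - d.
  move=> /andP[d0 dk]; have [||q] := @IVT R J q0 P (J P - d) (ltW qP).
  - apply: derivable_within_continuous => z; rewrite in_itv/= => /andP[qz _].
    by have [] := dJ z (lt_le_trans aq qz).
  - have JJ : J q0 <= J P by rewrite ltW// Jlt.
    rewrite (min_idPl JJ) (max_idPr JJ); move: d0 dk; rewrite /kap; clear; lra.
  - by rewrite in_itv/= => qb h; exists q.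
have pE (d : R) : 0 <= d <= kap -> [/\ q0 <= p d, p d <= P & J (p d) = J P - d].
  move=> /pP[q /andP[q1 q2] Jq]; rewrite /p -Jq gJ ?(lt_le_trans aq)//.
have dp (d : R) : 0 <= d <= kap -> is_derive d 1 p (- Psi (p d)).
  move=> db; have [q1 q2 Jq] := pE d db.
  have dgq := dg _ (lt_le_trans aq q1); rewrite Jq in dgq.
  have ds : is_derive d 1 (cst (J P) - @id R) (- 1 : R).
    by apply: is_derive_eq; rewrite sub0r.
  have := @is_derive1_comp _ g (cst (J P) - @id R) d _ _ dgq ds.
  by rewrite mulrN1.
pose h0 (d : R) : R := K P - K (p d).
have dh (d : R) : 0 <= d <= kap -> is_derive d 1 h0 (p d).
  move=> db; have [q1 q2 Jq] := pE d db.
  have dc := @is_derive1_comp _ K p d _ _ (dK _ (lt_le_trans aq q1)) (dp d db).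
  have -> : h0 = cst (K P) - (K \o p) by [].
  apply: is_derive_eq; rewrite sub0r mulrN opprK divfK//.
(* Clamping extends [h0] continuously from [[0, kap]] to the whole line. *)
pose h (d : R) : R := h0 (clamp 0 kap d).
have ch0 (d : R) : 0 <= d <= kap -> {for d, continuous h0}.
  move=> /dh[+ _] => dd; apply: differentiable_continuous.
  exact/derivable1_diffP.
have hE (d : R) : 0 <= d <= kap -> h d = h0 d.
  by move=> db; rewrite /h clamp_id.
have h00 : h0 0 = 0.
  by rewrite /h0 /p subr0 gJ ?subrr// (lt_trans aq).
exists P, kap, h; split => //.
- move=> d; apply: (@continuous_comp _ _ _ (clamp 0 kap) h0).
    exact: continuous_clamp.
  by apply: ch0; apply: clamp_itv; exact: ltW.
- rewrite hE ?(ltW k0) ?lexx// /h0 /p /kap subKr gJ//.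
  exact: ltW.
- move=> d db; rewrite hE//; have /andP[d0 dk] := db.
  have [||c] := @MVT_segment R h0 p 0 d d0.
  + move=> z; rewrite in_itv/= => /andP[z0 zd]; apply: dh.
    by rewrite (ltW z0)/= (le_trans (ltW zd)).
  + apply: derivable_within_continuous => z; rewrite in_itv/= => /andP[z0 zd].
    have zb : 0 <= z <= kap by rewrite z0 (le_trans zd).
    by have [] := dh z zb.
  + rewrite in_itv/= => /andP[c0 cd]; rewrite h00 !subr0 => ->.
    have cb : 0 <= c <= kap by rewrite c0 (le_trans cd).
    have [c1 c2 _] := pE c cb.
    by rewrite !ler_wpM2r.
- move=> d /andP[d0 dk]; have db : 0 <= d <= kap by rewrite !ltW.
  have [q1 q2 Jq] := pE d db.
  exists (p d).
  have r0 : 0 < Num.min d (kap - d) by rewrite lt_min d0 subr_gt0.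
  have rP (y : R) : `|y - d| < Num.min d (kap - d) -> 0 <= y <= kap.
    rewrite lt_min !ltr_norml => /andP[/andP[y1 y2] /andP[y3 y4]].
    by move: y1 y4; clear; lra.
  have hh (y : R) : `|y - d| < Num.min d (kap - d) -> h y = h0 y.
    by move=> /rP; exact: hE.
  split => //.
  + exact: lderiv_local r0 hh (is_derive_lderiv (dh d db)).
  + exact: rderiv_local r0 hh (is_derive_rderiv (dh d db)).
  + apply: (sderiv2_local r0 hh).
    rewrite -(PsiE (p d)); last exact: le_trans q1.
    apply: (is_derive_sderiv2 r0 (p := p)).
      by move=> y /rP; exact: dh.
    exact: is_derive_eps (dp d db).
Unshelve. all: by end_near. Qed.

End Profile.

(** * Reduction to difference quotients *)

(* [w] is [u] with both arguments clamped to the closed cylinder, which makes it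
   continuous on the whole plane, and [v] is [u_x]. *)
Record solution_data (R : realType) (l tau M : R)
  (a f b g : R -> R -> R -> R -> R)
    (w v : R -> R -> R) : Prop := {
  sol_cont : continuous (fun q : R * R => w q.1 q.2) ;
  sol_bound : forall t x : R, `|w t x| <= M ;
  sol_eq : forall t x : R, 0 < t < tau -> - l < x < l -> exists D L : R,
    [/\ lderiv (w ^~ x) t D, sderiv2 (w t) x L, lderiv (w t) x (v t x),
      rderiv (w t) x (v t x)
    & D = a t x (w t x) (v t x) * L + f t x (w t x) (v t x)] ;
  sol_right : forall t : R, 0 < t < tau -> exists2 D : R,
    lderiv (w ^~ l) t D /\ lderiv (w t) l (v t l) &
    D + b t l (w t l) (v t l) * v t l = g t l (w t l) (v t l) ;
  sol_left : forall t : R, 0 < t < tau -> exists2 D : R,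
    lderiv (w ^~ (- l)) t D /\ rderiv (w t) (- l) (v t (- l)) &
    D - b t (- l) (w t (- l)) (v t (- l)) * v t (- l) =
      g t (- l) (w t (- l)) (v t (- l)) }.

Section ClassicalSolutions.
Context {R : realType}.

Lemma cont_within_comp (T S V : topologicalType) (A : set S) (f : S -> V)
    (phi : T -> S) : {within A, continuous f} -> continuous phi ->
  (forall x, A (phi x)) -> continuous (fun x => f (phi x)).
Proof.
move=> /subspace_continuousP cf cphi Aphi x.
apply: (cvg_comp phi f _ (cf (phi x) (Aphi x))) => P /= hP.
have := cphi x _ hP; rewrite /nbhs/=; apply: filterS => y /=.
by apply; exact: Aphi.
Qed.

Lemma eps_is_derive (w : R -> R) (x D : R) :
  (forall e : R, 0 < e -> exists2 d : R, 0 < d & forall y, `|y - x| < d ->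
     `|w y - w x - D * (y - x)| <= e * `|y - x|) -> is_derive x 1 w D.
Proof.
move=> h.
have cv : h^-1 *: (w (h *: 1 + x) - w x) @[h --> 0^'] --> D.
  apply/cvgrPdist_le => e e0; have [d d0 hd] := h e e0.
  apply/nbhs_ballP; exists d => // s; rewrite /ball/= sub0r normrN => sd s0.
  rewrite /GRing.scale/= mulr1.
  have := hd (s + x); rewrite addrK => /(_ sd) hs.
  rewrite -(ler_pM2r (x := `|s|)) ?normr_gt0// -normrM.
  rewrite (_ : (D - s^-1 * (w (s + x) - w x)) * s =
    - (w (s + x) - w x - D * s)); last by field.
  by rewrite normrN.
apply: DeriveDef; first by apply/cvg_ex; exists D.
exact: cvg_lim cv.
Qed.

Lemma within_interior_is_derive (v w : R -> R) (a b x : R) :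
  derivable_within `[a, b] v x -> a < x < b ->
  (forall y, a <= y <= b -> w y = v y) ->
  is_derive x 1 w (derive_within `[a, b] v x).
Proof.
move=> dv /andP[ax xb] wv; apply: eps_is_derive => e e0.
have [d d0 hd] := derive_within_eps dv e0.
exists (Num.min d (Num.min (x - a) (b - x))) => [|y].
  by rewrite !lt_min d0; move: ax xb; clear; lra.
rewrite lt_min => /andP[yd]; rewrite lt_min !ltr_norml =>
  /andP[/andP[y1 y2] /andP[y3 y4]].
have yb : a <= y <= b by move: y1 y4; clear; lra.
rewrite !wv ?yb //; last by rewrite !ltW.
by apply: hd.
Qed.

Lemma within_lderiv (v w : R -> R) (a b x : R) :
  derivable_within `[a, b] v x -> a < x <= b ->
  (forall y, a <= y <= b -> w y = v y) ->
  lderiv w x (derive_within `[a, b] v x).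
Proof.
move=> dv /andP[ax xb] wv e e0.
have [d d0 hd] := derive_within_eps dv e0.
exists (Num.min d (x - a)) => [|s /andP[s0]].
  by rewrite lt_min d0; move: ax; clear; lra.
rewrite lt_min => /andP[sd sa].
have yb : a <= x - s <= b by move: s0 sa xb; clear; lra.
have := hd (x - s); rewrite /= in_itv/= yb addrAC subrr add0r normrN
  gtr0_norm//.
move=> /(_ isT sd); rewrite !wv ?yb //; last by rewrite (ltW ax).
by rewrite -normrN; congr (`|_| <= _); ring.
Qed.

Lemma within_rderiv (v w : R -> R) (a b x : R) :
  derivable_within `[a, b] v x -> a <= x < b ->
  (forall y, a <= y <= b -> w y = v y) ->
  rderiv w x (derive_within `[a, b] v x).
Proof.
move=> dv /andP[ax xb] wv e e0.
have [d d0 hd] := derive_within_eps dv e0.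
exists (Num.min d (b - x)) => [|s /andP[s0]].
  by rewrite lt_min d0; move: xb; clear; lra.
rewrite lt_min => /andP[sd sa].
have yb : a <= x + s <= b by move: s0 sa ax; clear; lra.
have := hd (x + s); rewrite /= in_itv/= yb addrAC subrr add0r gtr0_norm//.
move=> /(_ isT sd).
rewrite !opprK (_ : - (- x - s) = x + s); last by ring.
rewrite !wv//; last by rewrite ax ltW.
by congr (`|_| <= _); ring.
Qed.

(** The supremum norm sees the open cylinder only; every point of the closed one is a limit of
    interior points along the segment to the centre [(tau / 2, 0)]. *)
Lemma extend_bound (w : R -> R -> R) (l tau M : R) : 0 < l -> 0 < tau ->
  continuous (fun q : R * R => w q.1 q.2) ->
  (forall t x : R, 0 < t < tau -> - l < x < l -> `|w t x| <= M) ->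
  forall t x : R, 0 <= t <= tau -> - l <= x <= l -> `|w t x| <= M.
Proof.
move=> l0 tau0 cw wM t x /andP[t0 tT] /andP[x0 xl].
rewrite leNgt; apply/negP => h.
pose phi s := w (t + s * (tau / 2 - t)) (x * (1 - s)).
have cphi : continuous phi.
  have cid : continuous (fun s : R => s) by move=> ?; exact: cvg_id.
  apply: (cont_uncurry cw (f := fun s : R => t + s * (tau / 2 - t))
    (g := fun s : R => x * (1 - s))).
    apply: contD; first exact: cst_continuous.
    by apply: contM => //; exact: cst_continuous.
  apply: contM; first exact: cst_continuous.
  by apply: contB => //; exact: cst_continuous.
have /cvgrPdist_lt := cphi 0.
move=> /(_ (`|w t x| - M)); rewrite subr_gt0 => /(_ h) /nbhs_ballP[d /= d0 hd].
pose s := Num.min (1 / 2) (d / 2).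
have s0 : 0 < s by rewrite lt_min !divr_gt0.
have [s1 sd] : s <= 1 / 2 /\ s <= d / 2 by apply/andP; rewrite -le_min.
have bs : ball 0 d s.
  by rewrite /ball/= sub0r normrN gtr0_norm//; move: sd d0; clear; lra.
have := hd s bs.
have -> : phi 0 = w t x by rewrite /phi mul0r addr0 subr0 mulr1.
have t2 : 0 < t + s * (tau / 2 - t) < tau.
  have e1 : t + s * (tau / 2 - t) = (1 - s) * t + s * (tau / 2) by ring.
  have e2 : tau - (t + s * (tau / 2 - t)) = (1 - s) * (tau - t) + s * (tau / 2).
    by field.
  have p1 : 0 < s * (tau / 2) by rewrite mulr_gt0// divr_gt0.
  have p2 : 0 <= (1 - s) * t by rewrite mulr_ge0//; move: s1; clear; lra.
  have p3 : 0 <= (1 - s) * (tau - t).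
    by rewrite mulr_ge0 ?subr_ge0//; move: s1; clear; lra.
  by move: e1 e2 p1 p2 p3; set A := t + _; clear; lra.
have x2 : - l < x * (1 - s) < l.
  have p1 : 0 < s * l by rewrite mulr_gt0.
  have p2 : 0 <= (1 - s) * (l - x).
    by rewrite mulr_ge0 ?subr_ge0//; move: s1; clear; lra.
  have p3 : 0 <= (1 - s) * (l + x).
    by rewrite mulr_ge0 ?subr_ge0//; move: s1 x0; clear; lra.
  by move: p1 p2 p3; clear; lra.
have := wM _ _ t2 x2; rewrite -/(phi s) => h1 h2.
have := le_lt_trans (lerB_dist _ _) h2.
by move: h1; clear; lra.
Qed.

(** The equations are available for [0 < t < tau], where the derivatives of [u] relative to the
    closed cylinder give left derivatives in time, also at the end points. Clamping both arguments
    carries the bound [M] to the whole plane. *)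
Lemma extract_solution (l tau M : R) (a f b g : R -> R -> R -> R -> R)
    (u : R -> R -> R) : 0 < l -> 0 < tau ->
  C12_on tau l (closed_cyl tau l) u -> classical_solution tau l a f b g u ->
  (sup_norm (open_cyl tau l) u <= M%:E)%E ->
  exists w : R -> R -> R, solution_data l tau M a f b g w (dx l u) /\
    forall t x : R, 0 <= t <= tau -> - l <= x <= l -> w t x = u t x.
Proof.
move=> l0 tau0 [cu du _ _] [_ _ _ eqi eqb] uM.
have ll : - l <= l by move: l0; clear; lra.
pose w t x := u (clamp 0 tau t) (clamp (- l) l x).
have wE (t x : R) : 0 <= t <= tau -> - l <= x <= l -> w t x = u t x.
  by move=> tb xb; rewrite /w !clamp_id.
have cw : continuous (fun q : R * R => w q.1 q.2).
  apply: (@cont_within_comp _ _ _ (closed_cyl tau l)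
    (fun q : R * R => u q.1 q.2)
    (fun q : R * R => (clamp 0 tau q.1, clamp (- l) l q.2))) => //.
    have c1 : continuous (fun q : R * R => clamp 0 tau q.1).
      by apply: (cont_comp (@continuous_clamp _ _ _)) => q; exact: cvg_fst.
    have c2 : continuous (fun q : R * R => clamp (- l) l q.2).
      by apply: (cont_comp (@continuous_clamp _ _ _)) => q; exact: cvg_snd.
    by move=> q; exact: (cvg_pair (c1 q) (c2 q)).
  by move=> q; split; rewrite /= in_itv/= clamp_itv// ltW.
have wM (t x : R) : `|w t x| <= M.
  rewrite -[w t x]/(u _ _) -wE ?clamp_itv ?(ltW tau0)//.
  apply: (extend_bound l0 tau0 cw) => [||];
    [|by rewrite clamp_itv// ltW|exact: clamp_itv].
  move=> t' x' /andP[t1 t2] /andP[x1 x2].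
  have -> : w t' x' = u t' x' by apply: wE; rewrite !ltW.
  rewrite -lee_fin; apply: le_trans uM; apply: ereal_sup_ubound.
  by exists (t', x') => //; split; rewrite /= in_itv/= ?t1 ?x1.
have cyl (t x : R) : 0 < t < tau -> - l <= x <= l -> closed_cyl tau l (t, x).
  by move=> /andP[t1 t2] xb; split; rewrite /= in_itv/= ?xb// !ltW.
have hT (t x : R) : 0 < t < tau -> - l <= x <= l ->
    lderiv (w ^~ x) t (dt tau u t x).
  move=> tb xb; have [dT _ _] := du t x (cyl t x tb xb).
  apply: (within_lderiv dT) => [|y yb]; last exact: wE.
  by case/andP: tb => -> /ltW.
have wtE (t : R) : 0 < t < tau -> forall y : R, - l <= y <= l -> w t y = u t y.
  by move=> /andP[t1 t2] y yb; apply: wE; rewrite // !ltW.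
exists w; split=> //; split => //.
- move=> t x tb xb; have xb' : - l <= x <= l by case/andP: xb => /ltW-> /ltW.
  have [_ dX dXX] := du t x (cyl t x tb xb').
  exists (dt tau u t x), (dxx l u t x); split.
  + exact: hT.
  + case/andP: xb => x1 x2.
    have r0 : 0 < Num.min (x + l) (l - x).
      by rewrite lt_min; move: x1 x2; clear; lra.
    have yP (y : R) : `|y - x| < Num.min (x + l) (l - x) -> - l < y < l.
      rewrite lt_min !ltr_norml => /andP[/andP[y1 y2] /andP[y3 y4]].
      by move: y1 y4; clear; lra.
    apply: (@sderiv2_local R _ (u t) x _ _ r0).
      by move=> y /yP/andP[y1 y2]; apply: wtE; rewrite // !ltW.
    apply: (is_derive_sderiv2 r0 (p := dx l u t)).
      move=> y /yP yb; apply: within_interior_is_derive; [|exact: yb|by []].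
      have yb' : - l <= y <= l by case/andP: yb => /ltW-> /ltW.
      by have [] := du t y (cyl t y tb yb').
    apply: is_derive_eps; apply: within_interior_is_derive;
      [exact: dXX| |by []].
    by rewrite x1.
  + apply: (within_lderiv dX); last exact: wtE.
    by case/andP: xb => -> /ltW.
  + apply: (within_rderiv dX); last exact: wtE.
    by case/andP: xb => /ltW-> ->.
  + by rewrite (wtE t tb x xb') -(eqi t x tb xb); ring.
- move=> t tb; have lb : - l <= l <= l by rewrite ll lexx.
  have [_ dX _] := du t l (cyl t l tb lb).
  exists (dt tau u t l); last by rewrite (wtE t tb l lb); case: (eqb t tb).
  split; first exact: hT.
  apply: (within_lderiv dX); last exact: wtE.
  by rewrite lexx andbT; move: l0; clear; lra.
- move=> t tb; have lb : - l <= - l <= l by rewrite ll lexx.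
  have [_ dX _] := du t (- l) (cyl t (- l) tb lb).
  exists (dt tau u t (- l)); last by rewrite (wtE t tb (- l) lb);
    case: (eqb t tb).
  split; first exact: hT.
  apply: (within_rderiv dX); last exact: wtE.
  by rewrite lexx/=; move: l0; clear; lra.
Qed.

End ClassicalSolutions.

(** * Hoelder continuity of the slopes *)

Section LocalHolder.
Context {R : realType}.
Implicit Types (U w : R -> R -> R).

Lemma slopes_lderiv U (s t lo hi m M th x p : R) :
  slopes U s t lo hi m M -> s <= th <= t -> lo < x <= hi ->
  lderiv (U th) x p -> m <= p <= M.
Proof.
move=> sl thb /andP[lx xh] hp.
have lin c : lderiv (fun z : R => c * z) x c.
  by move=> e e0; exists 1 => // z /andP[z0 _];
    rewrite (_ : _ - _ = 0) ?normr0 ?mulr_ge0 ?(ltW e0) ?(ltW z0)//; ring.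
have d0 : 0 < x - lo by rewrite subr_gt0.
have key z : 0 < z < x - lo ->
    m * z <= U th x - U th (x - z) <= M * z.
  move=> /andP[z0 z1]; have := sl th (x - z) x thb.
  rewrite (_ : x - (x - z) = z); last by ring.
  by apply; move: z0 z1 xh; clear; lra.
apply/andP; split.
- apply: (lderiv_min d0 (lin m) hp) => z /key /andP[+ _].
  by clear; lra.
- apply: (lderiv_min d0 hp (lin M)) => z /key /andP[_].
  by clear; lra.
Qed.

Lemma slopes_rderiv U (s t lo hi m M th x p : R) :
  slopes U s t lo hi m M -> s <= th <= t -> lo <= x < hi ->
  rderiv (U th) x p -> m <= p <= M.
Proof.
move=> sl thb /andP[lx xh].
apply: (@slopes_lderiv (fun th y => - U th (- y)) s t (- hi) (- lo)) => //.
  move=> th' y' x' thb' hy yx xl.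
  have := sl th' (- x') (- y') thb'.
  rewrite (_ : - y' - - x' = x' - y'); last by ring.
  rewrite (_ : - U th' (- x') - - U th' (- y') = U th' (- y') - U th' (- x')).
    by apply; move: hy yx xl; clear; lra.
  by ring.
by rewrite ltrN2 lerN2 xh.
Qed.

Lemma bottom_le (t0 r mu r' mu' : R) :
  r ^+ 2 / mu <= r' ^+ 2 / mu' -> bottom t0 r' mu' <= bottom t0 r mu.
Proof.
move=> h; rewrite /bottom ge_max !le_max lexx/=; apply/orP; right.
by rewrite lerD2l lerN2.
Qed.

Lemma powRXn (x d : R) k : 0 <= x -> (x `^ d) ^+ k = (x ^+ k) `^ d.
Proof.
by move=> x0; rewrite -(powR_mulrn k (powR_ge0 x d)) powRAC (powR_mulrn k x0).
Qed.

(** A radius [r] lies between two consecutive [(1 / 32) ^ k * r0]; the larger cylinder is used, and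
    its radius is less than [32 * r], whence the factor 32. *)
Lemma holder_of_decay U (t0 x0 mu r0 om delta r : R) :
  0 < mu -> 0 < r0 -> 0 < om -> 0 <= delta ->
  (forall k, exists m, let r := (1 / 32) ^+ k * r0 in
     slopes U (bottom t0 r mu) t0 (x0 - r) (x0 + r)
       m (m + ((1 / 32) `^ delta) ^+ k * om)) ->
  0 < r <= r0 ->
  exists m, slopes U (bottom t0 r mu) t0 (x0 - r) (x0 + r)
    m (m + (32 * r / r0) `^ delta * om).
Proof.
move=> mu0 r00 om0 d0 dec /andP[rp rr0].
have p0 : (0 : R) <= 1 / 32 by clear; lra.
have ex : exists k, (1 / 32) ^+ k * r0 < r.
  pose N := Num.bound (r0 / r).
  have hN : r0 / r < 2 ^+ N by apply: upper_nthrootP.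
  have h2 : 2 ^+ N <= 32 ^+ N :> R by rewrite lerXn2r ?nnegrE//; clear; lra.
  exists N; rewrite expr_div_n expr1n mul1r mulrC ltr_pdivrMr ?exprn_gt0//.
  by rewrite -ltr_pdivrMl// mulrC (lt_le_trans hN).
(* The least exponent with radius below [r] is not 0 because [r <= r0], so its predecessor
   exists. *)
case: (ex_minnP ex) => -[|k] hk mink.
  by move: hk; rewrite expr0 mul1r ltNge rr0.
have rk : r <= (1 / 32) ^+ k * r0.
  by rewrite leNgt; apply/negP => /mink; rewrite ltnn.
have [m hm] := dec k; exists m; move: hm => /=.
apply: slopes_sub => //.
- apply: bottom_le; rewrite ler_pM2r ?invr_gt0//.
  by rewrite lerXn2r ?nnegrE ?(ltW rp) ?(le_trans (ltW rp)).
- by rewrite lerD2l lerN2.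
- by rewrite lerD2l.
rewrite lerD2l ler_pM2r// powRXn//.
apply: ge0_ler_powR => //; rewrite ?nnegrE ?exprn_ge0//.
  by rewrite divr_ge0 ?mulr_ge0 ?(ltW rp) ?(ltW r00).
rewrite ler_pdivlMr//; move: hk; rewrite exprS -mulrA.
by clear; lra.
Qed.

Lemma powR_le_exp (delta alpha x : R) : 0 <= x <= 1 -> 0 < delta <= alpha ->
  x `^ alpha <= x `^ delta.
Proof.
move=> /andP[x0 x1] /andP[d0 da].
move: x0; rewrite le_eqVlt => /orP[/eqP<-|x0].
  by rewrite !powR0// gt_eqF// (lt_le_trans d0).
rewrite /powR gt_eqF// ler_expR ler_wnM2r//.
exact: ln_le0.
Qed.

(** Cylinders may cross the end points, hence the reflection. The decay starts from slopes in
    [[- P, P]], of range at most [om]. Since [delta <= alpha], the initial oscillation shrinks at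
    least as fast as the quarter range allowed at each scale, and [delta < 1] keeps the decay factor
    above [1 / 32]. *)
Lemma local_holder w (l t0 x0 r0 mu kap F H P om delta alpha : R) :
  0 < l -> - l <= x0 <= l -> 0 < r0 <= l -> 1 <= kap -> 0 < mu -> 0 <= t0 ->
  0 <= F -> 0 <= H -> 0 < delta <= alpha -> alpha < 1 ->
  1 - gain kap <= (1 / 32) `^ delta ->
  continuous (fun q : R * R => w q.1 q.2) ->
  slopes w 0 t0 (- l) l (- P) P ->
  (forall r : R, 0 < r -> exists c : R, forall y x : R,
     - l <= y -> x0 - r <= y -> y <= x -> x <= l -> x <= x0 + r ->
     (c - H * r `^ alpha) * (x - y) <= w 0 x - w 0 y <=
       (c + H * r `^ alpha) * (x - y)) ->
  (forall t x : R, bottom t0 r0 mu < t <= t0 -> `|x - x0| < r0 ->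
     parabolic_at (odd_reflect w l) mu (kap * mu) F t x) ->
  2 * P <= om -> 0 < om -> 4 * (H * r0 `^ alpha) <= om ->
  F * r0 <= gain kap / 2 * (mu * om) ->
  forall r : R, 0 < r <= r0 -> exists m : R,
    slopes (odd_reflect w l) (bottom t0 r mu) t0 (x0 - r) (x0 + r)
      m (m + (32 * r / r0) `^ delta * om).
Proof.
move=> l0 x0b /andP[r00 r0l] kap1 mu0 t00 F0 H0 da a1 gd cw sl init eqU omP om0
  omH omF r rb.
have /andP[d0 dla] := da.
have r02 : 0 <= r0 <= 2 * l by rewrite ltW//=; move: r00 r0l l0; clear; lra.
have p01 : 0 <= (1 / 32 : R) <= 1 by clear; lra.
have p0 : 0 <= (1 / 32 : R) by case/andP: p01.
apply: holder_of_decay => //; first exact: ltW.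
apply: (@osc_decay R _ kap mu F t0 x0 r0 om _ (- P)) => //.
- have {1}-> : 1 / 32 = (1 / 32) `^ 1 :> R by rewrite powRr1.
  by apply: powR_le_exp; rewrite // d0 (le_trans dla)// ltW.
- exact: continuous_reflect.
- apply: (@slopes_sub _ _ _ _ _ _ (- P) P) => //; last first.
  + apply: (@slopes_reflect _ w l (bottom t0 r0 mu) t0) => //.
    move=> th y x /andP[th1 th2] y1 _ yx x1 _; apply: sl => //.
    by rewrite th2 (le_trans _ th1)// /bottom le_max lexx.
  + by move: omP; clear; lra.
- move=> t x tb xb; apply: eqU => //; rewrite ltr_norml; move: xb; clear; lra.
move=> k; pose rk := (1 / 32) ^+ k * r0.
have rk0 : 0 < rk by rewrite mulr_gt0// exprn_gt0//; clear; lra.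
have rkr : rk <= r0.
  by rewrite /rk ler_piMl ?(ltW r00)// exprn_ile1//; case/andP: p01.
have [c hc] := init rk rk0; exists c => /=; rewrite -/rk.
have hle : H * rk `^ alpha <= ((1 / 32) `^ delta) ^+ k * om / 4.
  rewrite /rk powRM ?exprn_ge0 ?(ltW r00)//.
  have h1 : ((1 / 32) ^+ k) `^ alpha <= ((1 / 32) `^ delta) ^+ k.
    rewrite powRXn//.
    by apply: powR_le_exp => //; rewrite exprn_ge0// exprn_ile1//;
      case/andP: p01.
  have h2 : 0 <= H * r0 `^ alpha by rewrite mulr_ge0 ?powR_ge0.
  have : ((1 / 32) ^+ k) `^ alpha * (H * r0 `^ alpha) <=
      ((1 / 32) `^ delta) ^+ k * (om / 4).
    apply: ler_pM; [exact: powR_ge0|exact: h2|exact: h1|].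
    by move: omH; clear; lra.
  by clear; lra.
apply: (@slopes_sub _ _ 0 0 (x0 - rk) (x0 + rk) (c - H * rk `^ alpha)
  (c + H * rk `^ alpha)) => //;
  last first.
- apply: slopes_reflect => //.
    by rewrite ltW//= (le_trans rkr)//; case/andP: r02.
  move=> th y x /andP[th1 th2]; have -> : th = 0 by apply/eqP;
    rewrite eq_le th2 th1.
  exact: hc.
- by rewrite lerD2l.
- by rewrite lerD2l lerN2.
Qed.

End LocalHolder.

(** * Choice of the exponent, compactness, and the gradient estimate *)

Section Estimates.
Context {R : realType}.

(** One step divides the radius by 32 and multiplies the range by [1 - gain kap]; [delta] is the
    exponent relating the two, capped by [alpha]. *)
Lemma holder_exponent (kap alpha : R) : 0 < alpha < 1 ->
  exists2 delta : R, 0 < delta <= alpha & 1 - gain kap <= (1 / 32) `^ delta.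
Proof.
move=> /andP[a0 a1]; have /andP[g0 g1] := gain_bounds kap.
have p0 : (0 : R) < 1 / 32 by clear; lra.
have p1 : (1 / 32 : R) < 1 by clear; lra.
have lnp : ln (1 / 32 : R) < 0 by rewrite ln_lt0// p0.
have gp : 0 < 1 - gain kap < 1 by move: g0 g1; clear; lra.
have lng : ln (1 - gain kap) < 0 by rewrite ln_lt0.
pose d := ln (1 - gain kap) / ln (1 / 32).
have d0 : 0 < d by rewrite /d nmulr_rgt0// invr_lt0.
have dE : (1 / 32) `^ d = 1 - gain kap.
  rewrite /powR gt_eqF// /d divfK ?lt_eqF// lnK// posrE.
  by case/andP: gp.
exists (Num.min alpha d); first by rewrite lt_min a0 d0 ge_min lexx.
rewrite -dE; apply: powR_le_exp; first by rewrite !ltW.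
by rewrite lt_min a0 d0 ge_min lexx orbT.
Qed.

Lemma compact_bound (T : topologicalType) (K : set T) (f : T -> R) :
  compact K -> continuous f -> exists2 B : R, 0 <= B & forall q,
    K q -> `|f q| <= B.
Proof.
move=> cK cf; have [->|/set0P K0] := eqVneq K set0; first by exists 0.
have cn : continuous (fun q => `|f q|).
  exact: (cont_comp (@norm_continuous R R)).
have [q _ h] := compact_EVT_max K0 cK (continuous_subspaceT cn).
by exists `|f q| => // q' Kq'; apply: h; exact: mem_set.
Qed.

Lemma compact_pos_min (T : topologicalType) (K : set T) (f : T -> R) :
  compact K -> continuous f -> (forall q, K q -> 0 < f q) ->
  exists2 c : R, 0 < c & forall q, K q -> c <= f q.
Proof.
move=> cK cf f0; have [->|/set0P K0] := eqVneq K set0; first by exists 1.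
have [q /set_mem Kq h] := compact_EVT_min K0 cK (continuous_subspaceT cf).
by exists (f q) => [|q' Kq']; [exact: f0|apply: h; exact: mem_set].
Qed.

(** The pairs with [|c p - c q| >= e] form a compact set on which the sum of the coordinate
    distances is positive, hence at least some [m > 0]; four distances below [m / 4] exclude such a
    pair. *)
Lemma unif_cont4 (K : set (R * R * R * R)) (c : R * R * R * R -> R) (e : R) :
  compact K -> continuous c -> 0 < e ->
  exists2 d : R, 0 < d & forall p q, K p -> K q ->
    `|p.1.1.1 - q.1.1.1| < d -> `|p.1.1.2 - q.1.1.2| < d ->
    `|p.1.2 - q.1.2| < d -> `|p.2 - q.2| < d -> `|c p - c q| < e.
Proof.
move=> cK cc e0.
pose V := ((R * R * R * R) * (R * R * R * R))%type.
have c1 (A B : topologicalType) : continuous (@fst A B) by move=> q;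
  exact: cvg_fst.
have c2 (A B : topologicalType) : continuous (@snd A B) by move=> q;
  exact: cvg_snd.
have cp1 (f : R * R * R * R -> R) : continuous f -> continuous (fun q : V =>
  f q.1).
  by move=> cf; apply: (cont_comp cf); exact: c1.
have cp2 (f : R * R * R * R -> R) : continuous f -> continuous (fun q : V =>
  f q.2).
  by move=> cf; apply: (cont_comp cf); exact: c2.
have cn (f : R * R * R * R -> R) : continuous f ->
    continuous (fun q : V => `|f q.1 - f q.2|).
  move=> cf; apply: (cont_comp (@norm_continuous R R)
    (f := fun q : V => f q.1 - f q.2)).
  by apply: contB; [exact: cp1|exact: cp2].
have f1 : continuous (fun q : R * R * R * R => q.1.1.1).
  by do 2 apply: (cont_comp (c1 _ _)); exact: c1.
have f2 : continuous (fun q : R * R * R * R => q.1.1.2).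
  by apply: (cont_comp (c2 _ _)); apply: (cont_comp (c1 _ _)); exact: c1.
have f3 : continuous (fun q : R * R * R * R => q.1.2).
  by apply: (cont_comp (c2 _ _)); exact: c1.
have f4 : continuous (fun q : R * R * R * R => q.2) by exact: c2.
pose D (q : V) := `|q.1.1.1.1 - q.2.1.1.1| + `|q.1.1.1.2 - q.2.1.1.2| +
  `|q.1.1.2 - q.2.1.2| + `|q.1.2 - q.2.2|.
have cD : continuous D.
  rewrite /D; apply: contD; last exact: (cn _ f4).
  apply: contD; last exact: (cn _ f3).
  by apply: contD; [exact: (cn _ f1)|exact: (cn _ f2)].
have cbad : compact ((K `*` K) `&` [set q : V | e <= `|c q.1 - c q.2|]).
  apply: compact_closedI; first exact: compact_setX.
  apply: (@preimage_closed _ _ (fun q : V =>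
    `|c q.1 - c q.2|) [set x | e <= x]).
    by move=> q _; exact: (cn _ cc).
  exact: closed_ge.
have [|m m0 hm] := compact_pos_min cbad cD.
  move=> [p q] [[Kp Kq] /=]; apply: contraTT; rewrite -leNgt => h.
  have := h; rewrite /D/= => h'.
  have [n1 n2 n3 n4] : [/\ p.1.1.1 = q.1.1.1, p.1.1.2 = q.1.1.2, p.1.2 = q.1.2
      & p.2 = q.2].
    have := normr_ge0 (p.1.1.1 - q.1.1.1);
      have := normr_ge0 (p.1.1.2 - q.1.1.2).
    have := normr_ge0 (p.1.2 - q.1.2); have := normr_ge0 (p.2 - q.2).
    move=> k1 k2 k3 k4.
    have z (x y : R) : `|x - y| <= 0 -> x = y.
      by rewrite normr_le0 subr_eq0 => /eqP.
    by split; apply: z; move: h' k1 k2 k3 k4; clear; lra.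
  have -> : p = q.
    move: p q n1 n2 n3 n4 {Kp Kq h h'} =>
      [[[p1 p2] p3] p4] [[[q1 q2] q3] q4] /=.
    by move=> -> -> -> ->.
  by rewrite subrr normr0 -ltNge.
exists (m / 4) => [|p q Kp Kq h1 h2 h3 h4]; first by rewrite divr_gt0.
rewrite ltNge; apply/negP => h.
have := hm (p, q) (conj (conj Kp Kq) h); rewrite /D/=.
by move: h1 h2 h3 h4; clear; lra.
Qed.

(** [gradient_bound] is applied to [w] and to [- w], each using two of the four conditions on [g].
    It is applied on [[0, t]] with [t < tau], since nothing is known at the final time. *)
Lemma gradient_estimate (T l tau M q0 P kap : R) (psi h : R -> R)
    (a f b g : R -> R -> R -> R -> R) (w v : R -> R -> R) :
  0 < l -> tau <= T -> 0 <= q0 -> comparison_profile psi q0 M P kap h ->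
  (forall t x z p : R, 0 <= t <= T -> - l <= x <= l -> 0 < a t x z p) ->
  (forall t x z p : R, 0 <= t <= T -> - l <= x <= l -> - M <= z <= M ->
     `|f t x z p| <= a t x z p * psi `|p|) ->
  (forall t z p : R, 0 < t <= T -> - M <= z <= M -> q0 <= p ->
     [/\ g t l z p <= b t l z p * p,
         - g t l z (- p) <= b t l z (- p) * p,
         - g t (- l) z p <= b t (- l) z p * p
       & g t (- l) z (- p) <= b t (- l) z (- p) * p]) ->
  solution_data l tau M a f b g w v ->
  (forall y x : R, - l <= y -> y <= x -> x <= l ->
     `|w 0 x - w 0 y| <= q0 * (x - y)) ->
  forall t : R, 0 <= t < tau -> slopes w 0 t (- l) l (- P) P.
Proof.
move=> l0 tT q00 prof a0 fa gb [cw wM eqi eqr eql] init t /andP[t0 tt].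
have ll : - l <= l by move: l0; clear; lra.
have lb : - l <= l <= l by rewrite ll lexx.
have lb' : - l <= - l <= l by rewrite ll lexx.
have wMb (s x : R) : - M <= w s x <= M by rewrite -ler_norml.
have tb (s : R) : 0 < s <= t -> [/\ 0 < s < tau, 0 <= s <= T & 0 < s <= T].
  move=> /andP[s0 st]; have sT : s <= T
    by rewrite (le_trans st)// (le_trans (ltW tt)).
  by rewrite s0 (le_lt_trans st) // (ltW s0) sT.
have eqw s x : 0 < s <= t -> - l < x < l -> gradient_eq psi w s x.
  move=> /tb[s1 s2 s3] xb; have [D [L [hD hL hl hr e]]] := eqi s x s1 xb.
  have xb' : - l <= x <= l by case/andP: xb => /ltW-> /ltW.
  exists D, L, (v s x), (a s x (w s x) (v s x)), (f s x (w s x) (v s x)).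
  by split => //; split; [exact: a0|exact: fa].
have up := @gradient_bound R w psi l t q0 M P kap h l0 q00 prof cw.
have dn := @gradient_bound R (fun t x =>
  - w t x) psi l t q0 M P kap h l0 q00 prof.
move=> th y x thb y1 yx x1; apply/andP; split; last first.
  apply: up => //.
  - move=> y' x' h1 h2 h3; apply: le_trans (init y' x' h1 h2 h3);
    exact: ler_norm.
  - move=> s /tb[s1 s2 s3]; have [D [hD hl] e] := eqr s s1.
    exists D, (v s l); split => // qv.
    have [k _ _ _] := gb s (w s l) (v s l) s3 (wMb _ _) qv.
    by move: e k; clear; lra.
  - move=> s /tb[s1 s2 s3]; have [D [hD hl] e] := eql s s1.
    exists D, (v s (- l)); split => // qv.
    have [_ _ k _] := gb s (w s (- l)) (v s (- l)) s3 (wMb _ _) qv.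
    by move: e k; clear; lra.
have : - w th x - - w th y <= P * (x - y).
  apply: dn => //.
  - move=> q; apply: continuousN; exact: cw.
  - by move=> s z _ _; rewrite normrN.
  - move=> y' x' h1 h2 h3; apply: le_trans (init y' x' h1 h2 h3).
    by rewrite -opprB opprK addrC -normrN opprB ler_norm.
  - move=> s z sb zb.
    have [D [L [p [a1 [f1 [hD hL [h1 h2] [h3 h4] e]]]]]] := eqw s z sb zb.
    exists (- D), (- L), (- p), a1, (- f1); split.
    + exact: lderivN.
    + exact: sderiv2N.
    + by split; [exact: lderivN|exact: rderivN].
    + by rewrite !normrN.
    + by rewrite e; ring.
  - move=> s /tb[s1 s2 s3]; have [D [hD hl] e] := eqr s s1.
    exists (- D), (- v s l); split; [exact: lderivN|exact: lderivN|] => qv.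
    have [_ + _ _] := gb s (w s l) (- v s l) s3 (wMb _ _) qv.
    by rewrite opprK; move: e; clear; lra.
  - move=> s /tb[s1 s2 s3]; have [D [hD hl] e] := eql s s1.
    exists (- D), (- v s (- l)); split; [exact: lderivN|exact: rderivN|] => qv.
    have [_ _ _] := gb s (w s (- l)) (- v s (- l)) s3 (wMb _ _) qv.
    by rewrite opprK; move: e; clear; lra.
by clear; lra.
Qed.

End Estimates.

(** What the Hoelder estimate retains of a solution: [f], [psi], [b] and [g] are absorbed into the
    constants [F], [N], [P]. Only [A] keeps its arguments, because its uniform continuity is used in
    the second pass. *)
Record bounded_flow (R : realType) (l tau M F N P : R)
    (A : R -> R -> R -> R -> R) (w v : R -> R -> R) : Prop := {
  flow_cont : continuous (fun q : R * R => w q.1 q.2) ;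
  flow_bound : forall t x : R, `|w t x| <= M ;
  flow_slopes : forall t : R, 0 <= t < tau -> slopes w 0 t (- l) l (- P) P ;
  flow_eq : forall t x : R, 0 < t < tau -> - l < x < l -> exists D L f : R,
    [/\ lderiv (w ^~ x) t D, sderiv2 (w t) x L,
      lderiv (w t) x (v t x) /\ rderiv (w t) x (v t x), `|f| <= F
    & D = A t x (w t x) (v t x) * L + f] ;
  flow_side : forall t c : R, 0 < t < tau -> c = l \/ c = - l ->
    exists2 D : R, lderiv (w ^~ c) t D & `|D| <= N }.

(** * The two passes of the Hoelder estimate *)

Section HolderEstimate.
Context {R : realType}.
Implicit Types (A : R -> R -> R -> R -> R) (w v : R -> R -> R).

Lemma flow_slopes_v l tau M F N P A w v (s t lo hi m m' th x : R) :
  bounded_flow l tau M F N P A w v ->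
  slopes (odd_reflect w l) s t lo hi m m' -> s <= th <= t -> 0 < th < tau ->
  lo <= x <= hi -> lo < hi -> - l < x < l -> m <= v th x <= m'.
Proof.
move=> fl sl thb thb' /andP[x1 x2] lohi xb.
have [_ [_ [_ [_ _ [hl hr] _ _]]]] := flow_eq fl thb' xb.
have r0 : 0 < Num.min (x + l) (l - x).
  by case/andP: xb => ? ?; rewrite lt_min; apply/andP; split; lra.
have loc y : `|y - x| < Num.min (x + l) (l - x)
  -> odd_reflect w l th y = w th y.
  rewrite lt_min !ltr_norml => /andP[/andP[y1 y2] /andP[y3 y4]].
  by rewrite reflect_mid//; move: y1 y4; clear; lra.
move: x1; rewrite le_eqVlt => /orP[/eqP xE|x1].
  apply: (slopes_rderiv sl thb _ (rderiv_local r0 loc hr)).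
  by rewrite -xE lexx.
apply: (slopes_lderiv sl thb _ (lderiv_local r0 loc hl)).
by rewrite x1.
Qed.

Lemma flow_v_bound l tau M F N P A w v (t x : R) :
  bounded_flow l tau M F N P A w v -> 0 < t < tau -> - l < x < l ->
  `|v t x| <= P.
Proof.
move=> fl tb xb; have [_ [_ [_ [_ _ [hl _] _ _]]]] := flow_eq fl tb xb.
have /andP[t0 tt] := tb; have /andP[x1 x2] := xb.
have sl : slopes w 0 t (- l) l (- P) P by apply: (flow_slopes fl); rewrite ltW.
by rewrite ler_norml; apply: (slopes_lderiv sl _ _ hl);
  [rewrite lexx andbT ltW|rewrite x1 ltW].
Qed.

Lemma flow_parabolic l tau M F N P A w v (mu nu t x : R) :
  0 < l -> 0 <= F -> 0 <= N -> mu <= nu ->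
  bounded_flow l tau M F N P A w v -> 0 < t < tau -> `|x| < 3 * l ->
  (- l < fold_itv l x < l ->
     mu <= A t (fold_itv l x) (w t (fold_itv l x)) (v t (fold_itv l x)) <= nu)
       ->
  parabolic_at (odd_reflect w l) mu nu (F + 2 * N) t x.
Proof.
move=> l0 F0 N0 mn fl tb xb hA; apply: reflect_parabolic => //.
- move=> yb; have [D [L [f [hD hL _ hf e]]]] := flow_eq fl tb yb.
  exists D, L, (A t (fold_itv l x) (w t (fold_itv l x)) (v t (fold_itv l x))),
    f.
  by split => //; exact: hA.
- by apply: (flow_side fl tb); left.
- by apply: (flow_side fl tb); right.
Qed.

(** Ensures that the coefficient read at a folded point is still close to its value at [x0]. *)
Lemma fold_near l (x0 x : R) : - l <= x0 <= l -> `|fold_itv l x - x0| <= `|x -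
  x0|.
Proof.
move=> /andP[x1 x2]; rewrite /fold_itv; case: ltP => [lx|xl].
  rewrite [X in _ <= X]ger0_norm; last by lra.
  by rewrite ler_norml; lra.
case: ltP => // xl'; rewrite [X in _ <= X]ler0_norm; last by lra.
by rewrite ler_norml; lra.
Qed.

Lemma small_bound (s : seq R) : all (fun c => 0 < c) s ->
  exists2 r : R, 0 < r & all (fun c => r <= c) s.
Proof.
elim: s => [|c s IH] /=; first by exists 1.
move=> /andP[c0 /IH[r r0 hr]]; exists (Num.min c r); first by rewrite lt_min c0.
rewrite ge_min lexx/=; apply/allP => z zs; rewrite ge_min.
by rewrite (allP hr z zs) orbT.
Qed.

(** Hoelder continuity of the initial slope in difference-quotient form, with [c] playing the role
    of the derivative at [x0]. *)
Definition initial_holder (l alpha H : R) w : Prop :=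
  forall x0 r : R, - l < x0 < l -> 0 < r -> exists c : R, forall y x : R,
    - l <= y -> x0 - r <= y -> y <= x -> x <= l -> x <= x0 + r ->
    (c - H * r `^ alpha) * (x - y) <= w 0 x - w 0 y <=
      (c + H * r `^ alpha) * (x - y).

(** With [a_] the coefficient at the centre and [a_ >= 2 * lam], a variation of [A] below [lam / 2]
    is below [a_ / 4]. Nearby coefficients then lie in [[mu, 2 * mu]] for [mu = 3 / 4 * a_], so the
    second pass runs with ratio 2. The factor 2 in [2 * lam] leaves room for [lam <= mu], so the
    cylinders of the second pass lie inside those of the first. *)
Lemma holder_estimate (T l M lam Lam F N P H alpha delta : R) A :
  0 < l -> 0 < lam -> lam <= Lam -> 0 <= F -> 0 <= N -> 0 < P -> 0 <= H ->
  0 < delta <= alpha -> alpha < 1 -> 1 - gain 2 <= (1 / 32) `^ delta ->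
  (forall t x z p : R, 0 <= t <= T -> - l <= x <= l -> `|z| <= M -> `|p| <= P ->
     2 * lam <= A t x z p <= Lam) ->
  (forall e : R, 0 < e -> exists2 d : R, 0 < d &
     forall t x z p t' x' z' p' : R, 0 <= t <= T -> - l <= x <= l -> `|z| <= M
       ->
     `|p| <= P -> 0 <= t' <= T -> - l <= x' <= l -> `|z'| <= M -> `|p'| <= P ->
     `|t - t'| < d -> `|x - x'| < d -> `|z - z'| < d -> `|p - p'| < d ->
     `|A t x z p - A t' x' z' p'| < e) ->
  exists C : R, forall (tau : R) w v, tau <= T ->
    bounded_flow l tau M F N P A w v -> initial_holder l alpha H w ->
    (forall t y x : R, 0 < t < tau -> - l < y < l -> - l < x < l -> y != x ->
       `|v t y - v t x| <= C * `|y - x| `^ delta) /\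
    (forall s t x : R, 0 < s < tau -> 0 < t < tau -> - l < x < l -> s < t ->
       `|v t x - v s x| <= C * `|t - s| `^ (delta / 2)).
Proof.
move=> l0 lam0 lamL F0 N0 P0 H0 da a1 gd hA hAu.
have /andP[d0 dla] := da.
have a0 : 0 < alpha by exact: lt_le_trans dla.
pose kap := Lam / lam.
have kap1 : 1 <= kap by rewrite ler_pdivlMr// mul1r.
have kapE : kap * lam = Lam by rewrite /kap divfK// gt_eqF.
have Lam0 : 0 < Lam by exact: lt_le_trans lamL.
(* The ratio [kap] depends on [P], hence so does [del1]; this exponent is only
   used to make [v] nearly constant on cylinders of radius [r2]. *)
have [del1 /andP[del10 del1a] gd1]
  := @holder_exponent R kap alpha ltac:(by rewrite a0).
pose F' := F + 2 * N.
have F'0 : 0 <= F' by rewrite addr_ge0// mulr_ge0.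
have omega (k r : R) : 0 < r -> exists om : R, [/\ 2 * P <= om, 0 < om,
    4 * (H * r `^ alpha) <= om & forall mu, lam <= mu ->
    F' * r <= gain k / 2 * (mu * om)].
  move=> r0; have /andP[g0 _] := gain_bounds k.
  have g2 : 0 < gain k / 2 by exact: divr_gt0.
  (* Each summand meets one requirement; the last absorbs [F'] for the smallest admissible [mu],
     namely [lam]. *)
  pose om := 2 * P + 4 * (H * r `^ alpha) + 2 * (F' * r) / (gain k * lam).
  have p1 : 0 <= H * r `^ alpha by rewrite mulr_ge0 ?powR_ge0.
  have p2 : 0 <= 2 * (F' * r) / (gain k * lam).
    by rewrite divr_ge0 ?mulr_ge0 ?(ltW r0) ?(ltW g0) ?(ltW lam0).
  exists om; rewrite /om; split; try by move: p1 p2 P0; clear; lra.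
  move=> mu lmu; apply: (@le_trans _ _ (gain k / 2 * (lam * om))).
    have FE : F' * r = gain k / 2 * (lam * (2 * (F' * r) / (gain k * lam))).
      by field; rewrite !gt_eqF.
    rewrite {1}FE.
    apply: ler_wpM2l; first exact: ltW.
    apply: ler_wpM2l; first exact: ltW.
    rewrite /om.
    by move: p1 P0; clear; lra.
  apply: ler_wpM2l; first exact: ltW.
  apply: ler_wpM2r; last by [].
  rewrite /om.
  by move: p1 p2 P0; clear; lra.
have [om1 [om1P om10 om1H om1F]] := omega kap l l0.
have [d dp hd] := hAu (lam / 2) ltac:(exact: divr_gt0).
(* This is the parameter of [time_modulus]: it makes [P * e1] at most [d / 4], and [C1] is the
   resulting rate. *)
pose e1 := d / (4 * (P + 1)).
have P10 : 0 < P + 1 by rewrite addr_gt0.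
have e10 : 0 < e1 by rewrite divr_gt0// mulr_gt0.
have e1E : P * e1 <= d / 4.
  have -> : d / 4 = (P + 1) * e1 by rewrite /e1; field; rewrite gt_eqF.
  by rewrite ler_pM2r// lerDl.
clearbody e1.
pose C1 := Lam * P / (2 * e1) + F + N + 1.
have C10 : 0 < C1.
  have : 0 <= Lam * P / (2 * e1).
    by rewrite divr_ge0 ?mulr_ge0 ?(ltW Lam0) ?(ltW P0) ?(ltW e10).
  by rewrite /C1; move: F0 N0; clear; lra.
(* Solves [(32 * rv / l) ^ del1 * om1 = d / 2], so the first pass confines [v] to a range of [d / 2]
   below this radius. *)
pose rv := l / 32 * (d / (2 * om1)) `^ (del1^-1).
have rv0 : 0 < rv by rewrite mulr_gt0 ?powR_gt0 ?divr_gt0 ?mulr_gt0.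
have p3 : 0 < d / 2 by exact: divr_gt0.
have p4 : 0 < e1 / 2 by exact: divr_gt0.
have p5 : 0 < lam * d / 2 by rewrite divr_gt0// mulr_gt0.
have p6 : 0 < lam * (d / (4 * C1)) by rewrite mulr_gt0// divr_gt0// mulr_gt0.
(* In order: [l] for the reflection, 1 for [r2 ^ 2 <= r2], [d / 2] for the variation of [x],
   [e1 / 2] for that of [w] in space, [lam * d / 2] for that of [t], [lam * (d / (4 * C1))] for that
   of [w] in time, and [rv] for that of [v]. *)
have [r2 r20] := @small_bound [:: l; 1; d / 2; e1 / 2; lam * d / 2;
    lam * (d / (4 * C1)); rv] ltac:(by rewrite /= ltr01 rv0 l0 p3 p4 p5 p6).
move=> /= /and5P[r2l r21 r2d r2e /and4P[r2t r2c r2v _]].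
have [om [omP om0 omH omF]] := omega 2 r2 r20.
pose W r := (32 * r / r2) `^ delta * om.
exists (om * (32 / r2) `^ delta + om * (32 * Num.sqrt Lam / r2) `^ delta).
move=> tau w v tT fl init.
have cw := flow_cont fl.
have tTb (t : R) : 0 < t < tau -> 0 <= t <= T.
  by move=> /andP[t0 tt]; rewrite ltW//= (le_trans (ltW tt)).
have hAt (t x : R) : 0 < t < tau -> - l < x < l ->
    2 * lam <= A t x (w t x) (v t x) <= Lam.
  move=> tb xb; apply: hA; [exact: tTb| | |].
  - by case/andP: xb => /ltW-> /ltW.
  - exact: (flow_bound fl).
  - exact: (flow_v_bound fl tb xb).
have bt0 (t0 r mu : R) : 0 <= bottom t0 r mu by rewrite /bottom le_max lexx.
have tlt (t0 r mu t : R) : 0 < t0 < tau -> bottom t0 r mu < t <= t0 -> 0 < t <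
  tau.
  move=> /andP[t00 t0t] /andP[t1 t2]; rewrite (le_lt_trans (bt0 _ _ _) t1)/=.
  exact: le_lt_trans t0t.
have xlt (x0 r x : R) : - l < x0 < l -> r <= l -> `|x - x0| < r -> `|x| < 3 * l.
  move=> /andP[x01 x02] rl; rewrite !ltr_norml => /andP[x1 x2].
  by move: x01 x02 rl x1 x2 l0; clear; lra.
have par1 (t x : R) : 0 < t < tau -> `|x| < 3 * l ->
    parabolic_at (odd_reflect w l) lam Lam F' t x.
  move=> tb xb; apply: (flow_parabolic l0 F0 N0 lamL fl tb xb);
    set y := fold_itv l x => yb.
  have /andP[h1 h2] := hAt t y tb yb.
  by rewrite h2 andbT; move: h1 lam0; clear; lra.
have near_v (t0 x0 t x : R) : 0 < t0 < tau -> - l < x0 < l ->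
    bottom t0 r2 lam < t <= t0 -> `|x - x0| < r2 -> - l < x < l ->
    `|v t x - v t0 x0| < d.
  move=> t0b x0b tb xb xlb.
  have /andP[t00 t0t] := t0b; have /andP[tb1 tb2] := tb.
  have x0b' : - l <= x0 <= l by case/andP: x0b => /ltW-> /ltW.
  have [m hm] : exists m : R, slopes (odd_reflect w l) (bottom t0 r2 lam) t0
      (x0 - r2) (x0 + r2) m (m + (32 * r2 / l) `^ del1 * om1).
    apply: (@local_holder R w l t0 x0 l lam kap F' H P om1 del1 alpha) => //.
    - by rewrite l0 lexx.
    - exact: ltW.
    - by rewrite del10.
    - by apply: (flow_slopes fl); rewrite ltW.
    - by move=> r r0; exact: init.
    - move=> s y sb yb; rewrite kapE; apply: par1; first exact: tlt sb.
      exact: (xlt x0 l).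
    - exact: om1F.
    - by rewrite r20.
  have wd : (32 * r2 / l) `^ del1 * om1 <= d / 2.
    have h1 : 32 * r2 / l <= (d / (2 * om1)) `^ (del1^-1).
      rewrite ler_pdivrMr//; move: r2v; rewrite /rv; set z := _ `^ _.
      by clear; lra.
    have : (32 * r2 / l) `^ del1 <= d / (2 * om1).
      apply: (@le_trans _ _ (((d / (2 * om1)) `^ (del1^-1)) `^ del1)).
        apply: ge0_ler_powR; [exact: ltW| | |exact: h1].
          by rewrite nnegrE divr_ge0 ?mulr_ge0 ?(ltW r20) ?(ltW l0).
        by rewrite nnegrE powR_ge0.
      rewrite -powRrM mulVf ?gt_eqF// powRr1// divr_ge0 ?(ltW dp)//.
      by rewrite mulr_ge0 ?(ltW om10).
    by rewrite -(ler_pM2r om10) => /le_trans; apply; rewrite le_eqVlt;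
      apply/orP; left; apply/eqP; field; rewrite gt_eqF.
  have lohi : x0 - r2 < x0 + r2 by move: r20; clear; lra.
  have thb : bottom t0 r2 lam <= t <= t0 by rewrite ltW.
  have thb0 : bottom t0 r2 lam <= t0 <= t0 by rewrite lexx (le_trans (ltW tb1)).
  have xbb : x0 - r2 <= x <= x0 + r2.
    by move: xb; rewrite ltr_norml; clear; lra.
  have x0bb : x0 - r2 <= x0 <= x0 + r2 by move: r20; clear; lra.
  have := flow_slopes_v fl hm thb (tlt _ _ _ _ t0b tb) xbb lohi xlb.
  have := flow_slopes_v fl hm thb0 t0b x0bb lohi x0b.
  move: wd dp; set z := _ * om1; rewrite ltr_norml.
  by clear; lra.
have near_w (t0 x0 t x : R) : 0 < t0 < tau -> - l < x0 < l ->
    bottom t0 r2 lam < t <= t0 -> `|x - x0| < r2 -> - l < x < l ->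
    `|t - t0| < d /\ `|w t x - w t0 x0| < d.
  move=> t0b x0b tb xb xlb.
  have /andP[t00 t0t] := t0b; have /andP[tb1 tb2] := tb.
  have x0b' : - l <= x0 <= l by case/andP: x0b => /ltW-> /ltW.
  have xb' : - l <= x <= l by case/andP: xlb => /ltW-> /ltW.
  have tp : 0 <= t by exact: le_trans (bt0 _ _ _) (ltW tb1).
  have dt1 : t0 - t <= r2 / lam.
    have : t0 - r2 ^+ 2 / lam < t by apply: le_lt_trans tb1;
      rewrite /bottom le_max lexx orbT.
    have : r2 ^+ 2 / lam <= r2 / lam.
      by rewrite ler_pM2r ?invr_gt0// expr2 ger_pMr.
    by clear; lra.
  have dt2 : t0 - t <= d / 2.
    apply: (le_trans dt1); rewrite ler_pdivrMr//; move: r2t; clear; lra.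
  have dt3 : C1 * (t0 - t) <= d / 4.
    apply: (@le_trans _ _ (C1 * (d / (4 * C1)))).
      rewrite ler_pM2l// (le_trans dt1)// ler_pdivrMr//.
      by move: r2c; set z := d / _; clear; lra.
    by rewrite le_eqVlt; apply/orP; left; apply/eqP; field; rewrite gt_eqF.
  split.
    by rewrite distrC ger0_norm ?subr_ge0//; move: dt2 dp; clear; lra.
  have slw : slopes w 0 t0 (- l) l (- P) P by apply: (flow_slopes fl);
    rewrite ltW.
  have sptm (z : R -> R -> R) : continuous (fun q : R * R => z q.1 q.2) ->
      slopes z 0 t0 (- l) l (- P) P ->
      (forall t x : R, 0 < t <= t0 -> - l < x < l -> parabolic_at z lam Lam F t
        x) ->
      (forall t x : R, 0 < t <= t0 -> x = l \/ x = - l ->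
        exists2 D : R, lderiv (z ^~ x) t D & D <= N) ->
      z t0 x0 - z t x0 <= d / 2.
    move=> cz slz eqz bz.
    have := time_modulus l0 lam0 F0 N0 (ltW P0)
      e10 cz slz eqz bz tp tb2 (lexx _) x0b'.
    by rewrite -/C1; move: e1E dt3; clear; lra.
  have eqw (s y : R) : 0 < s <= t0 -> - l < y < l -> parabolic_at w lam Lam F s
    y.
    move=> /andP[s0 s1] yb.
    have sb : 0 < s < tau by rewrite s0 (le_lt_trans s1).
    have [D [L [f [hD hL _ hf e]]]] := flow_eq fl sb yb.
    exists D, L, (A s y (w s y) (v s y)), f; split => //.
    have /andP[h1 ->] := hAt s y sb yb.
    by rewrite andbT; move: h1 lam0; clear; lra.
  have h1 : w t0 x0 - w t x0 <= d / 2.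
    apply: sptm => // s c /andP[s0 s1] cl.
    have sb : 0 < s < tau by rewrite s0 (le_lt_trans s1).
    have [D hD hN] := flow_side fl sb cl; exists D => //.
    exact: le_trans (ler_norm _) hN.
  have h2 : - w t0 x0 - - w t x0 <= d / 2.
    apply: (sptm (fun t x => - w t x)).
    - by move=> q; apply: continuousN; exact: cw.
    - move=> s y z sb h3 h4 h5; have := slw s y z sb h3 h4 h5.
      by clear; lra.
    - move=> s y sb yb; have [D [L [a [f [hD hL ab hf e]]]]] := eqw s y sb yb.
      exists (- D), (- L), a, (- f); split => //.
      + exact: lderivN.
      + exact: sderiv2N.
      + by rewrite normrN.
      + by rewrite e; ring.
    - move=> s c /andP[s0 s1] cl.
      have sb : 0 < s < tau by rewrite s0 (le_lt_trans s1).
      have [D hD hN] := flow_side fl sb cl; exists (- D); first exact: lderivN.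
      by apply: le_trans (ler_norm _) _; rewrite normrN.
  have h3 : `|w t x - w t x0| <= d / 8.
    have Px : P * `|x - x0| <= d / 8.
      apply: (@le_trans _ _ (P * (e1 / 2))).
        by rewrite ler_pM2l// (le_trans (ltW xb)).
      by move: e1E; clear; lra.
    have tb' : 0 <= t <= t0 by rewrite tp.
    have /andP[x1 x2] := xb'; have /andP[x3 x4] := x0b'.
    have [xx|xx] := leP x0 x.
      have := slw t x0 x tb' x3 xx x2.
      move: Px; rewrite ger0_norm ?subr_ge0// ler_norml.
      by clear; lra.
    have := slw t x x0 tb' x1 (ltW xx) x4.
    move: Px; rewrite ler0_norm ?subr_le0 ?(ltW xx)// ler_norml.
    by clear; lra.
  by move: h1 h2 h3 dp; rewrite ler_norml ltr_norml; clear; lra.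
have main (t0 x0 r : R) : 0 < t0 < tau -> - l < x0 < l -> 0 < r <= r2 ->
    exists2 mu : R, 0 < mu <= Lam & forall t x : R,
      0 < t -> bottom t0 r mu <= t ->
      t <= t0 -> `|x - x0| <= r -> - l < x < l -> `|v t x - v t0 x0| <= W r.
  move=> t0b x0b rb; have /andP[t00 t0t] := t0b.
  have x0b' : - l <= x0 <= l by case/andP: x0b => /ltW-> /ltW.
  set a_ := A t0 x0 (w t0 x0) (v t0 x0).
  have /andP[a_1 a_2] : 2 * lam <= a_ <= Lam by exact: hAt.
  pose mu := 3 / 4 * a_.
  have lmu : lam <= mu by rewrite /mu; move: a_1 lam0; clear; lra.
  have mu0 : 0 < mu by exact: lt_le_trans lmu.
  exists mu; first by rewrite mu0 /mu; move: a_1 a_2 lam0; clear; lra.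
  have bl : bottom t0 r2 lam <= bottom t0 r2 mu.
    apply: bottom_le; rewrite ler_wpM2l ?sqr_ge0//.
    by rewrite lef_pV2// posrE.
  have [m hm] : exists m : R, slopes (odd_reflect w l) (bottom t0 r mu) t0
      (x0 - r) (x0 + r) m (m + W r).
    apply: (@local_holder R w l t0 x0 r2 mu 2 F' H P om delta alpha) => //.
    - by rewrite r20.
    - by rewrite ler1n.
    - exact: ltW.
    - by apply: (flow_slopes fl); rewrite ltW.
    - by move=> r' r'0; exact: init.
    - move=> t x tb xb.
      have tb' : bottom t0 r2 lam < t <= t0.
        by case/andP: tb => h1 ->; rewrite (le_lt_trans bl).
      have tbt := tlt _ _ _ _ t0b tb'.
      have mu2 : mu <= 2 * mu by move: mu0; clear; lra.
      apply: (flow_parabolic l0 F0 N0 mu2 fl tbt (xlt _ _ _ x0b r2l xb)).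
      set y := fold_itv l x => yb.
      have yx : `|y - x0| < r2 by exact: le_lt_trans (fold_near x x0b') xb.
      have [h1 h2] := near_w _ _ _ _ t0b x0b tb' yx yb.
      have h3 := near_v _ _ _ _ t0b x0b tb' yx yb.
      have yb' : - l <= y <= l by case/andP: yb => /ltW-> /ltW.
      have h4 : `|y - x0| < d.
        by apply: (lt_le_trans yx); move: r2d dp; clear; lra.
      have := hd _ _ _ _ _ _ _ _ (tTb t tbt) yb' (flow_bound fl t y)
        (flow_v_bound fl tbt yb) (tTb t0 t0b) x0b' (flow_bound fl t0 x0)
        (flow_v_bound fl t0b x0b) h1 h4 h2 h3.
      rewrite -/a_ ltr_norml; rewrite /mu; move: a_1 lam0; clear; lra.
    - exact: omF.
  move=> t x t1 t2 t3 xb xlb.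
  have /andP[r0 _] := rb.
  have lohi : x0 - r < x0 + r by move: r0; clear; lra.
  have thb : bottom t0 r mu <= t <= t0 by rewrite t2.
  have thb0 : bottom t0 r mu <= t0 <= t0 by rewrite lexx (le_trans t2).
  have xbb : x0 - r <= x <= x0 + r.
    by move: xb; rewrite ler_norml; clear; lra.
  have x0bb : x0 - r <= x0 <= x0 + r by move: r0; clear; lra.
  have tbt : 0 < t < tau by rewrite t1 (le_lt_trans t3).
  have := flow_slopes_v fl hm thb tbt xbb lohi xlb.
  have := flow_slopes_v fl hm thb0 t0b x0bb lohi x0b.
  by rewrite ler_norml; clear; lra.
(* For distances beyond [r2] the bound follows from [|v| <= P], as [om] was taken at least
   [2 * P]. *)
have big (r : R) : r2 < r -> 2 * P <= W r.
  move=> rr; apply: (le_trans omP); rewrite /W ler_peMl ?(ltW om0)//.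
  have h1 : 1 <= 32 * r / r2.
    by rewrite ler_pdivlMr// mul1r; move: rr r20; clear; lra.
  apply: (@le_trans _ _ (1 `^ delta)); first by rewrite powR1.
  apply: ge0_ler_powR; [exact: ltW|by rewrite nnegrE| |exact: h1].
  by rewrite nnegrE (le_trans ler01).
have vv (t y s x : R) : 0 < t < tau -> - l < y < l -> 0 < s < tau -> - l < x <
  l ->
    `|v t y - v s x| <= 2 * P.
  move=> tb yb sb xb; apply: (le_trans (ler_normB _ _)).
  have := flow_v_bound fl tb yb; have := flow_v_bound fl sb xb.
  by clear; lra.
have om_ge0 := ltW om0.
have q0 (z : R) : 0 <= om * z `^ delta by rewrite mulr_ge0 ?powR_ge0.
split.
- move=> t y x tb yb xb yx; set r := `|y - x|.
  have r0 : 0 < r by rewrite normr_gt0 subr_eq0.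
  apply: (@le_trans _ _ (W r)).
    have [rr|rr] := leP r r2; last by apply: le_trans (big r rr); exact: vv.
    have [mu /andP[mu0 _] h] := main t x r tb xb ltac:(by rewrite r0).
    case/andP: tb => t0 tt; apply: h => //.
    by rewrite /bottom ge_max (ltW t0)/= lerBlDr lerDl divr_ge0 ?sqr_ge0 ?(ltW
      mu0).
  have -> : W r = om * (32 / r2) `^ delta * r `^ delta.
    rewrite /W (_ : 32 * r / r2 = 32 / r2 * r); last by ring.
    by rewrite powRM ?(ltW r0) ?divr_ge0 ?(ltW r20)//; ring.
  by rewrite ler_wpM2r ?powR_ge0// lerDl.
- move=> s t x sb tb xb st.
  set D := `|t - s|.
  have DE : D = t - s by rewrite /D gtr0_norm ?subr_gt0.
  have D0 : 0 < D by rewrite DE subr_gt0.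
  (* As [mu <= Lam], the cylinder of this radius has height [r ^ 2 / mu >= D] and reaches down to
     [s], unless it is cut at 0. *)
  pose r := Num.sqrt (Lam * D).
  have r0 : 0 < r by rewrite sqrtr_gt0 mulr_gt0.
  apply: (@le_trans _ _ (W r)).
    have [rr|rr] := leP r r2; last by apply: le_trans (big r rr); exact: vv.
    have [mu /andP[mu0 muL] h] := main t x r tb xb ltac:(by rewrite r0).
    rewrite distrC; case/andP: sb => s0 ss; apply: h => //.
    + rewrite /bottom ge_max (ltW s0)/= sqr_sqrtr ?mulr_ge0 ?(ltW D0)
      ?(ltW Lam0)//.
      have : D <= Lam * D / mu.
        by rewrite ler_pdivlMr// mulrC ler_pM2r.
      by rewrite {1}DE; clear; lra.
    + exact: ltW.
    + by rewrite subrr normr0 ltW.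
  have -> : W r = om * (32 * Num.sqrt Lam / r2) `^ delta * D `^ (delta / 2).
    rewrite /W /r sqrtrM ?(ltW Lam0)//.
    rewrite (_ : 32 * (Num.sqrt Lam * Num.sqrt D) / r2 =
      32 * Num.sqrt Lam / r2 * Num.sqrt D); last by ring.
    rewrite powRM ?sqrtr_ge0//; last first.
      by rewrite divr_ge0 ?mulr_ge0 ?sqrtr_ge0 ?(ltW r20).
    rewrite -[Num.sqrt D]powR12_sqrt ?(ltW D0)// -powRrM [2^-1 * delta]mulrC.
    by ring.
  by rewrite ler_wpM2r ?powR_ge0// lerDr.
Qed.

End HolderEstimate.

(** By the mean value theorem a difference quotient is a value of the derivative at an interior
    point, so the seminorm on the open interval is enough; [c] is the derivative at [x0]. Taking
    [|h|] provides the nonnegative constant required later. *)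
Lemma derive_within_initial (R : realType) (alpha l h : R) (u0 w0 : R -> R) :
  0 < l -> 0 < alpha -> continuous w0 -> (forall x : R,
    - l <= x <= l -> w0 x = u0 x) ->
  C1_on `[- l, l] u0 ->
  holder_seminorm alpha `]- l, l[ (derive_within `[- l, l] u0) = h%:E ->
  initial_holder l alpha `|h| (fun=> w0).
Proof.
move=> l0 a0 cw wE [du _] hs x0 r x0b r0.
set d0 := derive_within `[- l, l] u0 in hs.
exists (d0 x0) => y x y1 y2; rewrite le_eqVlt => /orP[/eqP<- _ _|yx x1 x2].
  by rewrite !subrr !mulr0 lexx.
have [||z] := @MVT R w0 d0 y x yx.
- move=> z; rewrite in_itv/= => /andP[z1 z2].
  have zb : - l < z < l by rewrite (le_lt_trans y1)// (lt_le_trans z2).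
  apply: within_interior_is_derive => //; apply: du.
  by rewrite /= in_itv/= !ltW//; case/andP: zb.
- exact: continuous_subspaceT.
rewrite in_itv/= => /andP[z1 z2] ->.
have zb : - l < z < l by rewrite (le_lt_trans y1)// (lt_le_trans z2).
have hz : `|d0 z - d0 x0| <= `|h| * r `^ alpha.
  have [->|zx] := eqVneq z x0; first
    by rewrite subrr normr0 mulr_ge0// powR_ge0.
  have zx0 : 0 < `|z - x0| by rewrite normr_gt0 subr_eq0.
  have hq : `|d0 z - d0 x0| <= h * `|z - x0| `^ alpha.
    rewrite -ler_pdivrMr; last exact: powR_gt0.
    rewrite -lee_fin -hs; apply: ereal_sup_ubound; exists (z, x0); last by [].
    by split => //=; rewrite in_itv.
  have zr : `|z - x0| <= r.
    by rewrite ler_norml; move: z1 z2 y2 x2; clear; lra.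
  apply: (le_trans hq); apply: (@le_trans _ _ (`|h| * `|z - x0| `^ alpha)).
    by rewrite ler_wpM2r ?powR_ge0// ler_norm.
  rewrite ler_wpM2l//; apply: ge0_ler_powR; rewrite ?nnegrE//; exact: ltW.
rewrite !ler_pM2r ?subr_gt0//; move: hz; rewrite ler_norml.
by clear; lra.
Qed.

Theorem corollary3p4 (R : realType) (T l : R)
    (a f b g : R -> R -> R -> R -> R)
    (T_gt0 : 0 < T) (l_gt0 : 0 < l)
    (a_cont : continuous_interior T l a)
    (f_cont : continuous_interior T l f)
    (b_contr : continuous_boundary T l b)
    (b_contl : continuous_boundary T (- l) b)
    (g_contr : continuous_boundary T l g)
    (g_contl : continuous_boundary T (- l) g)
    (a_gt0 : forall t x z p, 0 <= t <= T -> - l <= x <= l -> 0 < a t x z p)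
    (b_gt0 : forall t z p, 0 <= t <= T -> 0 < b t l z p /\ 0 < b t (- l) z p)
    (M alpha : R) (M_gt0 : 0 < M) (alpha01 : 0 < alpha < 1) :
  exists2 delta : R, 0 < delta <= alpha &
  forall (q0 : R) (psi : R -> R),
    C1_on `[0, +oo[ psi ->
    (forall q, 0 <= q -> 1 <= psi q) ->
    ((2 * M)%:E <
       \int[lebesgue_measure]_(rho in `[q0, +oo[) (rho / psi rho)%:E)%E ->
    (forall t x z p, 0 <= t <= T -> - l <= x <= l -> - M <= z <= M ->
       `|f t x z p| <= a t x z p * psi `|p|) ->
    (forall t z p, 0 < t <= T -> - M <= z <= M -> q0 <= p ->
       [/\ g t l z p <= b t l z p * p,
           - g t l z (- p) <= b t l z (- p) * p,
           - g t (- l) z p <= b t (- l) z p * p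
         & g t (- l) z (- p) <= b t (- l) z (- p) * p]) ->
  forall h : R,
  exists Cstar : R,
  forall (u0 : R -> R) (K : R),
    C1_holder alpha l u0 ->
    holder_seminorm alpha `]- l, l[ (derive_within `[- l, l] u0) = h%:E ->
    (forall x y, - l <= x <= l -> - l <= y <= l ->
       `|u0 x - u0 y| <= K * `|x - y|) ->
    K <= q0 ->
  forall (tau : R) (u : R -> R -> R),
    0 < tau <= T ->
    C12_on tau l (closed_cyl tau l) u ->
    classical_solution tau l a f b g u ->
    (forall x, - l <= x <= l -> u 0 x = u0 x) ->
    (sup_norm (open_cyl tau l) u <= M%:E)%E ->
    (parabolic_seminorm delta tau l (dx l u) <= Cstar%:E)%E.

Proof.
(* The second pass has ratio 2 whatever the data, so [delta] is available before [q0] and [psi] are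
   given. *)
have [delta da gd] := holder_exponent 2 alpha01.
have /andP[alpha0 alpha1] := alpha01; have /andP[delta0 _] := da.
exists delta => // q0 psi hpsi psi1 hint fa gb h.
have [q00|q0neg] := leP 0 q0; last first.
  (* A negative [q0] would force a negative Lipschitz constant [K] on a nondegenerate interval, so
     any constant does. *)
  exists 0 => u0 K _ _ hK Kq; exfalso.
  have := hK l (- l); rewrite lexx andbT => /(_ ltac:(lra)).
  move=> /(_ ltac:(by rewrite lexx; lra)).
  have : K * `|l - - l| < 0.
    by rewrite nmulr_rlt0 ?(le_lt_trans Kq)// normr_gt0; lra.
  have := normr_ge0 (u0 l - u0 (- l)); lra.
have [P [kap [hp prof]]] := profile_exists q00 M_gt0 hpsi psi1 hint.
have P0 : 0 < P.
  have kap0 := profile_gt0 prof; have := profile_ge prof.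
  have /andP[_] := profile_lin prof (d := kap) ltac:(by rewrite lexx ltW).
  move=> h1 h2; rewrite -(pmulr_lgt0 _ kap0)
    (lt_le_trans _ h1)// (lt_le_trans _ h2)//.
  by rewrite mulr_gt0.
have ll : - l <= l by move: l_gt0; clear; lra.
have T0 := ltW T_gt0.
pose K4 : set (R * R * R * R) :=
  ((`[0, T] `*` `[- l, l]) `*` `[- M, M]) `*` `[- P, P].
have cK4 : compact K4 by do !apply: compact_setX; exact: segment_compact.
have K4P (t x z p : R) : 0 <= t <= T -> - l <= x <= l -> `|z| <= M -> `|p| <= P
  ->
    K4 (t, x, z, p).
  by rewrite !ler_norml => tb xb zb pb; do !split; rewrite /= in_itv/=.
pose K3 : set (R * R * R) := (`[0, T] `*` `[- M, M]) `*` `[- P, P].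
have cK3 : compact K3 by do !apply: compact_setX; exact: segment_compact.
have K3P (t z p : R) : 0 <= t <= T -> `|z| <= M -> `|p| <= P -> K3 (t, z, p).
  by rewrite !ler_norml => tb zb pb; do !split; rewrite /= in_itv/=.
(* Clamping [t] and [x] makes a coefficient continuous everywhere, so that its bounds and its
   uniform continuity come from compactness. *)
pose cl (c : R -> R -> R -> R -> R) (q : R * R * R * R) :=
  c (clamp 0 T q.1.1.1) (clamp (- l) l q.1.1.2) q.1.2 q.2.
have clE c (t x z p : R) : 0 <= t <= T -> - l <= x <= l ->
    cl c (t, x, z, p) = c t x z p.
  by move=> tb xb; rewrite /cl/= !clamp_id.
have c1 (A B : topologicalType) : continuous (@fst A B) by move=> q;
  exact: cvg_fst.
have c2 (A B : topologicalType) : continuous (@snd A B) by move=> q;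
  exact: cvg_snd.
have cpair (A B C : topologicalType) (p : A -> B) (q : A -> C) :
    continuous p -> continuous q -> continuous (fun z => (p z, q z)).
  by move=> cp cq z; exact: (cvg_pair (cp z) (cq z)).
have ccl c : continuous_interior T l c -> continuous (cl c).
  move=> hc; apply: (cont_within_comp (phi := fun q : R * R * R * R =>
    (clamp 0 T q.1.1.1, clamp (- l) l q.1.1.2, q.1.2, q.2)) hc).
    apply: (cpair _ _ _ _ _); last exact: c2.
    apply: (cpair _ _ _ _ _); last by apply: (cont_comp (c2 _ _)); exact: c1.
    apply: (cpair _ _ _ _ _); apply: (cont_comp (@continuous_clamp _ _ _)).
      by do 2 apply: (cont_comp (c1 _ _)); exact: c1.
    by apply: (cont_comp (c2 _ _)); apply: (cont_comp (c1 _ _)); exact: c1.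
  by move=> q; split; rewrite /= in_itv/= clamp_itv.
pose sd (c : R -> R -> R -> R -> R) (x : R) (q : R * R * R) :=
  c (clamp 0 T q.1.1) x q.1.2 q.2.
have csd c x : continuous_boundary T x c -> continuous (sd c x).
  move=> hc; apply: (cont_within_comp (phi := fun q : R * R * R =>
    (clamp 0 T q.1.1, q.1.2, q.2)) hc).
    apply: (cpair _ _ _ _ _); last exact: c2.
    apply: (cpair _ _ _ _ _); last by apply: (cont_comp (c2 _ _)); exact: c1.
    apply: (cont_comp (@continuous_clamp _ _ _)).
    by apply: (cont_comp (c1 _ _)); exact: c1.
  by move=> q; rewrite /= clamp_itv.
have bsd c x : continuous_boundary T x c -> exists2 B : R, 0 <= B &
    forall t z p : R, 0 <= t <= T -> `|z| <= M -> `|p| <= P -> `|c t x z p| <=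
      B.
  move=> /csd cc; have [B B0 hB] := compact_bound cK3 cc;
    exists B => // t z p tb zb pb.
  by have := hB (t, z, p) (K3P _ _ _ tb zb pb); rewrite /sd/= clamp_id.
have [la la0 hla] : exists2 c : R, 0 < c & forall q, K4 q -> c <= cl a q.
  apply: (compact_pos_min cK4 (ccl _ a_cont)) => q [[[]]]/=;
    rewrite !in_itv/= => tb xb _ _.
  by apply: a_gt0; rewrite clamp_itv.
have [La La0 hLa] := compact_bound cK4 (ccl _ a_cont).
have [F F0 hF] := compact_bound cK4 (ccl _ f_cont).
have [Bb Bb0 hBb] := bsd _ _ b_contr; have [Bb' Bb'0 hBb'] := bsd _ _ b_contl.
have [Bg Bg0 hBg] := bsd _ _ g_contr; have [Bg' Bg'0 hBg'] := bsd _ _ g_contl.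
(* Solving the boundary conditions for [u_t] bounds it by [|g| + |b| * P]; the sum over both ends
   gives one constant. *)
pose N := (Bg + Bb * P) + (Bg' + Bb' * P).
have n1 : 0 <= Bb * P by rewrite mulr_ge0// ltW.
have n2 : 0 <= Bb' * P by rewrite mulr_ge0// ltW.
have N0 : 0 <= N by rewrite /N !addr_ge0.
have lam0 : 0 < la / 2 by exact: divr_gt0.
(* [la / 2] leaves the factor 2 demanded of the lower bound, and adding [la] to [La] makes the two
   ellipticity bounds comparable at once. *)
have lamL : la / 2 <= La + la by move: La0 la0; clear; lra.
have hA (t x z p : R) : 0 <= t <= T -> - l <= x <= l -> `|z| <= M -> `|p| <= P
  ->
    2 * (la / 2) <= a t x z p <= La + la.
  move=> tb xb zb pb; have k4 := K4P _ _ _ _ tb xb zb pb.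
  have := hla _ k4; have := hLa _ k4; rewrite clE// ler_norml => /andP[_ h1] h2.
  by apply/andP; split; move: h1 h2 la0; clear; lra.
have hAu (e : R) : 0 < e -> exists2 d : R, 0 < d &
     forall t x z p t' x' z' p' : R, 0 <= t <= T -> - l <= x <= l -> `|z| <= M
       ->
     `|p| <= P -> 0 <= t' <= T -> - l <= x' <= l -> `|z'| <= M -> `|p'| <= P ->
     `|t - t'| < d -> `|x - x'| < d -> `|z - z'| < d -> `|p - p'| < d ->
     `|a t x z p - a t' x' z' p'| < e.
  move=> e0; have [d d0 hd] := unif_cont4 cK4 (ccl _ a_cont) e0.
  exists d => // t x z p t' x' z' p' h1 h2 h3 h4 h1' h2' h3' h4' k1 k2 k3 k4.
  have := hd (t, x, z, p) (t', x', z', p') (K4P _ _ _ _ h1 h2 h3 h4)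
    (K4P _ _ _ _ h1' h2' h3' h4') k1 k2 k3 k4.
  by rewrite !clE.
have [C hC] := holder_estimate l_gt0 lam0 lamL F0 N0 P0 (normr_ge0 h)
  da alpha1 gd hA hAu.
(* One [C] for the time part of the seminorm and one for the space part. *)
exists (C + C) => u0 K hu0 hsem hK Kq tau u /andP[tau0 tauT] hC12 hcl u0E hM.
have [w [sol wE]] := extract_solution l_gt0 tau0 hC12 hcl hM.
have w0E (x : R) : - l <= x <= l -> w 0 x = u0 x.
  by move=> xb; rewrite wE ?lexx ?(ltW tau0)// u0E.
have init (y x : R) : - l <= y -> y <= x -> x <= l ->
    `|w 0 x - w 0 y| <= q0 * (x - y).
  move=> y1 yx x1; have xb : - l <= x <= l by rewrite x1 (le_trans y1).
  have yb : - l <= y <= l by rewrite y1 (le_trans yx).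
  rewrite !w0E//; apply: (le_trans (hK _ _ xb yb)).
  by rewrite ger0_norm ?subr_ge0// ler_wpM2r ?subr_ge0.
have sl : forall t : R, 0 <= t < tau -> slopes w 0 t (- l) l (- P) P.
  apply: (gradient_estimate l_gt0 tauT q00 prof _ fa gb sol init).
  by move=> t x z p tb xb; exact: a_gt0.
have tT (t : R) : 0 < t < tau -> 0 <= t <= T.
  by move=> /andP[t0 tt]; rewrite ltW//= (le_trans (ltW tt)).
have slt (t : R) : 0 < t < tau -> slopes w 0 t (- l) l (- P) P.
  by move=> /andP[t0 tt]; apply: sl; rewrite ltW.
have tt (t : R) : 0 < t < tau -> 0 <= t <= t by move=> /andP[t0 _];
  rewrite lexx ltW.
have l2 : - l < l by move: l_gt0; clear; lra.
have flow : bounded_flow l tau M F N P a w (dx l u).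
  split; [exact: sol_cont sol|exact: sol_bound sol|exact: sl| |].
  - move=> t x tb xb; have [D [L [hD hL hl hr e]]] := sol_eq sol tb xb.
    have xb' : - l <= x <= l by case/andP: xb => /ltW-> /ltW.
    exists D, L, (f t x (w t x) (dx l u t x)); split => //.
    have pb : `|dx l u t x| <= P.
      rewrite ler_norml; apply: (slopes_lderiv (slt t tb) (tt t tb) _ hl).
      by case/andP: xb => -> /ltW.
    have := hF _ (K4P _ _ _ _ (tT t tb) xb' (sol_bound sol t x) pb).
    by rewrite clE// tT.
  - move=> t c tb [->|->].
    + have [D [hD hl] e] := sol_right sol tb; exists D => //.
      have pb : `|dx l u t l| <= P.
        rewrite ler_norml; apply: (slopes_lderiv (slt t tb) (tt t tb) _ hl).
        by rewrite l2 lexx.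
      have h1 := hBb _ _ _ (tT t tb) (sol_bound sol t l) pb.
      have h2 := hBg _ _ _ (tT t tb) (sol_bound sol t l) pb.
      rewrite (_ : D = g t l (w t l) (dx l u t l)
        - b t l (w t l) (dx l u t l) * dx l u t l); last by rewrite -e addrK.
      apply: (le_trans (ler_normB _ _)); rewrite normrM.
      have : `|b t l (w t l) (dx l u t l)| * `|dx l u t l| <= Bb * P.
        exact: ler_pM.
      by rewrite /N; move: h2 n2 Bg'0; clear; lra.
    + have [D [hD hl] e] := sol_left sol tb; exists D => //.
      have pb : `|dx l u t (- l)| <= P.
        rewrite ler_norml; apply: (slopes_rderiv (slt t tb) (tt t tb) _ hl).
        by rewrite l2 lexx.
      have h1 := hBb' _ _ _ (tT t tb) (sol_bound sol t (- l)) pb.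
      have h2 := hBg' _ _ _ (tT t tb) (sol_bound sol t (- l)) pb.
      rewrite (_ : D = g t (- l) (w t (- l)) (dx l u t (- l))
        + b t (- l) (w t (- l)) (dx l u t (- l)) * dx l u t (- l));
        last by rewrite -e subrK.
      apply: (le_trans (ler_normD _ _)); rewrite normrM.
      have : `|b t (- l) (w t (- l)) (dx l u t (- l))| * `|dx l u t (- l)| <=
        Bb' * P.
        exact: ler_pM.
      by rewrite /N; move: h2 n1 Bg0; clear; lra.
have cw0 : continuous (w 0).
  apply: (cont_uncurry (sol_cont sol) (f := fun=> 0) (g := fun x : R => x)).
    exact: cst_continuous.
  by move=> ?; exact: cvg_id.
have ih : initial_holder l alpha `|h| w.
  by have := derive_within_initial l_gt0 alpha0 cw0 w0E (proj1 hu0) hsem.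
have [hspace htime] := hC tau w (dx l u) tauT flow ih.
rewrite /parabolic_seminorm EFinD; apply: leeD.
- apply: ge_ereal_sup => S [x /=]; rewrite in_itv/= => xb <-.
  apply: ge_ereal_sup => _ [[s t] /= [sb tb st] <-].
  rewrite in_itv/= in sb; rewrite in_itv/= in tb.
  rewrite lee_fin ler_pdivrMr; last by rewrite powR_gt0// normr_gt0 subr_eq0.
  have [lt|lt|E] := ltgtP s t; last by move: st; rewrite E eqxx.
    by rewrite distrC [`|s - t|]distrC; exact: htime.
  exact: htime.
- apply: ge_ereal_sup => S [t /=]; rewrite in_itv/= => tb <-.
  apply: ge_ereal_sup => _ [[y x] /= [yb xb yx] <-].
  rewrite in_itv/= in yb; rewrite in_itv/= in xb.
  rewrite lee_fin ler_pdivrMr; last by rewrite powR_gt0// normr_gt0 subr_eq0.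
  exact: hspace.
Qed.
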